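(* The coefficients $G_s^-(z)$ ($s=0,1,2,\dots$) are rational functions of $z$ whose only poles are at $z=-1$, and, as $\nu\to\infty$ ($\nu$ real and positive), uniformly for $z\in S(\delta)$, $$\mathbf{A}_\nu(\nu z)\sim\frac1\pi\sum_{s=0}^\infty\frac{G_s^-(z)}{\nu^{2s+1}}.$$
   Context: $\mathbf{A}_\nu(z)$ is the associated Anger–Weber function $\mathbf{A}_\nu(z)=\frac1\pi\int_0^\infty\exp(-\nu t-z\sinh t)\,dt$ for $\Re z>0$, extended by analytic continuation to the principal plane. The coefficients are defined by $$G_s^-(z)=z^{-1/2}\{G_{0,s}(z)-G_{-1,s}(z)\},$$ where, for $\mu=0,-1$, $G_{\mu,0}(z)=\dfrac{z^{\mu+3/2}}{z^2-1}$ and $G_{\mu,s+1}(z)=\dfrac{G_{\mu,s}(z)+4z^2G_{\mu,s}''(z)}{4(1-z^2)}$ for $s=0,1,2,\dots$. Equivalently, $G_0^-(z)=\dfrac1{z+1}$ and $G_{s+1}^-(z)=\dfrac{z\,{G_s^-}'(z)+z^2{G_s^-}''(z)}{1-z^2}$. $\delta\in(0,1)$ is an arbitrary small constant and $S(\delta)$ is the cut principal plane $-\pi<\arg z\le\pi$ with all points at distance less than $\delta$ from the interval $-\infty<z\le-1$ removed. If a function is unbounded at $z=0$ that point is excluded, but expansions are uniformly valid arbitrarily close to it. *)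

(* Defs.v *)
(* Analysis over the Stdlib reals, with Coquelicot's complex numbers [C].  The
   principal branch is [-PI < arg <= PI] throughout, so the cut principal plane
   is all of [C], points of the cut being approached from [Im z > 0]. *)
From Stdlib Require Export Reals List.
From Coquelicot Require Export Coquelicot.
Open Scope R_scope.

Definition Cexp (z : C) : C := (exp (Re z) * cos (Im z), exp (Re z) * sin (Im z)).

Definition Carg (z : C) : R :=
  if Rle_dec 0 (Im z) then acos (Re z / Cmod z) else - acos (Re z / Cmod z).

Definition Clog (z : C) : C := (ln (Cmod z), Carg z).

(* Principal value of [z ^ a], for [z <> 0]. *)
Definition Cpowr (z : C) (a : R) : C := Cexp (RtoC a * Clog z)%C.

(* The plane cut along the nonpositive real axis. *)
Definition slit_plane (z : C) : Prop := Im z <> 0 \/ 0 < Re z.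

Definition holomorphic_on (D : C -> Prop) (f : C -> C) : Prop :=
  forall z, D z -> @ex_derive C_AbsRing C_NormedModule f z.

(* [A] is the associated Anger-Weber function of order [nu > 0].  The integral
   converges (improperly at infinity) to [PI * A z] for [Re z > 0]; [A] is its
   analytic continuation to the slit plane, extended by continuity from above
   to the cut ([arg z = PI]) and by continuity to the origin, where a finite
   limit exists because [nu > 0]. *)
Definition is_anger_weber (nu : R) (A : C -> C) : Prop :=
  (forall z : C, 0 < Re z ->
     @is_RInt_gen C_R_NormedModule
       (fun t : R => Cexp (- RtoC (nu * t) - z * RtoC (sinh t))%C)
       (at_point 0) (Rbar_locally p_infty) (RtoC PI * A z)%C) /\
  holomorphic_on slit_plane A /\
  (forall x : R, x < 0 ->
     filterlim A (within (fun w : C => 0 < Im w) (locally (RtoC x)))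
               (locally (A (RtoC x)))) /\
  filterlim A (within slit_plane (locally (RtoC 0))) (locally (A (RtoC 0))).

(* Meaningful on the slit plane minus [z = 1], an open set on which every
   member of the sequence is holomorphic; [C_derive] is local. *)
Fixpoint Gcoef (mu : R) (s : nat) : C -> C :=
  match s with
  | O => fun z => (Cpowr z (mu + 3 / 2) / (z ^ 2 - 1))%C
  | S s' => fun z =>
      ((Gcoef mu s' z + 4 * z ^ 2 * C_derive (C_derive (Gcoef mu s')) z)
         / (4 * (1 - z ^ 2)))%C
  end.

Definition Gminus (s : nat) (z : C) : C :=
  (Cpowr z (- (1 / 2)) * (Gcoef 0 s z - Gcoef (-1) s z))%C.

(* Evaluation of the polynomial with coefficients [p], constant term first. *)
Definition peval (p : list C) (z : C) : C :=
  fold_right (fun c v => (c + z * v)%C) (RtoC 0) p.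

(* [f] is a rational function, in lowest terms [p / q], with set of poles
   exactly [E]; the value of [f] at its poles is irrelevant. *)
Definition rational_with_poles (f : C -> C) (E : C -> Prop) : Prop :=
  exists p q : list C,
    (exists z, peval q z <> RtoC 0) /\
    (forall z, ~ (peval p z = RtoC 0 /\ peval q z = RtoC 0)) /\
    (forall z, peval q z = RtoC 0 <-> E z) /\
    (forall z, ~ E z -> f z = (peval p z / peval q z)%C).

(* The cut plane without the points at distance less than [delta] from
   the half-line [x <= -1]. *)
Definition Sdom (delta : R) (z : C) : Prop :=
  forall x : R, x <= -1 -> delta <= Cmod (z - RtoC x)%C.

(* [F nu z ~ (1/PI) * sum_{s >= 0} g s z / nu^(2s+1)] as [nu -> +oo], uniformly
   for [z] in [D]: each truncation error is of the order, in [nu], of the first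
   omitted term, with constants independent of [z].  [sum_n u N] is
   [u 0 + ... + u N]. *)
Definition uniform_expansion (D : C -> Prop) (F : R -> C -> C) (g : nat -> C -> C)
  : Prop :=
  forall N : nat, exists K nu0 : R, 0 < nu0 /\
    forall (nu : R) (z : C), nu0 <= nu -> D z ->
      Cmod (F nu z
            - RtoC (/ PI)
              * sum_n (fun s => (g s z / RtoC (nu ^ (2 * s + 1)))%C) N)%C
      <= K / nu ^ (2 * N + 3).

(* Main.v *)
Require Import Defs.
From Stdlib Require Import Lra Lia ClassicalEpsilon.

(** Put [u = t + z sinh t].  For [Re z > 0] the function [PI * A_nu (nu z)] is the
    integral of [exp (- nu u) dt] over the positive real axis.  Integrating by
    parts again and again, as in Watson's lemma, gives the terms
    [c_k / nu^(k+1)], where [c_k] is the derivative [d^(k+1) t / du^(k+1)] at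
    [t = 0].  These derivatives are polynomials in [q = dt/du = 1 / (1 + z cosh t)]
    and [p = z sinh t * q], obtained from [q] by a derivation [du].  At [t = 0] one
    has [p = 0] and [q = 1 / (1 + z)]; terms of odd index contain [p] and vanish,
    and the terms of even index are the coefficients, called [gcoef] below.

    That they are the given [Gminus] rests on the identity
    [(z d/dz)^2 t = (1 - z^2) d^2 t/du^2], a form of Bessel's equation
    ([coef_recurrence]), which yields the recurrence
    [g_(s+1) = (z g_s' + z^2 g_s'') / (1 - z^2)] ([Gminus_gcoef]).  All formulas are
    homogeneous for suitable weights, whence
    [g_s = N_s (z) / (1 + z)^(3 s + 1)] with a polynomial [N_s], and the same
    recurrence shows [N_s (-1) <> 0] ([gcoef_rational]).

    For [Im z > 0] the analytic continuation of the integral is obtained by moving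
    the path: from 0 along the real axis to [s], down to [s - i PI / 2] and then
    parallel to the real axis, where [exp (- nu z sinh t)] is bounded
    ([continued_shift]).  That the given function [A] coincides with this integral
    is the identity theorem for functions that are merely complex differentiable
    ([identity_upper_half_plane]), which is derived from Goursat's theorem on
    rectangles by way of the mean value property.

    The expansion is then uniform because on an initial piece of the path [q] and
    [p] are bounded independently of [z] ([segment_expansion]), while the rest of
    the path contributes an exponentially small term.  If [Im z] is bounded below,
    the initial piece lies on the imaginary axis and ends at [- i PI / 3]
    ([upper_estimate_far]); if [Re z] is bounded below by a number greater than -1,
    it is a short piece of the positive real axis ([upper_estimate_near]); [Sdom]
    is covered by these two cases, by reflection in the real axis and by
    continuity from above at real points. *)


(** * Complex differentiability *)

Definition cderiv (f : C -> C) (z l : C) : Prop :=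
  @is_derive C_AbsRing C_NormedModule f z l.

Lemma cderiv_eps (f : C -> C) (z l : C) :
  cderiv f z l <->
  forall eps : R, 0 < eps -> exists d : R, 0 < d /\ forall w : C,
    Cmod (w - z) < d -> Cmod (f w - f z - (w - z) * l) <= eps * Cmod (w - z).
Proof.
split.
- intros [_ H] eps Heps.
  destruct (H z (fun P HP => HP) (mkposreal eps Heps)) as [d Hd].
  exists (pos d); split; [apply cond_pos|].
  intros w Hw. exact (Hd w Hw).
- intros H; split.
  + apply is_linear_scal_l.
  + intros x Hx.
    rewrite <- (is_filter_lim_locally_unique (K := C_AbsRing) (V := AbsRing_NormedModule C_AbsRing) z x Hx).
    intros eps. destruct (H eps (cond_pos eps)) as [d [Hd1 Hd2]].
    exists (mkposreal d Hd1). intros w Hw. exact (Hd2 w Hw).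
Qed.

(** The product and chain rules are stated for [C] as a normed module over itself
    by way of its absolute ring, while [holomorphic_on] uses the module structure
    coming from the norm of [C]; the two notions of derivative coincide. *)
Lemma cderiv_absring (f : C -> C) (z l : C) :
  cderiv f z l <-> @is_derive C_AbsRing (AbsRing_NormedModule C_AbsRing) f z l.
Proof.
rewrite cderiv_eps. split.
- intros H; split.
  + apply (is_linear_scal_l (K := C_AbsRing) (V := AbsRing_NormedModule C_AbsRing)).
  + intros x Hx.
    rewrite <- (is_filter_lim_locally_unique (K := C_AbsRing) (V := AbsRing_NormedModule C_AbsRing) z x Hx).
    intros eps. destruct (H eps (cond_pos eps)) as [d [Hd1 Hd2]].
    exists (mkposreal d Hd1). intros w Hw. exact (Hd2 w Hw).
- intros [_ H] eps Heps.
  destruct (H z (fun P HP => HP) (mkposreal eps Heps)) as [d Hd].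
  exists (pos d); split; [apply cond_pos|].
  intros w Hw. exact (Hd w Hw).
Qed.

Lemma cderiv_const (c z : C) : cderiv (fun _ => c) z 0%C.
Proof. apply (is_derive_const (K := C_AbsRing) (V := C_NormedModule)). Qed.

Lemma cderiv_id (z : C) : cderiv (fun w => w) z 1%C.
Proof.
apply cderiv_eps. intros eps Heps. exists 1; split; [lra|]. intros w _.
replace (w - z - (w - z) * 1)%C with (RtoC 0) by ring.
rewrite Cmod_0. pose proof (Cmod_ge_0 (w - z)). nra.
Qed.

Lemma cderiv_plus (f g : C -> C) (z a b : C) :
  cderiv f z a -> cderiv g z b -> cderiv (fun w => f w + g w)%C z (a + b)%C.
Proof. apply (is_derive_plus (K := C_AbsRing) (V := C_NormedModule)). Qed.

Lemma cderiv_mult (f g : C -> C) (z a b : C) :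
  cderiv f z a -> cderiv g z b -> cderiv (fun w => f w * g w)%C z (a * g z + f z * b)%C.
Proof.
intros Hf Hg. apply cderiv_absring in Hf. apply cderiv_absring in Hg.
apply cderiv_absring.
exact (is_derive_mult (K := C_AbsRing) f g z a b Hf Hg Cmult_comm).
Qed.

Lemma cderiv_comp (f g : C -> C) (z a b : C) :
  cderiv f (g z) a -> cderiv g z b -> cderiv (fun w => f (g w)) z (b * a)%C.
Proof.
intros Hf Hg. apply cderiv_absring in Hg.
revert Hf Hg. apply (is_derive_comp (K := C_AbsRing) (V := C_NormedModule)).
Qed.

Lemma cderiv_ext (f g : C -> C) (z l : C) :
  (forall w, f w = g w) -> cderiv f z l -> cderiv g z l.
Proof. apply (is_derive_ext (K := C_AbsRing) (V := C_NormedModule)). Qed.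

Lemma cderiv_ext_near (f g : C -> C) (z l : C) (d : R) : 0 < d ->
  (forall w, Cmod (w - z) < d -> f w = g w) -> cderiv f z l -> cderiv g z l.
Proof.
intros Hd H. apply (is_derive_ext_loc (K := C_AbsRing) (V := C_NormedModule)).
exists (mkposreal d Hd). intros w Hw. apply H. exact Hw.
Qed.

Lemma cderiv_unique (f : C -> C) (z a b : C) : cderiv f z a -> cderiv f z b -> a = b.
Proof.
intros Ha Hb. rewrite <- (is_C_derive_unique f z a Ha).
exact (is_C_derive_unique f z b Hb).
Qed.

Lemma cderiv_continuous (f : C -> C) (z l : C) : cderiv f z l ->
  forall eps : R, 0 < eps -> exists d : R, 0 < d /\
    forall w, Cmod (w - z) < d -> Cmod (f w - f z) < eps.
Proof.
intros H eps Heps.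
destruct (proj1 (cderiv_eps f z l) H 1 Rlt_0_1) as [d [Hd Hw]].
pose proof (Cmod_ge_0 l) as Hl.
exists (Rmin d (eps / (2 + Cmod l))); split.
- apply Rmin_pos; [exact Hd|]. apply Rdiv_lt_0_compat; lra.
- intros w Hwz.
  assert (H1 := Rlt_le_trans _ _ _ Hwz (Rmin_l _ _)).
  assert (H2 := Rlt_le_trans _ _ _ Hwz (Rmin_r _ _)).
  specialize (Hw w H1).
  replace (f w - f z)%C with ((f w - f z - (w - z) * l) + (w - z) * l)%C by ring.
  eapply Rle_lt_trans; [apply Cmod_triangle|]. rewrite Cmod_mult.
  assert (Cmod (w - z) * (2 + Cmod l) < eps).
  { apply (Rmult_lt_compat_r (2 + Cmod l)) in H2; [|lra].
    unfold Rdiv in H2. rewrite Rmult_assoc, Rinv_l, Rmult_1_r in H2; lra. }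
  pose proof (Cmod_ge_0 (w - z)). nra.
Qed.

Lemma cderiv_inv (f : C -> C) (z l : C) : f z <> 0%C -> cderiv f z l ->
  cderiv (fun w => / f w)%C z (- l / (f z * f z))%C.
Proof.
intros Hz Hf.
assert (Hi : cderiv Cinv (f z) (- (/ (f z * f z)))%C).
{ set (a := f z) in *. clearbody a. clear Hf.
  assert (Ha : 0 < Cmod a) by (apply Cmod_gt_0; exact Hz).
  apply cderiv_eps. intros eps Heps.
  exists (Rmin (Cmod a / 2) (eps * Cmod a ^ 3 / 2)); split.
  { apply Rmin_pos; [lra|]. apply Rdiv_lt_0_compat; [|lra].
    apply Rmult_lt_0_compat; [lra|]. apply pow_lt; lra. }
  intros w Hw.
  assert (H1 := Rlt_le_trans _ _ _ Hw (Rmin_l _ _)).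
  assert (H2 := Rlt_le_trans _ _ _ Hw (Rmin_r _ _)).
  assert (Hm : Cmod a / 2 < Cmod w).
  { assert (Cmod a <= Cmod w + Cmod (w - a)).
    { replace a with (w + - (w - a))%C at 1 by ring.
      eapply Rle_trans; [apply Cmod_triangle|]. rewrite Cmod_opp. lra. }
    lra. }
  assert (Hw0 : w <> 0%C) by (apply Cmod_gt_0; lra).
  replace (/ w - / a - (w - a) * - / (a * a))%C
    with ((w - a) * ((w - a) / (w * (a * a))))%C by (field; auto).
  rewrite Cmod_mult, Rmult_comm.
  apply Rmult_le_compat_r; [apply Cmod_ge_0|].
  rewrite Cmod_div by (repeat apply Cmult_neq_0; auto).
  rewrite !Cmod_mult.
  assert (0 < Cmod w * (Cmod a * Cmod a)) by (repeat apply Rmult_lt_0_compat; lra).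
  apply (Rmult_le_reg_r (Cmod w * (Cmod a * Cmod a))); [assumption|].
  unfold Rdiv. rewrite Rmult_assoc, Rinv_l, Rmult_1_r by lra.
  assert (eps * Cmod a ^ 3 / 2 <= eps * (Cmod w * (Cmod a * Cmod a))).
  { assert (Cmod a / 2 * (Cmod a * Cmod a) <= Cmod w * (Cmod a * Cmod a)).
    { apply Rmult_le_compat_r; nra. }
    simpl. nra. }
  lra. }
assert (H := cderiv_comp Cinv f z _ _ Hi Hf).
replace (- l / (f z * f z))%C with (l * - / (f z * f z))%C by (field; auto).
exact H.
Qed.

Lemma cderiv_val (f : C -> C) (z a b : C) : cderiv f z a -> a = b -> cderiv f z b.
Proof. intros H <-. exact H. Qed.

Lemma cderiv_opp (f : C -> C) (z a : C) : cderiv f z a -> cderiv (fun w => - f w)%C z (- a)%C.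
Proof. apply (is_derive_opp (K := C_AbsRing) (V := C_NormedModule)). Qed.

Lemma cderiv_minus (f g : C -> C) (z a b : C) :
  cderiv f z a -> cderiv g z b -> cderiv (fun w => f w - g w)%C z (a - b)%C.
Proof. intros Hf Hg. apply (cderiv_plus f (fun w => - g w)%C); [|apply cderiv_opp]; assumption. Qed.

(** Computes the derivative of a ring expression by pattern matching on the body
    of the function.  The eta-reduced forms occur when the last argument of the
    outermost operation is the variable itself. *)
Ltac cder :=
  match goal with
  | |- cderiv (fun _ => ?c) _ _ => apply cderiv_const
  | |- cderiv (fun w => w) _ _ => apply cderiv_id
  | |- cderiv (fun w => Cplus _ _) _ _ => eapply cderiv_plus; cder
  | |- cderiv (fun w => Cminus _ _) _ _ => eapply cderiv_minus; cder
  | |- cderiv (fun w => Cmult _ _) _ _ => eapply cderiv_mult; cder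
  | |- cderiv (fun w => Copp _) _ _ => eapply cderiv_opp; cder
  | |- cderiv (Cplus ?c) _ _ => eapply (cderiv_plus (fun _ => c) (fun w => w)); cder
  | |- cderiv (Cminus ?c) _ _ => eapply (cderiv_minus (fun _ => c) (fun w => w)); cder
  | |- cderiv (Cmult ?c) _ _ => eapply (cderiv_mult (fun _ => c) (fun w => w)); cder
  | |- cderiv Copp _ _ => eapply (cderiv_opp (fun w => w)); cder
  | |- _ => eauto
  end.

Ltac cder_ring := eapply cderiv_val; [cder | cbv beta; try ring].

(** * Integrals of complex-valued functions of a real variable *)

Definition CInt (f : R -> C) (a b : R) : C := @RInt C_R_CompleteNormedModule f a b.

Lemma norm_C_R (x : C) : @norm R_AbsRing C_R_CompleteNormedModule x = Cmod x.
Proof. symmetry. apply Cmod_norm. Qed.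

Definition rcont (f : R -> C) (t : R) : Prop :=
  @continuous R_UniformSpace C_R_CompleteNormedModule f t.

Definition rderiv (f : R -> C) (t : R) (l : C) : Prop :=
  @is_derive R_AbsRing C_R_CompleteNormedModule f t l.

Lemma rderiv_rcont f t l : rderiv f t l -> rcont f t.
Proof.
intros H. apply (ex_derive_continuous (K := R_AbsRing) (V := C_R_CompleteNormedModule)).
exists l; exact H.
Qed.

Lemma cderiv_rderiv (f : C -> C) (a k l : C) (t : R) :
  cderiv f (a + RtoC t * k)%C l -> rderiv (fun t => f (a + RtoC t * k)%C) t (k * l)%C.
Proof.
intros H. pose proof (proj1 (cderiv_eps f _ l) H) as He. split.
- apply is_linear_scal_l.
- intros x Hx. rewrite <- (is_filter_lim_locally_unique (K := R_AbsRing) (V := R_NormedModule) t x Hx).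
  intros eps. pose proof (Cmod_ge_0 k) as Hk.
  destruct (He (eps / (1 + Cmod k))) as [d [Hd1 Hd2]].
  { apply Rdiv_lt_0_compat; [apply cond_pos|lra]. }
  assert (Hd : 0 < d / (1 + Cmod k)) by (apply Rdiv_lt_0_compat; lra).
  exists (mkposreal _ Hd). intros u Hu.
  change (Rabs (u - t) < d / (1 + Cmod k)) in Hu.
  rewrite norm_C_R.
  change (Cmod (f (a + RtoC u * k)%C - f (a + RtoC t * k)%C - scal (u - t)%R (k * l : C_R_NormedModule)%C)%C
    <= eps * Rabs (u - t)).
  replace (scal (u - t)%R (k * l : C_R_NormedModule)%C) with (RtoC (u - t) * (k * l))%C.
  2:{ rewrite scal_R_Cmult. reflexivity. }
  assert (Hw : Cmod (a + RtoC u * k - (a + RtoC t * k)) = Rabs (u - t) * Cmod k).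
  { rewrite <- Cmod_R, <- Cmod_mult. f_equal. rewrite RtoC_minus. ring. }
  specialize (Hd2 (a + RtoC u * k)%C). rewrite Hw in Hd2.
  replace (f (a + RtoC u * k) - f (a + RtoC t * k) - RtoC (u - t) * (k * l))%C
   with (f (a + RtoC u * k) - f (a + RtoC t * k) - (a + RtoC u * k - (a + RtoC t * k)) * l)%C
   by (rewrite RtoC_minus; ring).
  pose proof (Rabs_pos (u - t)) as Hp.
  apply (Rmult_lt_compat_r (1 + Cmod k)) in Hu; [|lra].
  unfold Rdiv in Hu. rewrite Rmult_assoc, Rinv_l, Rmult_1_r in Hu by lra.
  eapply Rle_trans; [apply Hd2; nra|].
  pose proof (cond_pos eps).
  apply Rle_trans with (eps / (1 + Cmod k) * ((1 + Cmod k) * Rabs (u - t))).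
  + apply Rmult_le_compat_l; [apply Rlt_le, Rdiv_lt_0_compat; lra|nra].
  + right. field. lra.
Qed.

Lemma cderiv_rcont (f : C -> C) (a k l : C) (t : R) :
  cderiv f (a + RtoC t * k)%C l -> rcont (fun t => f (a + RtoC t * k)%C) t.
Proof. intros H. eapply rderiv_rcont, cderiv_rderiv, H. Qed.

Definition contOn (f : R -> C) (a b : R) : Prop := forall t, Rmin a b <= t <= Rmax a b -> rcont f t.

Lemma is_CInt (f : R -> C) (a b : R) : contOn f a b ->
  @is_RInt C_R_CompleteNormedModule f a b (CInt f a b).
Proof.
intros H. apply (@RInt_correct C_R_CompleteNormedModule).
apply (@ex_RInt_continuous C_R_CompleteNormedModule). exact H.
Qed.

Lemma CInt_unique (f : R -> C) (a b : R) (l : C) :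
  @is_RInt C_R_CompleteNormedModule f a b l -> CInt f a b = l.
Proof. exact (is_RInt_unique (V := C_R_CompleteNormedModule) f a b l). Qed.

(** The integral is only real-linear by construction; multiplication by a complex
    constant mixes the two components. *)
Lemma is_CInt_scal (f : R -> C) (a b : R) (c l : C) :
  @is_RInt C_R_NormedModule f a b l -> @is_RInt C_R_NormedModule (fun t => c * f t)%C a b (c * l)%C.
Proof.
intros H.
pose proof (is_RInt_fct_extend_fst (U := R_NormedModule) (V := R_NormedModule) f a b l H) as H1.
pose proof (is_RInt_fct_extend_snd (U := R_NormedModule) (V := R_NormedModule) f a b l H) as H2.
destruct c as [c1 c2], l as [l1 l2]. simpl in H1, H2.
apply (is_RInt_fct_extend_pair (U := R_NormedModule) (V := R_NormedModule)).
- apply (is_RInt_ext (V := R_NormedModule) (fun t => minus (scal c1 (fst (f t))) (scal c2 (snd (f t))))).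
  { reflexivity. }
  apply (is_RInt_minus (V := R_NormedModule)); apply (is_RInt_scal (V := R_NormedModule)); assumption.
- apply (is_RInt_ext (V := R_NormedModule) (fun t => plus (scal c1 (snd (f t))) (scal c2 (fst (f t))))).
  { reflexivity. }
  apply (is_RInt_plus (V := R_NormedModule)); apply (is_RInt_scal (V := R_NormedModule)); assumption.
Qed.

Lemma CInt_scal (f : R -> C) (a b : R) (c : C) : contOn f a b ->
  CInt (fun t => c * f t)%C a b = (c * CInt f a b)%C.
Proof. intros H. apply CInt_unique, is_CInt_scal, is_CInt, H. Qed.

Lemma CInt_minus (f g : R -> C) (a b : R) : contOn f a b -> contOn g a b ->
  CInt (fun t => f t - g t)%C a b = (CInt f a b - CInt g a b)%C.
Proof.
intros Hf Hg. apply CInt_unique.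
apply (is_RInt_minus (V := C_R_CompleteNormedModule)); apply is_CInt; assumption.
Qed.

Lemma CInt_const (c : C) (a b : R) : CInt (fun _ => c) a b = (RtoC (b - a) * c)%C.
Proof.
unfold CInt. rewrite RInt_const. apply scal_R_Cmult.
Qed.

Lemma CInt_ext (f g : R -> C) (a b : R) :
  (forall t, Rmin a b < t < Rmax a b -> f t = g t) -> CInt f a b = CInt g a b.
Proof. exact (RInt_ext (V := C_R_CompleteNormedModule) f g a b). Qed.

Lemma CInt_Chasles (f : R -> C) (a b c : R) : contOn f a b -> contOn f b c ->
  (CInt f a b + CInt f b c)%C = CInt f a c.
Proof.
intros H1 H2. apply (RInt_Chasles (V := C_R_CompleteNormedModule));
 apply (@ex_RInt_continuous C_R_CompleteNormedModule); assumption.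
Qed.

Lemma CInt_bound (f : R -> C) (a b M : R) : a <= b ->
  contOn f a b -> (forall t, a <= t <= b -> Cmod (f t) <= M) ->
  Cmod (CInt f a b) <= (b - a) * M.
Proof.
intros Hab Hc H. rewrite <- norm_C_R.
apply (norm_RInt_le_const (V := C_R_CompleteNormedModule) f a b (CInt f a b) M Hab).
- intros t Ht. rewrite norm_C_R. exact (H t Ht).
- apply is_CInt, Hc.
Qed.

Lemma CInt_bound_fun (f : R -> C) (g : R -> R) (a b l : R) : a <= b ->
  contOn f a b -> (forall t, a <= t <= b -> Cmod (f t) <= g t) ->
  is_RInt g a b l -> Cmod (CInt f a b) <= l.
Proof.
intros Hab Hc H Hg. rewrite <- norm_C_R.
apply (norm_RInt_le (V := C_R_CompleteNormedModule) f g a b (CInt f a b) l Hab); [|apply is_CInt, Hc|exact Hg].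
intros t Ht. rewrite norm_C_R. exact (H t Ht).
Qed.

Lemma CInt_derive (f df : R -> C) (a b : R) :
  (forall t, Rmin a b <= t <= Rmax a b -> rderiv f t (df t)) -> contOn df a b ->
  CInt df a b = (f b - f a)%C.
Proof.
intros H Hc. apply CInt_unique. apply (is_RInt_derive (V := C_R_CompleteNormedModule)); assumption.
Qed.

(** * Goursat's theorem for rectangles *)

Lemma cderiv_rderiv_h (f : C -> C) (x y : R) (l : C) :
  cderiv f (x, y) l -> rderiv (fun x => f (x, y)) x l.
Proof.
intros H.
assert (E : forall t : R, ((0, y) + RtoC t * 1)%C = (t, y)).
{ intros t. apply injective_projections; simpl; ring. }
rewrite <- E in H. apply cderiv_rderiv in H. rewrite Cmult_1_l in H.
refine (is_derive_ext _ _ _ _ _ H). intros t. f_equal. apply E.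
Qed.

Lemma cderiv_rderiv_v (f : C -> C) (x y : R) (l : C) :
  cderiv f (x, y) l -> rderiv (fun y => f (x, y)) y (Ci * l)%C.
Proof.
intros H.
assert (E : forall t : R, ((x, 0) + RtoC t * Ci)%C = (x, t)).
{ intros t. apply injective_projections; simpl; ring. }
rewrite <- E in H. apply cderiv_rderiv in H.
refine (is_derive_ext _ _ _ _ _ H). intros t. f_equal. apply E.
Qed.

(** The integral of [f] along the boundary of [[x1, x2] x [y1, y2]], traversed
    counterclockwise. *)
Definition rect_int (f : C -> C) (x1 x2 y1 y2 : R) : C :=
  (CInt (fun x => f (x, y1)) x1 x2 - CInt (fun x => f (x, y2)) x1 x2
   + Ci * (CInt (fun y => f (x2, y)) y1 y2 - CInt (fun y => f (x1, y)) y1 y2))%C.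

Definition holo_rect (f : C -> C) (x1 x2 y1 y2 : R) : Prop :=
  forall x y, x1 <= x <= x2 -> y1 <= y <= y2 -> exists l, cderiv f (x, y) l.

Lemma holo_rect_sub f x1 x2 y1 y2 u1 u2 v1 v2 :
  holo_rect f x1 x2 y1 y2 -> x1 <= u1 -> u2 <= x2 -> y1 <= v1 -> v2 <= y2 ->
  holo_rect f u1 u2 v1 v2.
Proof. intros H ? ? ? ? x y Hx Hy. apply H; lra. Qed.

Lemma holo_rect_cont_h f x1 x2 y1 y2 y : holo_rect f x1 x2 y1 y2 -> x1 <= x2 ->
  y1 <= y <= y2 -> contOn (fun x => f (x, y)) x1 x2.
Proof.
intros H Hx Hy t Ht. rewrite Rmin_left, Rmax_right in Ht by lra.
destruct (H t y Ht Hy) as [l Hl]. eapply rderiv_rcont, cderiv_rderiv_h, Hl.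
Qed.

Lemma holo_rect_cont_v f x1 x2 y1 y2 x : holo_rect f x1 x2 y1 y2 -> y1 <= y2 ->
  x1 <= x <= x2 -> contOn (fun y => f (x, y)) y1 y2.
Proof.
intros H Hx Hy t Ht. rewrite Rmin_left, Rmax_right in Ht by lra.
destruct (H x t Hy Ht) as [l Hl]. eapply rderiv_rcont, cderiv_rderiv_v, Hl.
Qed.

Lemma rect_int_split_h f x1 x2 y1 y2 m : x1 <= m <= x2 -> y1 <= y2 ->
  holo_rect f x1 x2 y1 y2 ->
  rect_int f x1 x2 y1 y2 = (rect_int f x1 m y1 y2 + rect_int f m x2 y1 y2)%C.
Proof.
intros Hm Hy H. unfold rect_int.
rewrite <- (CInt_Chasles (fun x => f (x, y1)) x1 m x2), <- (CInt_Chasles (fun x => f (x, y2)) x1 m x2).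
ring.
all: apply holo_rect_cont_h with (y1 := y1) (y2 := y2); [eapply holo_rect_sub; [exact H|..]|..]; lra.
Qed.

Lemma rect_int_split_v f x1 x2 y1 y2 m : y1 <= m <= y2 -> x1 <= x2 ->
  holo_rect f x1 x2 y1 y2 ->
  rect_int f x1 x2 y1 y2 = (rect_int f x1 x2 y1 m + rect_int f x1 x2 m y2)%C.
Proof.
intros Hm Hy H. unfold rect_int.
rewrite <- (CInt_Chasles (fun y => f (x1, y)) y1 m y2), <- (CInt_Chasles (fun y => f (x2, y)) y1 m y2).
ring.
all: apply holo_rect_cont_v with (x1 := x1) (x2 := x2); [eapply holo_rect_sub; [exact H|..]|..]; lra.
Qed.

Lemma rect_int_primitive (P f : C -> C) x1 x2 y1 y2 : x1 <= x2 -> y1 <= y2 ->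
  (forall w, cderiv P w (f w)) -> (forall w, exists l, cderiv f w l) ->
  rect_int f x1 x2 y1 y2 = 0%C.
Proof.
intros Hx Hy HP Hf.
assert (Hh : holo_rect f x1 x2 y1 y2) by (intros x y _ _; apply Hf).
assert (E1 : forall y, y1 <= y <= y2 ->
  CInt (fun x => f (x, y)) x1 x2 = (P (x2, y) - P (x1, y))%C).
{ intros y Hyy. apply (CInt_derive (fun x => P (x, y))).
  - intros t _. apply cderiv_rderiv_h, HP.
  - eapply holo_rect_cont_h; eauto. }
assert (E2 : forall x, x1 <= x <= x2 ->
  (Ci * CInt (fun y => f (x, y)) y1 y2)%C = (P (x, y2) - P (x, y1))%C).
{ intros x Hxx. rewrite <- CInt_scal by (eapply holo_rect_cont_v; eauto).
  apply (CInt_derive (fun y => P (x, y))).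
  - intros t _. apply cderiv_rderiv_v, HP.
  - intros t _. destruct (Hf (x, t)) as [l Hl].
    eapply rderiv_rcont. apply (cderiv_rderiv_v (fun w => Ci * f w)%C).
    apply cderiv_mult; [apply cderiv_const|exact Hl]. }
unfold rect_int.
replace (Ci * (CInt (fun y => f (x2, y)) y1 y2 - CInt (fun y => f (x1, y)) y1 y2))%C
  with (Ci * CInt (fun y => f (x2, y)) y1 y2 - Ci * CInt (fun y => f (x1, y)) y1 y2)%C by ring.
rewrite !E1, !E2 by lra. ring.
Qed.

(** A function that is within [e] of an affine one: the affine part has a
    primitive, hence only the error is integrated. *)
Lemma rect_int_local (f : C -> C) (p l : C) (e x1 x2 y1 y2 : R) :
  x1 <= x2 -> y1 <= y2 -> holo_rect f x1 x2 y1 y2 ->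
  (forall x y, x1 <= x <= x2 -> y1 <= y <= y2 ->
     Cmod (f (x, y) - f p - ((x, y) - p) * l) <= e) ->
  Cmod (rect_int f x1 x2 y1 y2) <= 2 * ((x2 - x1) + (y2 - y1)) * e.
Proof.
intros Hx Hy Hf He.
set (a := fun w : C => (f p + (w - p) * l)%C).
assert (Ha : forall w, cderiv a w l).
{ intros w. unfold a. cder_ring. }
set (P := fun w : C => ((f p - p * l) * w + (l * / 2) * (w * w))%C).
assert (HP : forall w, cderiv P w (a w)).
{ intros w. unfold P, a.
  cder_ring. field. }
assert (H0 : rect_int a x1 x2 y1 y2 = 0%C).
{ apply (rect_int_primitive P); auto. intros w; exists l; apply Ha. }
assert (Hha : holo_rect a x1 x2 y1 y2) by (intros x y _ _; exists l; apply Ha).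
set (g := fun w => (f w - a w)%C).
assert (Hg : holo_rect g x1 x2 y1 y2).
{ intros x y Hxx Hyy. destruct (Hf x y Hxx Hyy) as [m Hm].
  eexists. unfold g. cder. }
assert (E : rect_int f x1 x2 y1 y2 = rect_int g x1 x2 y1 y2).
{ replace (rect_int g x1 x2 y1 y2) with (rect_int f x1 x2 y1 y2 - rect_int a x1 x2 y1 y2)%C.
  { rewrite H0. ring. }
  unfold rect_int, g.
  rewrite !CInt_minus; [ring|..].
  all: first [eapply holo_rect_cont_h; [eassumption|lra|lra]
             |eapply holo_rect_cont_v; [eassumption|lra|lra]]. }
rewrite E.
assert (Bg : forall x y, x1 <= x <= x2 -> y1 <= y <= y2 -> Cmod (g (x, y)) <= e).
{ intros x y Hxx Hyy. unfold g, a.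
  replace (f (x, y) - (f p + ((x, y) - p) * l))%C
   with (f (x, y) - f p - ((x, y) - p) * l)%C by ring. auto. }
unfold rect_int.
assert (B1 : forall y, y1 <= y <= y2 -> Cmod (CInt (fun x => g (x, y)) x1 x2) <= (x2 - x1) * e).
{ intros y Hyy. apply CInt_bound; auto. eapply holo_rect_cont_h; eauto. }
assert (B2 : forall x, x1 <= x <= x2 -> Cmod (CInt (fun y => g (x, y)) y1 y2) <= (y2 - y1) * e).
{ intros x Hxx. apply CInt_bound; auto. eapply holo_rect_cont_v; eauto. }
assert (T : forall u v s t : C, Cmod (u - v + Ci * (s - t)) <= Cmod u + Cmod v + (Cmod s + Cmod t)).
{ intros u v s t. eapply Rle_trans; [apply Cmod_triangle|].
  rewrite Cmod_mult, Cmod_Ci, Rmult_1_l.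
  apply Rplus_le_compat; (eapply Rle_trans; [apply Cmod_triangle|rewrite Cmod_opp; lra]). }
eapply Rle_trans; [apply T|].
pose proof (B1 y1 ltac:(lra)). pose proof (B1 y2 ltac:(lra)).
pose proof (B2 x1 ltac:(lra)). pose proof (B2 x2 ltac:(lra)). lra.
Qed.

(** Bisection argument: if the boundary integral exceeds [eta], then some quarter
    of the rectangle has boundary integral above [eta / 4], and so on.  The
    nested cells shrink to a point, where differentiability makes the integral
    over a cell of generation [k] much smaller than [eta / 4 ^ k]. *)
Section Bisection.
Variables (f : C -> C) (x1 y1 w h : R).
Hypothesis Hw : 0 < w.
Hypothesis Hh : 0 < h.
Hypothesis Hf : holo_rect f x1 (x1 + w) y1 (y1 + h).

(* [c] is the lower left corner of a cell of generation [k]. *)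
Let cell (k : nat) (c : R * R) : C :=
  rect_int f (fst c) (fst c + w / 2 ^ k) (snd c) (snd c + h / 2 ^ k).

Let inside (k : nat) (c : R * R) : Prop :=
  (x1 <= fst c /\ fst c + w / 2 ^ k <= x1 + w) /\
  (y1 <= snd c /\ snd c + h / 2 ^ k <= y1 + h).

Let quarters (k : nat) (c : R * R) : list (R * R) :=
  c :: (fst c + w / 2 ^ S k, snd c) :: (fst c, snd c + h / 2 ^ S k)
    :: (fst c + w / 2 ^ S k, snd c + h / 2 ^ S k) :: nil.

Let half (v : R) (k : nat) : v / 2 ^ k = v / 2 ^ S k + v / 2 ^ S k.
Proof. simpl. field. apply pow_nonzero. lra. Qed.

Let halfpos (v : R) (k : nat) : 0 < v -> 0 < v / 2 ^ k.
Proof. intros H. apply Rdiv_lt_0_compat; [exact H|]. apply pow_lt; lra. Qed.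

Let cell_split k c : inside k c ->
  cell k c = fold_right (fun d s => cell (S k) d + s)%C 0%C (quarters k c).
Proof.
intros [Hx Hy]. destruct c as [a b]. unfold cell; simpl fst in *; simpl snd in *.
pose proof (halfpos w (S k) Hw) as Pw. pose proof (halfpos h (S k) Hh) as Ph.
rewrite !(half w k) in Hx |- *. rewrite !(half h k) in Hy |- *.
set (u := w / 2 ^ S k) in *. set (v := h / 2 ^ S k) in *.
rewrite (rect_int_split_h f a (a + (u + u)) b (b + (v + v)) (a + u)) by
  (try lra; (eapply holo_rect_sub; [exact Hf|lra..])).
rewrite (rect_int_split_v f a (a + u) b (b + (v + v)) (b + v)) by
  (try lra; (eapply holo_rect_sub; [exact Hf|lra..])).
rewrite (rect_int_split_v f (a + u) (a + (u + u)) b (b + (v + v)) (b + v)) by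
  (try lra; (eapply holo_rect_sub; [exact Hf|lra..])).
unfold quarters; cbn [fold_right fst snd]. fold u. fold v.
rewrite !Rplus_assoc. ring.
Qed.

Variable eta : R.
Let bad (k : nat) (c : R * R) : Prop := eta / 4 ^ k < Cmod (cell k c).
Let bad_dec k c : {bad k c} + {~ bad k c}.
Proof. apply Rlt_dec. Defined.

Let next (k : nat) (c : R * R) : R * R :=
  match find (fun d => if bad_dec (S k) d then true else false) (quarters k c) with
  | Some d => d | None => c end.

Let next_spec k c : inside k c -> bad k c ->
  In (next k c) (quarters k c) /\ bad (S k) (next k c).
Proof.
intros Hi Hb. unfold next.
destruct (find _ _) as [d|] eqn:E.
- apply find_some in E as [E1 E2]. split; [exact E1|].
  destruct (bad_dec (S k) d); [assumption|discriminate].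
- exfalso.
  assert (Hn : forall d, In d (quarters k c) -> Cmod (cell (S k) d) <= eta / 4 ^ S k).
  { intros d Hd. pose proof (find_none _ _ E d Hd) as H. simpl in H.
    destruct (bad_dec (S k) d) as [|H']; [discriminate|]. unfold bad in H'. lra. }
  unfold bad in Hb. rewrite (cell_split k c Hi) in Hb.
  unfold quarters in Hb, Hn. cbn [fold_right] in Hb.
  pose proof (Hn _ (or_introl eq_refl)) as H1.
  pose proof (Hn _ (or_intror (or_introl eq_refl))) as H2.
  pose proof (Hn _ (or_intror (or_intror (or_introl eq_refl)))) as H3.
  pose proof (Hn _ (or_intror (or_intror (or_intror (or_introl eq_refl))))) as H4.
  revert Hb H1 H2 H3 H4.
  generalize (cell (S k) c) (cell (S k) (fst c + w / 2 ^ S k, snd c))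
    (cell (S k) (fst c, snd c + h / 2 ^ S k))
    (cell (S k) (fst c + w / 2 ^ S k, snd c + h / 2 ^ S k)).
  intros a b d e Hb H1 H2 H3 H4.
  assert (E4 : eta / 4 ^ k = 4 * (eta / 4 ^ S k)).
  { simpl. field. apply pow_nonzero; lra. }
  pose proof (Cmod_triangle a (b + (d + (e + 0)))).
  pose proof (Cmod_triangle b (d + (e + 0))).
  pose proof (Cmod_triangle d (e + 0)).
  pose proof (Cmod_triangle e 0). rewrite Cmod_0 in *. lra.
Qed.

Let corner : nat -> R * R :=
  fix corner k := match k with O => (x1, y1) | S k => next k (corner k) end.

Hypothesis Hbad : eta < Cmod (rect_int f x1 (x1 + w) y1 (y1 + h)).

Let corner_spec k : inside k (corner k) /\ bad k (corner k).
Proof.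
induction k as [|k [IHi IHb]].
- simpl. unfold inside, bad, cell. simpl. rewrite !Rdiv_1_r. repeat split; lra.
- destruct (next_spec k _ IHi IHb) as [H1 H2]. split; [|exact H2].
  pose proof (half w k) as Ew. pose proof (half h k) as Eh.
  pose proof (halfpos w (S k) Hw) as Pw. pose proof (halfpos h (S k) Hh) as Ph.
  change (corner (S k)) with (next k (corner k)).
  destruct IHi as [Ix Iy]. unfold inside.
  destruct H1 as [<-|[<-|[<-|[<-|[]]]]]; cbn [fst snd]; lra.
Qed.

Let corner_step k :
  (fst (corner k) <= fst (corner (S k)) /\
   fst (corner (S k)) + w / 2 ^ S k <= fst (corner k) + w / 2 ^ k) /\
  (snd (corner k) <= snd (corner (S k)) /\
   snd (corner (S k)) + h / 2 ^ S k <= snd (corner k) + h / 2 ^ k).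
Proof.
destruct (corner_spec k) as [Hi Hb]. destruct (next_spec k _ Hi Hb) as [H1 _].
pose proof (half w k) as Ew. pose proof (half h k) as Eh.
pose proof (halfpos w (S k) Hw) as Pw. pose proof (halfpos h (S k) Hh) as Ph.
change (corner (S k)) with (next k (corner k)).
destruct H1 as [<-|[<-|[<-|[<-|[]]]]]; cbn [fst snd]; lra.
Qed.

(** The corners increase and the opposite corners decrease, so that the supremum of
    the former lies in every cell. *)
Let nested (g : nat -> R) (v : R) : 0 < v ->
  (forall k, g k <= g (S k) /\ g (S k) + v / 2 ^ S k <= g k + v / 2 ^ k) ->
  exists l, forall k, g k <= l <= g k + v / 2 ^ k.
Proof.
intros Hv Hg.
assert (Hm : forall k j, g k <= g (k + j)%nat /\
  g (k + j)%nat + v / 2 ^ (k + j) <= g k + v / 2 ^ k).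
{ intros k j. induction j as [|j IH]; [rewrite Nat.add_0_r; lra|].
  rewrite Nat.add_succ_r. pose proof (Hg (k + j)%nat). lra. }
assert (Hle : forall k j, g j <= g k + v / 2 ^ k).
{ intros k j. pose proof (halfpos v (max k j) Hv).
  pose proof (Hm k (max k j - k)%nat) as H1. pose proof (Hm j (max k j - j)%nat) as H2.
  replace (k + (max k j - k))%nat with (max k j) in H1 by lia.
  replace (j + (max k j - j))%nat with (max k j) in H2 by lia. lra. }
destruct (completeness (fun x => exists j, x = g j)) as [l [Hu Hl]].
- exists (g 0%nat + v / 2 ^ 0). intros x [j ->]. apply Hle.
- exists (g 0%nat). exists 0%nat. reflexivity.
- exists l. intros k. split; [apply Hu; exists k; reflexivity|].
  apply Hl. intros x [j ->]. apply Hle.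
Qed.

Lemma bisection_absurd : 0 < eta -> False.
Proof.
intros Heta.
destruct (nested (fun k => fst (corner k)) w Hw) as [px Hpx]; [intros k; apply corner_step|].
destruct (nested (fun k => snd (corner k)) h Hh) as [py Hpy]; [intros k; apply corner_step|].
assert (Hin : x1 <= px <= x1 + w /\ y1 <= py <= y1 + h).
{ pose proof (Hpx 0%nat) as H1. pose proof (Hpy 0%nat) as H2. simpl in H1, H2. lra. }
destruct (Hf px py (proj1 Hin) (proj2 Hin)) as [l Hl].
(* With this precision the local bound is half of [eta / 4 ^ k]. *)
assert (He : 0 < eta / (4 * ((w + h) * (w + h)))).
{ apply Rdiv_lt_0_compat; [lra|]. nra. }
destruct (proj1 (cderiv_eps f _ l) Hl _ He) as [d [Hd Hd']].
assert (Hk : exists k, (w + h) / 2 ^ k < d).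
{ destruct (pow_lt_1_zero (/ 2)) with (y := d / (w + h)) as [k Hk].
  - rewrite Rabs_right; lra.
  - apply Rdiv_lt_0_compat; lra.
  - exists k. specialize (Hk k (le_n k)).
    rewrite Rabs_right in Hk by (apply Rle_ge, pow_le; lra).
    unfold Rdiv. rewrite <- pow_inv.
    apply (Rmult_lt_compat_l (w + h)) in Hk; [|lra].
    replace ((w + h) * (d / (w + h))) with d in Hk by (field; lra). exact Hk. }
destruct Hk as [k Hk].
destruct (corner_spec k) as [[Ix Iy] Hb].
pose proof (halfpos w k Hw) as Pw. pose proof (halfpos h k Hh) as Ph.
specialize (Hpx k). specialize (Hpy k).
assert (Es : (w + h) / 2 ^ k = w / 2 ^ k + h / 2 ^ k) by (unfold Rdiv; ring).
rewrite Es in Hk.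
unfold bad, cell in Hb.
set (u := w / 2 ^ k) in *. set (v := h / 2 ^ k) in *.
set (e := eta / (4 * ((w + h) * (w + h)))) in *.
assert (HL := rect_int_local f (px, py) l (e * (u + v))
  (fst (corner k)) (fst (corner k) + u) (snd (corner k)) (snd (corner k) + v)).
assert (Hlt : Cmod (rect_int f (fst (corner k)) (fst (corner k) + u) (snd (corner k)) (snd (corner k) + v))
  <= 2 * (u + v) * (e * (u + v))).
{ eapply Rle_trans; [apply HL|right; ring].
  - lra.
  - lra.
  - eapply holo_rect_sub; [exact Hf|lra..].
  - intros x y Hx Hy.
    assert (Hm : Cmod ((x, y) - (px, py)) <= u + v).
    { replace ((x, y) - (px, py))%C with (RtoC (x - px) + RtoC (y - py) * Ci)%C
        by (apply injective_projections; simpl; ring).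
      eapply Rle_trans; [apply Cmod_triangle|].
      rewrite Cmod_mult, !Cmod_R, Cmod_Ci, Rmult_1_r.
      apply Rplus_le_compat; apply Rabs_le; lra. }
    eapply Rle_trans; [apply Hd'; lra|]. apply Rmult_le_compat_l; lra. }
assert (E4 : 2 * (u + v) * (e * (u + v)) = / 2 * (eta / 4 ^ k)).
{ unfold u, v, e. replace 4 with (2 * 2) at 2 by ring. rewrite Rpow_mult_distr.
  field. split; [|lra]. apply pow_nonzero; lra. }
assert (0 < eta / 4 ^ k).
{ apply Rdiv_lt_0_compat; [lra|]. apply pow_lt; lra. }
lra.
Qed.

End Bisection.

(** No continuity of the derivative is assumed, so Green's formula is not
    available and bisection is needed. *)
Theorem goursat (f : C -> C) (x1 x2 y1 y2 : R) : x1 < x2 -> y1 < y2 ->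
  holo_rect f x1 x2 y1 y2 -> rect_int f x1 x2 y1 y2 = 0%C.
Proof.
intros Hx Hy Hf.
replace x2 with (x1 + (x2 - x1)) in * by ring.
replace y2 with (y1 + (y2 - y1)) in * by ring.
destruct (Req_dec (Cmod (rect_int f x1 (x1 + (x2 - x1)) y1 (y1 + (y2 - y1)))) 0) as [E|E].
- apply Cmod_eq_0, E.
- exfalso. pose proof (Cmod_ge_0 (rect_int f x1 (x1 + (x2 - x1)) y1 (y1 + (y2 - y1)))) as H.
  apply (bisection_absurd f x1 y1 (x2 - x1) (y2 - y1) ltac:(lra) ltac:(lra) Hf
    (Cmod (rect_int f x1 (x1 + (x2 - x1)) y1 (y1 + (y2 - y1))) / 2)); lra.
Qed.

(** * The complex exponential *)

Lemma Cexp_plus (z w : C) : Cexp (z + w) = (Cexp z * Cexp w)%C.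
Proof.
unfold Cexp. destruct z as [x y], w as [u v]. simpl.
rewrite exp_plus, cos_plus, sin_plus.
apply injective_projections; simpl; ring.
Qed.

Lemma Cexp_0 : Cexp 0 = 1%C.
Proof.
unfold Cexp. simpl. rewrite exp_0, cos_0, sin_0.
apply injective_projections; simpl; ring.
Qed.

Lemma Cmod_Cexp (z : C) : Cmod (Cexp z) = exp (Re z).
Proof.
unfold Cmod, Cexp. simpl fst. simpl snd.
replace ((exp (Re z) * cos (Im z)) ^ 2 + (exp (Re z) * sin (Im z)) ^ 2)
  with (Rsqr (exp (Re z)) * (Rsqr (sin (Im z)) + Rsqr (cos (Im z)))) by (unfold Rsqr; ring).
rewrite sin2_cos2, Rmult_1_r. apply sqrt_Rsqr. apply Rlt_le, exp_pos.
Qed.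

Lemma Cexp_2PI (z : C) : Cexp (z + (0, 2 * PI)) = Cexp z.
Proof.
rewrite Cexp_plus.
replace (Cexp (0, 2 * PI)) with (RtoC 1); [ring|].
unfold Cexp. simpl. rewrite exp_0, cos_2PI, sin_2PI.
apply injective_projections; simpl; ring.
Qed.

Lemma exp_m1_bound (x : R) : Rabs (exp x - 1) <= Rabs x * exp (Rabs x).
Proof.
destruct (Rle_dec 0 x) as [H|H].
- pose proof (exp_ineq1_le x). rewrite !Rabs_right by lra.
  pose proof (exp_ineq1_le (- x)). rewrite exp_Ropp in H1.
  pose proof (exp_pos x).
  apply (Rmult_le_compat_l (exp x)) in H1; [|lra]. rewrite Rinv_r in H1; lra.
- pose proof (exp_ineq1_le x). rewrite !Rabs_left; try lra.
  2: { rewrite <- exp_0. pose proof (exp_increasing x 0). lra. }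
  pose proof (exp_ineq1_le (- x)). nra.
Qed.

Lemma sin_abs_le (x : R) : Rabs (sin x) <= Rabs x.
Proof.
destruct (MVT_gen sin 0 x cos) as [c [_ Hc]].
- intros. apply is_derive_Reals, derivable_pt_lim_sin.
- intros. apply continuity_sin.
- rewrite sin_0, !Rminus_0_r in Hc. rewrite Hc, Rabs_mult.
  pose proof (COS_bound c). assert (Rabs (cos c) <= 1) by (apply Rabs_le; lra).
  pose proof (Rabs_pos x). nra.
Qed.

Lemma one_minus_cos_bound (x : R) : 0 <= 1 - cos x <= x ^ 2.
Proof.
split; [pose proof (COS_bound x); lra|].
replace x with (2 * (x / 2)) at 1 by lra. rewrite cos_2a_sin.
pose proof (sin_abs_le (x / 2)) as H. apply Rsqr_le_abs_1 in H. unfold Rsqr in H. nra.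
Qed.

Lemma sin_minus_id_bound (x : R) : Rabs (sin x - x) <= x ^ 2.
Proof.
destruct (MVT_gen (fun t => sin t - t) 0 x (fun t => cos t - 1)) as [c [Hc1 Hc]].
- intros. auto_derive; [trivial|]. ring.
- intros. apply continuity_pt_minus; [apply continuity_sin|apply derivable_continuous, derivable_id].
- rewrite sin_0, !Rminus_0_r in Hc. rewrite Hc, Rabs_mult.
  assert (Hcx : Rabs c <= Rabs x).
  { revert Hc1. unfold Rmin, Rmax, Rabs. repeat (destruct (Rle_dec _ _) || destruct (Rcase_abs _)); lra. }
  assert (Hcc : Rabs (cos c - 1) <= Rabs c).
  { replace (cos c) with (cos (2 * (c / 2))) by (f_equal; lra). rewrite cos_2a_sin.
    replace (1 - 2 * sin (c / 2) * sin (c / 2) - 1) with (- (2 * (sin (c / 2) * sin (c / 2)))) by ring.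
    rewrite Rabs_Ropp, !Rabs_mult, (Rabs_right 2) by lra.
    pose proof (sin_abs_le (c / 2)) as H. unfold Rdiv in H at 2. rewrite Rabs_mult, (Rabs_right (/ 2)) in H by lra.
    pose proof (SIN_bound (c / 2)). assert (Rabs (sin (c / 2)) <= 1) by (apply Rabs_le; lra).
    pose proof (Rabs_pos (sin (c / 2))). nra. }
  replace (x ^ 2) with (Rabs x * Rabs x) by (rewrite <- (pow2_abs x); ring).
  apply Rmult_le_compat_r; [apply Rabs_pos|lra].
Qed.

Lemma Cmod_le_abs (z : C) : Cmod z <= Rabs (Re z) + Rabs (Im z).
Proof.
replace (Cmod z) with (Cmod (RtoC (Re z) + RtoC (Im z) * Ci))
  by (f_equal; destruct z; apply injective_projections; simpl; ring).
eapply Rle_trans; [apply Cmod_triangle|].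
rewrite Cmod_mult, !Cmod_R, Cmod_Ci. lra.
Qed.

Lemma im_le_Cmod (z : C) : Rabs (Im z) <= Cmod z.
Proof. eapply Rle_trans; [|apply Rmax_Cmod]. apply Rmax_r. Qed.

(** Second-order Taylor bound; the constant 5 is not optimal.  It follows from
    one-variable bounds for [exp], [cos] and [sin] applied to the two components. *)
Lemma Cexp_taylor (w : C) : Cmod (Cexp w - 1 - w) <= 5 * Cmod w ^ 2 * exp (Cmod w).
Proof.
destruct w as [x y].
pose proof (re_le_Cmod (x, y)) as Hx. pose proof (im_le_Cmod (x, y)) as Hy.
simpl Re in Hx. simpl Im in Hy.
set (m := Cmod (x, y)) in *.
assert (Hxm : exp (Rabs x) <= exp m) by (destruct Hx as [Hx| ->]; [left; apply exp_increasing, Hx|lra]).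
assert (He : exp x <= exp (Rabs x)).
{ destruct (Rle_abs x) as [H| <-]; [left; apply exp_increasing, H|lra]. }
assert (H1 : 1 <= exp m).
{ pose proof (exp_ineq1_le m). pose proof (Cmod_ge_0 (x, y)). unfold m in *. lra. }
pose proof (Rabs_pos x) as Px. pose proof (Rabs_pos y) as Py.
pose proof (exp_pos x) as Pe.
eapply Rle_trans; [apply Cmod_le_abs|].
replace (Re (Cexp (x, y) - 1 - (x, y))) with ((exp x - 1 - x) + exp x * (cos y - 1)) by (simpl; ring).
replace (Im (Cexp (x, y) - 1 - (x, y))) with ((exp x - 1) * sin y + (sin y - y)) by (simpl; ring).
assert (A1 : Rabs (exp x - 1 - x) <= m ^ 2 * exp m).
{ pose proof (exp_ineq1_le x). rewrite Rabs_right by lra.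
  pose proof (exp_m1_bound x) as B.
  assert (exp x - 1 - x <= Rabs x * Rabs (exp x - 1)).
  { rewrite <- Rabs_mult. eapply Rle_trans; [|apply Rle_abs].
    pose proof (exp_ineq1_le (- x)) as C1. rewrite exp_Ropp in C1.
    apply (Rmult_le_compat_l (exp x)) in C1; [|lra]. rewrite Rinv_r in C1; lra. }
  assert (Rabs x * Rabs (exp x - 1) <= Rabs x * (Rabs x * exp (Rabs x))).
  { apply Rmult_le_compat_l; assumption. }
  assert (Rabs x * Rabs x <= m ^ 2) by nra.
  assert (Rabs x * Rabs x * exp (Rabs x) <= m ^ 2 * exp m).
  { apply Rmult_le_compat; [nra|apply Rlt_le, exp_pos|lra|lra]. }
  lra. }
assert (A2 : Rabs (exp x * (cos y - 1)) <= m ^ 2 * exp m).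
{ rewrite Rabs_mult, (Rabs_right (exp x)), (Rabs_left1 (cos y - 1)) by
    (pose proof (one_minus_cos_bound y); lra).
  pose proof (one_minus_cos_bound y) as B.
  assert (y ^ 2 <= m ^ 2) by (rewrite <- (pow2_abs y); nra).
  rewrite Rmult_comm. apply Rmult_le_compat; lra. }
assert (A3 : Rabs ((exp x - 1) * sin y) <= m ^ 2 * exp m).
{ rewrite Rabs_mult. pose proof (exp_m1_bound x) as B. pose proof (sin_abs_le y) as D.
  assert (Rabs (exp x - 1) * Rabs (sin y) <= (Rabs x * exp (Rabs x)) * Rabs y).
  { apply Rmult_le_compat; auto using Rabs_pos. }
  assert (Rabs x * Rabs y * exp (Rabs x) <= m ^ 2 * exp m).
  { apply Rmult_le_compat; [nra|apply Rlt_le, exp_pos|nra|lra]. }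
  lra. }
assert (A4 : Rabs (sin y - y) <= m ^ 2 * exp m).
{ pose proof (sin_minus_id_bound y).
  assert (y ^ 2 <= m ^ 2) by (rewrite <- (pow2_abs y); nra).
  assert (0 <= m ^ 2) by nra. nra. }
assert (0 <= m ^ 2 * exp m) by (pose proof (exp_pos m); nra).
pose proof (Rabs_triang (exp x - 1 - x) (exp x * (cos y - 1))).
pose proof (Rabs_triang ((exp x - 1) * sin y) (sin y - y)). lra.
Qed.

Lemma cderiv_Cexp (z : C) : cderiv Cexp z (Cexp z).
Proof.
apply cderiv_eps. intros eps Heps.
pose proof (exp_pos (Re z)) as He. pose proof (exp_pos 1) as H1.
set (K := 5 * exp 1 * exp (Re z)).
assert (HK : 0 < K) by (unfold K; repeat apply Rmult_lt_0_compat; lra).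
exists (Rmin 1 (eps / K)); split.
{ apply Rmin_pos; [lra|]. apply Rdiv_lt_0_compat; lra. }
intros w Hw.
assert (W1 := Rlt_le_trans _ _ _ Hw (Rmin_l _ _)).
assert (W2 := Rlt_le_trans _ _ _ Hw (Rmin_r _ _)).
replace (Cexp w) with (Cexp z * Cexp (w - z))%C
  by (rewrite <- Cexp_plus; f_equal; ring).
set (v := (w - z)%C) in *.
replace (Cexp z * Cexp v - Cexp z - v * Cexp z)%C with (Cexp z * (Cexp v - 1 - v))%C by ring.
rewrite Cmod_mult, Cmod_Cexp.
pose proof (Cexp_taylor v) as T. pose proof (Cmod_ge_0 v) as Hv.
assert (exp (Cmod v) <= exp 1) by (left; apply exp_increasing; lra).
apply Rle_trans with (exp (Re z) * (5 * Cmod v ^ 2 * exp 1)).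
{ apply Rmult_le_compat_l; [lra|]. eapply Rle_trans; [exact T|].
  apply Rmult_le_compat_l; [nra|lra]. }
apply (Rmult_lt_compat_r K) in W2; [|lra].
unfold Rdiv in W2. rewrite Rmult_assoc, Rinv_l, Rmult_1_r in W2 by lra.
replace (exp (Re z) * (5 * Cmod v ^ 2 * exp 1)) with (Cmod v * K * Cmod v) by (unfold K; ring).
apply Rmult_le_compat_r; lra.
Qed.

Lemma cderiv_exp_comp (f : C -> C) (z l : C) : cderiv f z l ->
  cderiv (fun w => Cexp (f w)) z (l * Cexp (f z))%C.
Proof. intros H. apply (cderiv_comp Cexp f); [apply cderiv_Cexp|exact H]. Qed.

Lemma Cmod_unit_circle (z : C) : z <> 0%C -> (Re z / Cmod z)² + (Im z / Cmod z)² = 1.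
Proof.
intros Hz. apply Cmod_gt_0 in Hz. pose proof (Cmod2_alt z) as H. unfold Rsqr.
replace (Re z / Cmod z * (Re z / Cmod z) + Im z / Cmod z * (Im z / Cmod z))
  with ((Re z ^ 2 + Im z ^ 2) / Cmod z ^ 2) by (field; lra).
rewrite <- H. field. lra.
Qed.

Lemma Re_over_Cmod_bound (z : C) : z <> 0%C -> -1 <= Re z / Cmod z <= 1.
Proof.
intros Hz. pose proof (Cmod_unit_circle z Hz) as H. unfold Rsqr in H. nra.
Qed.

Lemma Cexp_Clog (z : C) : z <> 0%C -> Cexp (Clog z) = z.
Proof.
intros Hz. pose proof (Cmod_unit_circle z Hz) as Hu.
pose proof (Re_over_Cmod_bound z Hz) as Hb.
assert (Hm := proj1 (Cmod_gt_0 z) Hz).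
assert (Hs : sin (acos (Re z / Cmod z)) = Rabs (Im z / Cmod z)).
{ rewrite sin_acos by exact Hb. rewrite <- sqrt_Rsqr_abs. f_equal. lra. }
assert (Hc : cos (Carg z) = Re z / Cmod z).
{ unfold Carg. destruct (Rle_dec 0 (Im z)); [|rewrite cos_neg]; apply cos_acos; exact Hb. }
assert (Hs' : sin (Carg z) = Im z / Cmod z).
{ unfold Carg. destruct (Rle_dec 0 (Im z)) as [H|H]; [|rewrite sin_neg]; rewrite Hs.
  - apply Rabs_right, Rle_ge, Rdiv_le_0_compat; assumption.
  - unfold Rdiv. rewrite Rabs_left; [ring|].
    pose proof (Rinv_0_lt_compat _ Hm). nra. }
unfold Cexp.
change (Re (Clog z)) with (ln (Cmod z)). change (Im (Clog z)) with (Carg z).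
rewrite exp_ln, Hc, Hs' by exact Hm. unfold Re, Im.
apply injective_projections; simpl fst; simpl snd; field; lra.
Qed.

Lemma Clog_upper (z : C) : 0 < Im z -> 0 < Im (Clog z) < PI.
Proof.
intros H.
assert (Hz : z <> 0%C) by (intros ->; simpl in H; lra).
pose proof (Cmod_unit_circle z Hz) as Hu.
assert (Hm := proj1 (Cmod_gt_0 z) Hz).
assert (0 < Im z / Cmod z) by (apply Rdiv_lt_0_compat; assumption).
unfold Clog, Carg. cbn [Im snd]. change (snd z) with (Im z).
destruct (Rle_dec 0 (Im z)); [|lra].
apply acos_bound_lt. unfold Rsqr in Hu. nra.
Qed.

(** * The mean value property and unique continuation *)

Lemma cont_bounded (f : R -> C) (a b : R) :
  (forall t, a <= t <= b -> rcont f t) -> exists M, 0 <= M /\ forall t, a <= t <= b -> Cmod (f t) <= M.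
Proof.
intros H.
destruct (@bounded_continuity R_AbsRing C_R_NormedModule f a b) as [M HM].
- intros x Hx. exact (H x Hx).
- exists (Rabs M); split; [apply Rabs_pos|]. intros t Ht. rewrite <- norm_C_R.
  left. eapply Rlt_le_trans; [exact (HM t Ht)|apply Rle_abs].
Qed.

Definition circle (b : C) (r y : R) : C := (b + RtoC r * Cexp (0, y))%C.

Lemma Cmod_circle b r y : 0 <= r -> Cmod (circle b r y - b) = r.
Proof.
intros Hr. unfold circle. replace (b + RtoC r * Cexp (0, y) - b)%C with (RtoC r * Cexp (0, y))%C by ring.
rewrite Cmod_mult, Cmod_R, Cmod_Cexp. simpl. rewrite exp_0, Rabs_right; lra.
Qed.

Lemma Cexp_re_im (x y : R) : Cexp (x, y) = (RtoC (exp x) * Cexp (0, y))%C.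
Proof.
unfold Cexp. simpl. rewrite exp_0. apply injective_projections; simpl; ring.
Qed.

(** In the logarithmic coordinate [b + exp zeta] a circle is a vertical segment
    of length [2 PI], and Goursat's theorem on a rectangle says that the mean
    over the circle does not depend on its radius. *)
Lemma mean_value (h : C -> C) (b : C) (r : R) : 0 < r ->
  (forall w, Cmod (w - b) <= r -> exists l, cderiv h w l) ->
  CInt (fun y => h (circle b r y)) 0 (2 * PI) = (RtoC (2 * PI) * h b)%C.
Proof.
intros Hr Hh. pose proof PI_RGT_0 as HPI.
set (F := fun zeta : C => h (b + Cexp zeta)%C).
assert (HF : forall x, x < ln r -> holo_rect F x (ln r) 0 (2 * PI)).
{ intros x _ u v [_ Hu] _.
  destruct (Hh (b + Cexp (u, v))%C) as [l Hl].
  - replace (b + Cexp (u, v) - b)%C with (Cexp (u, v)) by ring.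
    rewrite Cmod_Cexp. simpl. rewrite <- (exp_ln r Hr).
    destruct Hu as [Hu| ->]; [left; apply exp_increasing, Hu|lra].
  - eexists. unfold F. eapply (cderiv_comp h (fun z => b + Cexp z)%C); [exact Hl|].
    eapply cderiv_plus; [apply cderiv_const|apply cderiv_Cexp]. }
assert (HV : forall x, x < ln r ->
  CInt (fun y => F (x, y)) 0 (2 * PI) = CInt (fun y => F (ln r, y)) 0 (2 * PI)).
{ intros x Hx.
  pose proof (goursat F x (ln r) 0 (2 * PI) Hx ltac:(lra) (HF x Hx)) as G.
  unfold rect_int in G.
  rewrite (CInt_ext (fun t => F (t, 2 * PI)) (fun t => F (t, 0))) in G.
  2:{ intros t _. unfold F. do 2 f_equal. rewrite <- (Cexp_2PI (t, 0)). f_equal.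
      apply injective_projections; simpl; ring. }
  set (u := CInt (fun y => F (ln r, y)) 0 (2 * PI)) in *.
  set (v := CInt (fun y => F (x, y)) 0 (2 * PI)) in *.
  replace (CInt (fun x => F (x, 0)) x (ln r) - CInt (fun x => F (x, 0)) x (ln r) + Ci * (u - v))%C
   with (Ci * (u - v))%C in G by ring.
  transitivity (u + Ci * (Ci * (u - v)))%C; [|rewrite G; ring].
  destruct u, v; apply injective_projections; simpl; ring. }
assert (E0 : CInt (fun y => h (circle b r y)) 0 (2 * PI) = CInt (fun y => F (ln r, y)) 0 (2 * PI)).
{ apply CInt_ext. intros t _. unfold F, circle. rewrite (Cexp_re_im (ln r)), exp_ln by lra. reflexivity. }
rewrite E0. set (I0 := CInt (fun y => F (ln r, y)) 0 (2 * PI)) in *.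
assert (D : forall eps, 0 < eps -> Cmod (I0 - RtoC (2 * PI) * h b) <= 2 * PI * eps).
{ intros eps Heps.
  destruct (Hh b) as [l Hl].
  { replace (b - b)%C with (RtoC 0) by ring. rewrite Cmod_0. lra. }
  destruct (cderiv_continuous h b l Hl eps Heps) as [d [Hd Hd']].
  set (x := Rmin (ln r) (ln d) - 1).
  assert (X1 : x < ln r) by (unfold x; pose proof (Rmin_l (ln r) (ln d)); lra).
  assert (X2 : x < ln d) by (unfold x; pose proof (Rmin_r (ln r) (ln d)); lra).
  rewrite <- (HV x X1).
  assert (HHx : holo_rect F x (ln r) 0 (2 * PI)) by (apply HF, X1).
  assert (Hc : contOn (fun y => F (x, y)) 0 (2 * PI)).
  { eapply holo_rect_cont_v; [exact HHx|lra|lra]. }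
  assert (Hk : contOn (fun _ : R => h b) 0 (2 * PI)).
  { intros t _. apply continuous_const. }
  replace (RtoC (2 * PI) * h b)%C with (CInt (fun _ => h b) 0 (2 * PI))
    by (rewrite CInt_const; do 2 f_equal; lra).
  rewrite <- CInt_minus by assumption.
  replace (2 * PI * eps) with ((2 * PI - 0) * eps) by ring.
  apply CInt_bound; [lra| |].
  - intros t Ht. apply (continuous_minus (V := C_R_NormedModule)); [apply Hc, Ht|apply Hk, Ht].
  - intros t _. left. unfold F. apply Hd'.
    replace (b + Cexp (x, t) - b)%C with (Cexp (x, t)) by ring.
    rewrite Cmod_Cexp. simpl. rewrite <- (exp_ln d Hd). apply exp_increasing, X2. }
assert (Z : Cmod (I0 - RtoC (2 * PI) * h b) = 0).
{ apply Rle_antisym; [|apply Cmod_ge_0]. apply le_epsilon. intros e He.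
  eapply Rle_trans; [apply (D (e / (2 * PI)))|].
  - apply Rdiv_lt_0_compat; lra.
  - right. field. lra. }
apply Cmod_eq_0 in Z.
replace I0 with (I0 - RtoC (2 * PI) * h b + RtoC (2 * PI) * h b)%C by ring.
rewrite Z. ring.
Qed.

Lemma circle_rcont (h : C -> C) (b : C) (r t : R) (l : C) :
  cderiv h (circle b r t) l -> rcont (fun y => h (circle b r y)) t.
Proof.
intros Hl. eapply rderiv_rcont.
apply (cderiv_rderiv_v (fun z => h (b + RtoC r * Cexp z)%C) 0 t).
eapply (cderiv_comp h (fun z => b + RtoC r * Cexp z)%C); [exact Hl|].
eapply cderiv_plus; [apply cderiv_const|].
eapply cderiv_mult; [apply cderiv_const|apply cderiv_Cexp].
Qed.

(** The form of the maximum principle used below: the bound on the circle may be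
    improved by holomorphic weights equal to 1 at the centre. *)
Lemma mean_value_bound (h : C -> C) (b : C) (r M : R) : 0 < r ->
  (forall w, Cmod (w - b) <= r -> exists l, cderiv h w l) ->
  (forall y, 0 <= y <= 2 * PI -> Cmod (h (circle b r y)) <= M) -> Cmod (h b) <= M.
Proof.
intros Hr Hh HM. pose proof PI_RGT_0 as HPI.
pose proof (mean_value h b r Hr Hh) as E.
assert (H : Cmod (RtoC (2 * PI) * h b) <= (2 * PI - 0) * M).
{ rewrite <- E. apply CInt_bound; [lra| |exact HM].
  intros t _. destruct (Hh (circle b r t)) as [l Hl]; [rewrite Cmod_circle; lra|].
  eapply circle_rcont, Hl. }
rewrite Cmod_mult, Cmod_R, Rabs_right in H by lra.
apply Rmult_le_reg_l with (2 * PI); lra.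
Qed.

Lemma cderiv_pow (f : C -> C) (z : C) (n : nat) :
  (exists l, cderiv f z l) -> exists l, cderiv (fun w => f w ^ n)%C z l.
Proof.
intros [l Hl]. induction n as [|n [m Hm]].
- eexists. simpl. apply cderiv_const.
- eexists. simpl. eapply cderiv_mult; [exact Hl|exact Hm].
Qed.

(** One step of continuation across a horizontal line.  The weight
    [(Ci r / (z - (b - Ci r)))^n] is 1 at [b]; on the part of a circle around
    [b] where [F] need not vanish it is at most [(19/20)^n], because these points
    are farther than [r] from the pole [b - Ci r]. *)
Lemma zero_strip_step (F : C -> C) (c : R) : PI / 2 <= c < PI ->
  (forall z, 0 < Im z < PI -> exists l, cderiv F z l) ->
  (forall z, 0 < Im z < c -> F z = 0%C) ->
  forall z, 0 < Im z < c + (PI - c) / 32 -> F z = 0%C.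
Proof.
intros Hc HF H0 b Hb.
destruct (Rlt_dec (Im b) c) as [Hbc|Hbc]; [apply H0; lra|].
set (r := PI - c). set (rho := r / 2).
assert (Hr : 0 < r) by (unfold r; lra).
assert (Hrho : 0 < rho) by (unfold rho; lra).
assert (Hdisc : forall w, Cmod (w - b) <= rho -> 0 < Im w < PI).
{ intros w Hw. pose proof (im_le_Cmod (w - b)) as Hi.
  replace (Im (w - b)) with (Im w - Im b) in Hi by (destruct w, b; simpl; ring).
  assert (Ha : Rabs (Im w - Im b) <= rho) by lra.
  apply Rabs_le_between in Ha. unfold rho, r in *. lra. }
set (a := (b - Ci * RtoC r)%C).
assert (Hfar : forall w, Cmod (w - b) <= rho -> (w - a)%C <> 0%C).
{ intros w Hw Hz.
  assert (E : (w - b)%C = (- (Ci * RtoC r))%C).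
  { replace (w - b)%C with ((w - a) - Ci * RtoC r)%C by (unfold a; ring). rewrite Hz. ring. }
  rewrite E, Cmod_opp, Cmod_mult, Cmod_Ci, Cmod_R, Rabs_right in Hw by lra. unfold rho in Hw. lra. }
destruct (cont_bounded (fun y => F (circle b rho y)) 0 (2 * PI)) as [M [HM0 HM]].
{ intros t _. destruct (HF (circle b rho t)) as [l Hl].
  - apply Hdisc. rewrite Cmod_circle; lra.
  - eapply circle_rcont, Hl. }
set (W := fun z => (Ci * RtoC r / (z - a))%C).
assert (HB : forall n, Cmod (F b) <= (19 / 20) ^ n * M).
{ intros n.
  set (G := fun z => (F z * W z ^ n)%C).
  assert (Gb : G b = F b).
  { unfold G, W, a. replace (b - (b - Ci * r))%C with (Ci * r)%C by ring.
    assert (N : (Ci * RtoC r)%C <> 0%C).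
    { apply Cmod_gt_0. rewrite Cmod_mult, Cmod_Ci, Cmod_R, Rabs_right; lra. }
    unfold Cdiv. rewrite Cinv_r by exact N.
    rewrite Cpow_1_l. ring. }
  rewrite <- Gb. apply (mean_value_bound G b rho); [exact Hrho| |].
  - intros w Hw. destruct (HF w (Hdisc w Hw)) as [l Hl].
    assert (HW : exists m, cderiv W w m).
    { eexists. unfold W, Cdiv. eapply cderiv_mult; [apply cderiv_const|].
      apply (cderiv_inv (fun z => z - a)%C); [apply Hfar, Hw|].
      eapply cderiv_minus; [apply cderiv_id|apply cderiv_const]. }
    destruct (cderiv_pow W w n HW) as [m Hm].
    eexists. eapply cderiv_mult; [exact Hl|exact Hm].
  - intros y Hy.
    assert (Hin : Cmod (circle b rho y - b) <= rho) by (rewrite Cmod_circle; lra).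
    pose proof (Hdisc _ Hin) as Hs.
    assert (P0 : 0 <= (19 / 20) ^ n) by (apply pow_le; lra).
    assert (Hcases : F (circle b rho y) = 0%C \/ c <= Im (circle b rho y)).
    { destruct (Rlt_dec (Im (circle b rho y)) c); [left; apply H0; lra|right; lra]. }
    unfold G. rewrite Cmod_mult, Cmod_pow.
    destruct Hcases as [Hz|Hz].
    + rewrite Hz, Cmod_0, Rmult_0_l. apply Rmult_le_pos; assumption.
    + assert (HWle : Cmod (W (circle b rho y)) <= 19 / 20).
      { unfold W. rewrite Cmod_div by (apply Hfar, Hin).
        rewrite Cmod_mult, Cmod_Ci, Cmod_R, Rabs_right by lra.
        set (d := Cmod (circle b rho y - a)).
        assert (Hd : 0 < d) by (apply Cmod_gt_0, Hfar, Hin).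
        assert (Hd2 : d ^ 2 = rho ^ 2 + r ^ 2 + 2 * r * (rho * sin y)).
        { unfold d. rewrite Cmod2_alt.
          replace (Re (circle b rho y - a)) with (rho * cos y)
            by (unfold circle, a, Cexp; destruct b; simpl; rewrite exp_0; ring).
          replace (Im (circle b rho y - a)) with (rho * sin y + r)
            by (unfold circle, a, Cexp; destruct b; simpl; rewrite exp_0; ring).
          replace (rho ^ 2) with (rho ^ 2 * ((sin y)² + (cos y)²)) by (rewrite sin2_cos2; ring).
          unfold Rsqr. ring. }
        assert (Hsin : - (r / 32) <= rho * sin y).
        { replace (Im (circle b rho y)) with (Im b + rho * sin y) in Hz
            by (unfold circle, Cexp; destruct b; simpl; rewrite exp_0; ring).
          unfold r in *. lra. }
        (* Here [d ^ 2 >= (1 + 1/4 - 1/16) r ^ 2], and 1 + 1/4 - 1/16 > (20/19)^2. *)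
        assert (Hdr : r <= 19 / 20 * d).
        { apply Rsqr_incr_0; [|lra|nra]. unfold Rsqr. unfold rho in *. nra. }
        apply Rmult_le_reg_r with d; [exact Hd|].
        replace (1 * r / d * d) with r by (field; lra). exact Hdr. }
      rewrite Rmult_comm. apply Rmult_le_compat.
      * apply pow_le, Cmod_ge_0.
      * apply Cmod_ge_0.
      * apply pow_incr; split; [apply Cmod_ge_0|exact HWle].
      * apply HM, Hy. }
apply Cmod_eq_0. apply Rle_antisym; [|apply Cmod_ge_0].
apply le_epsilon. intros e He. rewrite Rplus_0_l.
destruct (pow_lt_1_zero (19 / 20)) with (y := e / (M + 1)) as [n Hn].
- rewrite Rabs_right; lra.
- apply Rdiv_lt_0_compat; lra.
- specialize (Hn n (le_n n)). specialize (HB n).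
  assert (P0 : 0 <= (19 / 20) ^ n) by (apply pow_le; lra).
  rewrite Rabs_right in Hn by lra.
  apply (Rmult_lt_compat_r (M + 1)) in Hn; [|lra].
  replace (e / (M + 1) * (M + 1)) with e in Hn by (field; lra). nra.
Qed.

(** Each step reduces the distance of the zero set from the upper edge of the
    strip by the factor 31/32. *)
Lemma zero_strip (F : C -> C) :
  (forall z, 0 < Im z < PI -> exists l, cderiv F z l) ->
  (forall z, 0 < Im z < PI / 2 -> F z = 0%C) ->
  forall z, 0 < Im z < PI -> F z = 0%C.
Proof.
intros HF H0 z Hz. pose proof PI_RGT_0 as HPI.
assert (HI : forall k z, 0 < Im z < PI - PI / 2 * (31 / 32) ^ k -> F z = 0%C).
{ induction k as [|k IH].
  - intros w Hw. apply H0. simpl in Hw. lra.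
  - assert (P1 : 0 < (31 / 32) ^ k) by (apply pow_lt; lra).
    assert (P2 : (31 / 32) ^ k <= 1).
    { replace 1 with (1 ^ k) by apply pow1. apply pow_incr. lra. }
    intros w Hw. apply (zero_strip_step F (PI - PI / 2 * (31 / 32) ^ k)); auto.
    + split; nra.
    + simpl in Hw. lra. }
destruct (pow_lt_1_zero (31 / 32)) with (y := (PI - Im z) / PI) as [k Hk].
- rewrite Rabs_right; lra.
- apply Rdiv_lt_0_compat; lra.
- apply (HI k). split; [lra|]. specialize (Hk k (le_n k)).
  rewrite Rabs_right in Hk by (apply Rle_ge, pow_le; lra).
  apply (Rmult_lt_compat_r PI) in Hk; [|lra].
  replace ((PI - Im z) / PI * PI) with (PI - Im z) in Hk by (field; lra).
  assert (0 <= (31 / 32) ^ k) by (apply pow_le; lra). nra.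
Qed.

(** The logarithm turns the sectors [0 < arg z < t] into strips, so that the
    width of the continuation step depends on [t] only. *)
Theorem identity_upper_half_plane (h : C -> C) :
  (forall z, 0 < Im z -> exists l, cderiv h z l) ->
  (forall z, 0 < Im z -> 0 < Re z -> h z = 0%C) ->
  forall z, 0 < Im z -> h z = 0%C.
Proof.
intros Hh H0 z Hz.
assert (Hz0 : z <> 0%C) by (intros ->; simpl in Hz; lra).
rewrite <- (Cexp_Clog z Hz0).
apply (zero_strip (fun w => h (Cexp w))); [| |apply Clog_upper, Hz].
- intros w Hw. destruct (Hh (Cexp w)) as [l Hl].
  + simpl. apply Rmult_lt_0_compat; [apply exp_pos|apply sin_gt_0; apply Hw].
  + eexists. eapply (cderiv_comp h Cexp); [exact Hl|apply cderiv_Cexp].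
- intros w Hw. pose proof PI_RGT_0. apply H0; simpl; (apply Rmult_lt_0_compat; [apply exp_pos|]).
  + apply sin_gt_0; lra.
  + apply cos_gt_0; lra.
Qed.

(** * Improper integrals with an exponentially decaying majorant *)

Lemma locally_Cmod (l : C) (eps : R) : 0 < eps -> locally l (fun w : C => Cmod (w - l) < eps).
Proof.
intros He. apply locally_C.
exists (mkposreal eps He). intros w Hw. exact Hw.
Qed.

Lemma filterlim_Cmod {T : Type} (F : (T -> Prop) -> Prop) {FF : Filter F} (f : T -> C) (l : C) :
  filterlim f F (locally l) <-> forall eps, 0 < eps -> F (fun x => Cmod (f x - l) < eps).
Proof.
split.
- intros H eps He. exact (H _ (locally_Cmod l eps He)).
- intros H P HP. apply locally_C in HP. destruct HP as [d Hd].
  unfold filtermap. apply (filter_imp (fun x => Cmod (f x - l) < d)); [|apply H, cond_pos].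
  intros x Hx. apply Hd. exact Hx.
Qed.

Definition tends (f : R -> C) (l : C) : Prop :=
  forall eps, 0 < eps -> exists M, forall T, M < T -> Cmod (f T - l) < eps.

Lemma tends_unique f l m : tends f l -> tends f m -> l = m.
Proof.
intros Hl Hm.
assert (Z : Cmod (l - m) = 0).
{ apply Rle_antisym; [|apply Cmod_ge_0]. apply le_epsilon. intros e He. rewrite Rplus_0_l.
  destruct (Hl (e / 2)) as [M1 H1]; [lra|]. destruct (Hm (e / 2)) as [M2 H2]; [lra|].
  set (T := Rmax M1 M2 + 1).
  pose proof (Rmax_l M1 M2). pose proof (Rmax_r M1 M2).
  specialize (H1 T ltac:(unfold T; lra)). specialize (H2 T ltac:(unfold T; lra)).
  replace (l - m)%C with (- (f T - l) + (f T - m))%C by ring.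
  eapply Rle_trans; [apply Cmod_triangle|]. rewrite Cmod_opp. lra. }
apply Cmod_eq_0 in Z. replace l with (l - m + m)%C by ring. rewrite Z. ring.
Qed.

Lemma is_RInt_gen_tends (f : R -> C) (l : C) :
  @is_RInt_gen C_R_NormedModule f (at_point 0) (Rbar_locally p_infty) l ->
  tends (fun T => CInt f 0 T) l.
Proof.
intros H eps He.
destruct (H _ (locally_Cmod l eps He)) as [Q S HQ [M HS] HQS].
exists M. intros T HT.
destruct (HQS 0 T HQ (HS T HT)) as [y [Hy1 Hy2]].
rewrite (CInt_unique f 0 T y Hy1). exact Hy2.
Qed.

Lemma is_RInt_exp (nu a b : R) : nu <> 0 ->
  is_RInt (fun x => exp (- (nu * x))) a b ((exp (- (nu * a)) - exp (- (nu * b))) / nu).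
Proof.
intros Hnu.
replace ((exp (- (nu * a)) - exp (- (nu * b))) / nu)
  with (minus (- exp (- (nu * b)) / nu) (- exp (- (nu * a)) / nu)).
2:{ unfold minus, plus, opp; simpl. field. exact Hnu. }
apply (is_RInt_derive (fun x => - exp (- (nu * x)) / nu)).
- intros x _. auto_derive; [trivial|]. field. exact Hnu.
- intros x _. apply (ex_derive_continuous (fun x => exp (- (nu * x)))). auto_derive. trivial.
Qed.

Lemma CInt_exp_bound (f : R -> C) (m nu a b : R) : 0 < nu -> 0 <= m -> a <= b -> contOn f a b ->
  (forall x, a <= x <= b -> Cmod (f x) <= m * exp (- (nu * x))) ->
  Cmod (CInt f a b) <= m / nu * exp (- (nu * a)).
Proof.
intros Hnu Hm Hab Hc Hf.
apply Rle_trans with (m * ((exp (- (nu * a)) - exp (- (nu * b))) / nu)).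
- apply (CInt_bound_fun f (fun x => m * exp (- (nu * x))) a b); auto.
  apply (is_RInt_scal (V := R_NormedModule) (fun x => exp (- (nu * x)))).
  apply is_RInt_exp. lra.
- replace (m / nu * exp (- (nu * a))) with (m * (exp (- (nu * a)) / nu)) by (field; lra).
  apply Rmult_le_compat_l; [exact Hm|]. apply Rmult_le_compat_r.
  + apply Rlt_le, Rinv_0_lt_compat, Hnu.
  + pose proof (exp_pos (- (nu * b))). lra.
Qed.

(** The integral over [[0, +oo)], as a total function. *)
Definition CIntInf (f : R -> C) : C :=
  epsilon (inhabits (RtoC 0)) (fun l => tends (fun T => CInt f 0 T) l).

(** The majorant makes the integrals over [[0, T]] a Cauchy family. *)
Lemma CIntInf_spec (f : R -> C) (m nu : R) : 0 < nu -> 0 <= m ->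
  (forall x, rcont f x) -> (forall x, 0 <= x -> Cmod (f x) <= m * exp (- (nu * x))) ->
  tends (fun T => CInt f 0 T) (CIntInf f).
Proof.
intros Hnu Hm Hc Hf. unfold CIntInf. apply epsilon_spec.
assert (Hcc : forall a b, contOn f a b) by (intros a b t _; apply Hc).
assert (Hstep : forall s T, 0 <= s -> s <= T ->
  Cmod (CInt f 0 T - CInt f 0 s) <= m / nu * exp (- (nu * s))).
{ intros s T Hs HT. rewrite <- (CInt_Chasles f 0 s T) by apply Hcc.
  replace (CInt f 0 s + CInt f s T - CInt f 0 s)%C with (CInt f s T) by ring.
  apply CInt_exp_bound; auto. intros x Hx. apply Hf. lra. }
assert (Hsmall : forall eps, 0 < eps -> exists M, 0 <= M /\ m / nu * exp (- (nu * M)) < eps).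
{ intros eps He. set (M := (m + 1) / (nu * nu * eps)). exists M.
  assert (HM : 0 < M).
  { apply Rdiv_lt_0_compat; [lra|]. repeat apply Rmult_lt_0_compat; assumption. }
  split; [lra|]. rewrite exp_Ropp.
  pose proof (exp_ineq1_le (nu * M)) as E.
  assert (H0 : m / nu < eps * (nu * M)).
  { unfold M. replace (eps * (nu * ((m + 1) / (nu * nu * eps)))) with ((m + 1) / nu) by (field; lra).
    apply Rmult_lt_compat_r; [apply Rinv_0_lt_compat; lra|lra]. }
  assert (P0 : 0 < nu * M) by (apply Rmult_lt_0_compat; lra).
  apply (Rmult_lt_reg_r (exp (nu * M))); [apply exp_pos|].
  rewrite Rmult_assoc, Rinv_l by (pose proof (exp_pos (nu * M)); lra). nra. }
destruct (proj1 (filterlim_locally_cauchy (U := C_R_CompleteNormedModule)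
  (F := Rbar_locally p_infty) (fun T => CInt f 0 T))) as [l Hl].
- intros eps. destruct (Hsmall (eps / 2)) as [M [HM0 HM]]; [pose proof (cond_pos eps); lra|].
  exists (fun T => M < T). split; [exists M; auto|].
  intros u v Hu Hv.
  apply (C_NormedModule_mixin_compat1 (CInt f 0 u) (CInt f 0 v)).
  change (Cmod (CInt f 0 v - CInt f 0 u) < eps).
  replace (CInt f 0 v - CInt f 0 u)%C
    with ((CInt f 0 v - CInt f 0 M) + - (CInt f 0 u - CInt f 0 M))%C by ring.
  eapply Rle_lt_trans; [apply Cmod_triangle|]. rewrite Cmod_opp.
  pose proof (Hstep M u HM0 ltac:(lra)). pose proof (Hstep M v HM0 ltac:(lra)). lra.
- exists l. intros eps He.
  destruct (proj1 (filterlim_Cmod (Rbar_locally p_infty) (fun T => CInt f 0 T) l) Hl eps He) as [M HM].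
  exists M. exact HM.
Qed.

Lemma tends_bound (f : R -> C) (l c : C) (B : R) (s : R) : tends f l ->
  (forall T, s <= T -> Cmod (f T - c) <= B) -> Cmod (l - c) <= B.
Proof.
intros H HB. apply le_epsilon. intros e He.
destruct (H e He) as [M HM]. set (T := Rmax M s + 1).
pose proof (Rmax_l M s). pose proof (Rmax_r M s).
specialize (HM T ltac:(unfold T; lra)). specialize (HB T ltac:(unfold T; lra)).
replace (l - c)%C with (- (f T - l) + (f T - c))%C by ring.
eapply Rle_trans; [apply Cmod_triangle|]. rewrite Cmod_opp. lra.
Qed.

Lemma CIntInf_tail (f : R -> C) (m nu s : R) : 0 < nu -> 0 <= m -> 0 <= s ->
  (forall x, rcont f x) -> (forall x, 0 <= x -> Cmod (f x) <= m * exp (- (nu * x))) ->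
  Cmod (CIntInf f - CInt f 0 s) <= m / nu * exp (- (nu * s)).
Proof.
intros Hnu Hm Hs Hc Hf.
apply (tends_bound (fun T => CInt f 0 T) _ _ _ s); [exact (CIntInf_spec f m nu Hnu Hm Hc Hf)|].
intros T HT. cbv beta. assert (Hcc : forall a b, contOn f a b) by (intros a b t _; apply Hc).
rewrite <- (CInt_Chasles f 0 s T) by apply Hcc.
replace (CInt f 0 s + CInt f s T - CInt f 0 s)%C with (CInt f s T) by ring.
apply CInt_exp_bound; auto. intros x Hx. apply Hf. lra.
Qed.

Lemma tends_plus f g l m : tends f l -> tends g m -> tends (fun T => f T + g T)%C (l + m)%C.
Proof.
intros Hf Hg e He.
destruct (Hf (e / 2)) as [M1 H1]; [lra|]. destruct (Hg (e / 2)) as [M2 H2]; [lra|].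
exists (Rmax M1 M2). intros T HT. pose proof (Rmax_l M1 M2). pose proof (Rmax_r M1 M2).
specialize (H1 T ltac:(lra)). specialize (H2 T ltac:(lra)).
replace (f T + g T - (l + m))%C with ((f T - l) + (g T - m))%C by ring.
eapply Rle_lt_trans; [apply Cmod_triangle|]. lra.
Qed.

Lemma tends_scal f l (c : C) : tends f l -> tends (fun T => c * f T)%C (c * l)%C.
Proof.
intros Hf e He. pose proof (Cmod_ge_0 c) as Hc.
destruct (Hf (e / (1 + Cmod c))) as [M H1]; [apply Rdiv_lt_0_compat; lra|].
exists M. intros T HT. specialize (H1 T HT).
replace (c * f T - c * l)%C with (c * (f T - l))%C by ring. rewrite Cmod_mult.
apply (Rmult_lt_compat_r (1 + Cmod c)) in H1; [|lra].
replace (e / (1 + Cmod c) * (1 + Cmod c)) with e in H1 by (field; lra).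
pose proof (Cmod_ge_0 (f T - l)). nra.
Qed.

(** * Continuation of the integral to the upper half-plane *)

Definition Ccosh (t : C) : C := ((Cexp t + Cexp (- t)) / 2)%C.
Definition Csinh (t : C) : C := ((Cexp t - Cexp (- t)) / 2)%C.

Lemma exp_le (a b : R) : a <= b -> exp a <= exp b.
Proof. intros [H| ->]; [left; apply exp_increasing, H|lra]. Qed.

Lemma C2_neq_0 : RtoC 2 <> 0%C.
Proof. intros H. apply (f_equal fst) in H. simpl in H. lra. Qed.

Lemma Ccosh_pair (x y : R) : Ccosh (x, y) = (cosh x * cos y, sinh x * sin y).
Proof.
unfold Ccosh, Cexp, cosh, sinh. simpl. rewrite cos_neg, sin_neg.
apply injective_projections; simpl; field.
Qed.

Lemma Csinh_pair (x y : R) : Csinh (x, y) = (sinh x * cos y, cosh x * sin y).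
Proof.
unfold Csinh, Cexp, cosh, sinh. simpl. rewrite cos_neg, sin_neg.
apply injective_projections; simpl; field.
Qed.

Lemma cderiv_Csinh (t : C) : cderiv Csinh t (Ccosh t).
Proof.
unfold Csinh, Ccosh, Cdiv.
eapply cderiv_val.
- eapply cderiv_mult; [|apply cderiv_const].
  eapply cderiv_minus; [apply cderiv_Cexp|].
  apply cderiv_exp_comp. eapply cderiv_opp, cderiv_id.
- cbv beta. ring.
Qed.

Lemma cderiv_Ccosh (t : C) : cderiv Ccosh t (Csinh t).
Proof.
unfold Csinh, Ccosh, Cdiv.
eapply cderiv_val.
- eapply cderiv_mult; [|apply cderiv_const].
  eapply cderiv_plus; [apply cderiv_Cexp|].
  apply cderiv_exp_comp. eapply cderiv_opp, cderiv_id.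
- cbv beta. ring.
Qed.

Lemma cosh_ge_1 (x : R) : 1 <= cosh x.
Proof.
unfold cosh. pose proof (exp_pos x) as H.
assert (H1 : exp x * exp (- x) = 1) by (rewrite <- exp_plus, Rplus_opp_r; apply exp_0).
pose proof (exp_pos (- x)).
pose proof (Rle_0_sqr (exp x - exp (- x))) as H2. unfold Rsqr in H2.
destruct (Rle_dec 2 (exp x + exp (- x))); nra.
Qed.

Lemma sinh_nonneg (x : R) : 0 <= x -> 0 <= sinh x.
Proof.
intros H. unfold sinh.
assert (exp (- x) <= exp x); [|lra].
destruct H as [H| <-]; [left; apply exp_increasing; lra|rewrite Ropp_0; lra].
Qed.

(** The integrand of the Anger-Weber integral for complex [t], so that the path of
    integration can be moved. *)
Definition integrand (nu : R) (Z t : C) : C := Cexp (- (RtoC nu * t) - Z * Csinh t)%C.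

Lemma cderiv_integrand nu Z t :
  cderiv (integrand nu Z) t (- (RtoC nu + Z * Ccosh t) * integrand nu Z t)%C.
Proof.
unfold integrand. eapply cderiv_val.
- apply cderiv_exp_comp. eapply cderiv_minus.
  + eapply cderiv_opp. eapply cderiv_mult; [apply cderiv_const|apply cderiv_id].
  + eapply cderiv_mult; [apply cderiv_const|apply cderiv_Csinh].
- cbv beta. ring.
Qed.

Lemma Cmod_integrand nu Z x y :
  Cmod (integrand nu Z (x, y)) =
  exp (- (nu * x) - Re Z * (sinh x * cos y) + Im Z * (cosh x * sin y)).
Proof.
unfold integrand. rewrite Cmod_Cexp, Csinh_pair. f_equal. destruct Z; simpl. ring.
Qed.

Definition entire (f : C -> C) : Prop := forall w, exists l, cderiv f w l.

Lemma entire_integrand nu Z : entire (integrand nu Z).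
Proof. intros w. eexists. apply cderiv_integrand. Qed.

Lemma entire_Csinh : entire Csinh.
Proof. intros w. eexists. apply cderiv_Csinh. Qed.

Lemma entire_mult f g : entire f -> entire g -> entire (fun w => f w * g w)%C.
Proof. intros Hf Hg w. destruct (Hf w), (Hg w). eexists. eapply cderiv_mult; eauto. Qed.

Lemma entire_minus f g : entire f -> entire g -> entire (fun w => f w - g w)%C.
Proof. intros Hf Hg w. destruct (Hf w), (Hg w). eexists. eapply cderiv_minus; eauto. Qed.

Lemma entire_opp f : entire f -> entire (fun w => - f w)%C.
Proof. intros Hf w. destruct (Hf w). eexists. eapply cderiv_opp; eauto. Qed.

Lemma entire_const c : entire (fun _ => c).
Proof. intros w. eexists. apply cderiv_const. Qed.

Lemma entire_rcont_h f x y : entire f -> rcont (fun x => f (x, y)) x.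
Proof. intros Hf. destruct (Hf (x, y)) as [l Hl]. eapply rderiv_rcont, cderiv_rderiv_h, Hl. Qed.

Lemma entire_rcont_v f x y : entire f -> rcont (fun y => f (x, y)) y.
Proof. intros Hf. destruct (Hf (x, y)) as [l Hl]. eapply rderiv_rcont, cderiv_rderiv_v, Hl. Qed.

Lemma entire_goursat f x1 x2 y1 y2 : entire f -> x1 <= x2 -> y1 < y2 -> rect_int f x1 x2 y1 y2 = 0%C.
Proof.
intros Hf [Hx| <-] Hy.
- apply goursat; auto. intros x y _ _. apply Hf.
- unfold rect_int, CInt. rewrite !RInt_point. unfold zero; simpl.
  apply injective_projections; simpl; ring.
Qed.

(** ** Differentiation under the integral sign *)

(** Replacing [Z] by [Z + k] multiplies the integrand by [exp (- k sinh t)], so this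
    is the Taylor remainder of the exponential. *)
Lemma integrand_taylor nu Z k t :
  Cmod (integrand nu (Z + k) t - integrand nu Z t - k * (- Csinh t * integrand nu Z t)) <=
  Cmod (integrand nu Z t) * (5 * (Cmod k * Cmod (Csinh t)) ^ 2 * exp (Cmod k * Cmod (Csinh t))).
Proof.
replace (integrand nu (Z + k) t) with (integrand nu Z t * Cexp (- (k * Csinh t)))%C.
2:{ unfold integrand. rewrite <- Cexp_plus. f_equal. ring. }
replace (integrand nu Z t * Cexp (- (k * Csinh t)) - integrand nu Z t
  - k * (- Csinh t * integrand nu Z t))%C
  with (integrand nu Z t * (Cexp (- (k * Csinh t)) - 1 - - (k * Csinh t)))%C by ring.
rewrite Cmod_mult. apply Rmult_le_compat_l; [apply Cmod_ge_0|].
eapply Rle_trans; [apply Cexp_taylor|]. rewrite Cmod_opp, Cmod_mult. lra.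
Qed.

Lemma cderiv_of_quadratic (f : C -> C) (z l : C) (K d : R) : 0 <= K -> 0 < d ->
  (forall k, Cmod k <= d -> Cmod (f (z + k)%C - f z - k * l) <= K * Cmod k ^ 2) -> cderiv f z l.
Proof.
intros HK Hd H. apply cderiv_eps. intros eps He.
exists (Rmin d (eps / (K + 1))); split.
{ apply Rmin_pos; [exact Hd|apply Rdiv_lt_0_compat; lra]. }
intros w Hw.
assert (W1 := Rlt_le_trans _ _ _ Hw (Rmin_l _ _)).
assert (W2 := Rlt_le_trans _ _ _ Hw (Rmin_r _ _)).
specialize (H (w - z)%C ltac:(lra)).
replace (z + (w - z))%C with w in H by ring.
eapply Rle_trans; [exact H|].
apply (Rmult_lt_compat_r (K + 1)) in W2; [|lra].
replace (eps / (K + 1) * (K + 1)) with eps in W2 by (field; lra).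
pose proof (Cmod_ge_0 (w - z)). nra.
Qed.

Section UpperHalfPlane.
Variable nu : R.
Hypothesis Hnu : 0 < nu.

(** The two pieces of the moved path: a vertical segment at abscissa [s] between
    the heights [- PI / 2] and 0, and the half-line at height [- PI / 2], on which
    [Z sinh t = - i Z cosh x] has nonnegative real part for [Im Z >= 0]. *)
Definition vert (Z : C) (s : R) : C := CInt (fun y => integrand nu Z (s, y)) (- (PI / 2)) 0.
Definition tail (Z : C) : C := CIntInf (fun x => integrand nu Z (x, - (PI / 2))).

Lemma Cmod_integrand_bottom Z x :
  Cmod (integrand nu Z (x, - (PI / 2))) = exp (- (nu * x) - Im Z * cosh x).
Proof.
rewrite Cmod_integrand, cos_neg, sin_neg, cos_PI2, sin_PI2. f_equal. ring.
Qed.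

Lemma Cmod_integrand_bottom_le Z x : 0 <= Im Z ->
  Cmod (integrand nu Z (x, - (PI / 2))) <= 1 * exp (- (nu * x)).
Proof.
intros HZ. rewrite Cmod_integrand_bottom, Rmult_1_l. pose proof (cosh_ge_1 x).
assert (0 <= Im Z * cosh x) by (apply Rmult_le_pos; lra).
apply exp_le. lra.
Qed.

(** On the segment from [- i PI / 2] to 0 both the integrand and [Csinh] have
    modulus at most 1, so the Taylor remainder is uniformly quadratic. *)
Lemma vert_cderiv Z : 0 < Im Z -> exists l, cderiv (fun Z => vert Z 0) Z l.
Proof.
intros HZ. pose proof PI_RGT_0 as HPI.
set (G := fun t => (- Csinh t * integrand nu Z t)%C).
assert (HG : entire G) by (apply entire_mult; [apply entire_opp, entire_Csinh|apply entire_integrand]).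
exists (CInt (fun y => G (0, y)) (- (PI / 2)) 0).
pose proof (exp_pos 1) as He1.
apply (cderiv_of_quadratic _ _ _ (PI / 2 * (5 * exp 1)) 1); [nra|lra|].
intros k Hk. unfold vert.
set (D := fun t => (integrand nu (Z + k) t - integrand nu Z t - k * G t)%C).
assert (HD : entire D).
{ apply entire_minus; [apply entire_minus; apply entire_integrand|].
  apply entire_mult; [apply entire_const|exact HG]. }
assert (Hc : forall f a b, entire f -> contOn (fun y => f (0, y)) a b).
{ intros f a b Hf t _. apply entire_rcont_v, Hf. }
assert (E : (CInt (fun y => integrand nu (Z + k) (0, y)) (- (PI / 2)) 0
   - CInt (fun y => integrand nu Z (0, y)) (- (PI / 2)) 0
   - k * CInt (fun y => G (0, y)) (- (PI / 2)) 0)%C = CInt (fun y => D (0, y)) (- (PI / 2)) 0).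
{ unfold D. rewrite CInt_minus, CInt_minus, CInt_scal; [reflexivity|..].
  - apply Hc, HG.
  - apply Hc, entire_integrand.
  - apply Hc, entire_integrand.
  - apply (Hc (fun t => integrand nu (Z + k) t - integrand nu Z t)%C), entire_minus; apply entire_integrand.
  - apply (Hc (fun t => k * G t)%C), entire_mult; [apply entire_const|exact HG]. }
rewrite E.
replace (PI / 2 * (5 * exp 1) * Cmod k ^ 2) with ((0 - - (PI / 2)) * (5 * exp 1 * Cmod k ^ 2)) by ring.
apply CInt_bound; [lra|apply Hc, HD|].
intros y Hy. unfold D, G.
eapply Rle_trans; [apply integrand_taylor|].
assert (Hs : Cmod (Csinh (0, y)) <= 1).
{ rewrite Csinh_pair, sinh_0, cosh_0. eapply Rle_trans; [apply Cmod_le_abs|]. simpl.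
  rewrite !Rmult_0_l, Rabs_R0, Rmult_1_l. pose proof (SIN_bound y).
  rewrite Rplus_0_l. apply Rabs_le; lra. }
assert (Hi : Cmod (integrand nu Z (0, y)) <= 1).
{ rewrite Cmod_integrand, sinh_0, cosh_0. replace 1 with (exp 0) at 2 by apply exp_0. apply exp_le.
  assert (sin y <= 0).
  { replace y with (- - y) by ring. rewrite sin_neg. pose proof (sin_ge_0 (- y)). lra. }
  nra. }
pose proof (Cmod_ge_0 k) as Pk. pose proof (Cmod_ge_0 (Csinh (0, y))) as Ps.
pose proof (Cmod_ge_0 (integrand nu Z (0, y))) as Pi0.
set (u := Cmod k * Cmod (Csinh (0, y))) in *.
assert (Hu : 0 <= u <= Cmod k) by (unfold u; nra).
assert (He : exp u <= exp 1) by (apply exp_le; lra).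
pose proof (exp_pos u).
assert (u ^ 2 <= Cmod k ^ 2) by nra.
apply Rle_trans with (1 * (5 * Cmod k ^ 2 * exp 1)); [|right; ring].
apply Rmult_le_compat; [assumption| |assumption|].
- apply Rmult_le_pos; nra.
- apply Rmult_le_compat; nra.
Qed.

Lemma exp_half_square (u : R) : 0 <= u -> u ^ 2 * exp (- u) <= 4.
Proof.
intros Hu. pose proof (exp_ineq1_le (u / 2)) as H.
replace u with (u / 2 + u / 2) at 2 by lra.
rewrite Ropp_plus_distr, exp_plus, exp_Ropp.
assert (P : 0 < exp (u / 2)) by apply exp_pos.
assert (Q : u / 2 * / exp (u / 2) <= 1).
{ apply Rmult_le_reg_r with (exp (u / 2)); [exact P|]. rewrite Rmult_assoc, Rinv_l; lra. }
assert (0 <= u / 2 * / exp (u / 2)).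
{ apply Rmult_le_pos; [lra|]. apply Rlt_le, Rinv_0_lt_compat, P. }
replace (u ^ 2 * (/ exp (u / 2) * / exp (u / 2))) with
  (4 * (u / 2 * / exp (u / 2)) * (u / 2 * / exp (u / 2))) by (field; lra).
nra.
Qed.

(** On the lower half-line the factor [exp (- Im Z cosh x)] dominates everything: one
    half of the exponent absorbs [exp (|k| cosh x)] for [|k| <= Im Z / 2], the other
    half absorbs the factor [cosh x ^ 2] of the Taylor remainder. *)
Lemma tail_cderiv Z : 0 < Im Z -> exists l, cderiv tail Z l.
Proof.
intros HZ. set (Y := Im Z) in *.
set (G := fun t => (- Csinh t * integrand nu Z t)%C).
assert (HG : entire G) by (apply entire_mult; [apply entire_opp, entire_Csinh|apply entire_integrand]).
set (b := - (PI / 2)).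
assert (Hrc : forall f x, entire f -> rcont (fun x => f (x, b)) x).
{ intros f x Hf. apply entire_rcont_h, Hf. }
assert (Hc : forall f u v, entire f -> contOn (fun x => f (x, b)) u v).
{ intros f u v Hf t _. apply Hrc, Hf. }
assert (HS : forall x, Cmod (Csinh (x, b)) = cosh x).
{ intros x. rewrite Csinh_pair. unfold b. rewrite cos_neg, sin_neg, cos_PI2, sin_PI2.
  pose proof (cosh_ge_1 x).
  replace (sinh x * 0, cosh x * - (1)) with (RtoC (- cosh x) * Ci)%C
    by (apply injective_projections; simpl; ring).
  rewrite Cmod_mult, Cmod_R, Cmod_Ci, Rabs_Ropp, Rabs_right; lra. }
assert (HGt : tends (fun T => CInt (fun x => G (x, b)) 0 T) (CIntInf (fun x => G (x, b)))).
{ apply (CIntInf_spec _ (/ Y) nu); [exact Hnu|apply Rlt_le, Rinv_0_lt_compat, HZ|intros; apply Hrc, HG|].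
  intros x _. unfold G. rewrite Cmod_mult, Cmod_opp, HS. unfold b. rewrite Cmod_integrand_bottom.
  fold Y. unfold Rminus. rewrite exp_plus.
  pose proof (exp_ineq1_le (Y * cosh x)) as E. rewrite (exp_Ropp (Y * cosh x)).
  pose proof (exp_pos (Y * cosh x)) as P1. pose proof (exp_pos (- (nu * x))) as P2.
  rewrite (Rmult_comm (exp (- (nu * x)))), <- Rmult_assoc.
  apply Rmult_le_compat_r; [lra|].
  apply Rmult_le_reg_r with (Y * exp (Y * cosh x)); [apply Rmult_lt_0_compat; assumption|].
  replace (cosh x * / exp (Y * cosh x) * (Y * exp (Y * cosh x))) with (Y * cosh x) by (field; lra).
  replace (/ Y * (Y * exp (Y * cosh x))) with (exp (Y * cosh x)) by (field; lra). lra. }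
exists (CIntInf (fun x => G (x, b))).
assert (HK : 0 < 80 / (Y * Y) / nu).
{ repeat apply Rdiv_lt_0_compat; try lra. apply Rmult_lt_0_compat; exact HZ. }
apply (cderiv_of_quadratic _ _ _ (80 / (Y * Y) / nu) (Y / 2)); [lra|lra|].
intros k Hk.
set (D := fun t => (integrand nu (Z + k) t - integrand nu Z t - k * G t)%C).
assert (HD : entire D).
{ apply entire_minus; [apply entire_minus; apply entire_integrand|].
  apply entire_mult; [apply entire_const|exact HG]. }
assert (HIt : forall W, 0 <= Im W -> tends (fun T => CInt (fun x => integrand nu W (x, b)) 0 T) (tail W)).
{ intros W HW. apply (CIntInf_spec _ 1 nu); [exact Hnu|lra| |].
  - intros x. apply (Hrc (integrand nu W)), entire_integrand.
  - intros x _. apply Cmod_integrand_bottom_le, HW. }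
assert (HWk : 0 <= Im (Z + k)%C).
{ pose proof (im_le_Cmod k) as Hi. assert (Ha : Rabs (Im k) <= Y / 2) by lra.
  apply Rabs_le_between in Ha. replace (Im (Z + k)%C) with (Y + Im k) by reflexivity. lra. }
assert (HDt : tends (fun T => CInt (fun x => D (x, b)) 0 T)
   (tail (Z + k) + (- (1)) * tail Z + (- k) * CIntInf (fun x => G (x, b)))%C).
{ intros e He.
  destruct (tends_plus _ _ _ _ (tends_plus _ _ _ _ (HIt (Z + k)%C HWk)
     (tends_scal _ _ (- (1))%C (HIt Z (Rlt_le _ _ HZ)))) (tends_scal _ _ (- k)%C HGt) e He) as [M HM].
  exists M. intros T HT. specialize (HM T HT). cbv beta in HM.
  replace (CInt (fun x => D (x, b)) 0 T) with
   (CInt (fun x => integrand nu (Z + k) (x, b)) 0 T + - (1) * CInt (fun x => integrand nu Z (x, b)) 0 T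
    + - k * CInt (fun x => G (x, b)) 0 T)%C; [exact HM|].
  unfold D. rewrite CInt_minus, CInt_minus, CInt_scal; [ring|..].
  - apply Hc, HG.
  - apply (Hc (integrand nu (Z + k))), entire_integrand.
  - apply (Hc (integrand nu Z)), entire_integrand.
  - apply (Hc (fun t => integrand nu (Z + k) t - integrand nu Z t)%C), entire_minus; apply entire_integrand.
  - apply (Hc (fun t => k * G t)%C), entire_mult; [apply entire_const|exact HG]. }
replace (tail (Z + k) - tail Z - k * CIntInf (fun x => G (x, b)))%C with
 ((tail (Z + k) + (- (1)) * tail Z + (- k) * CIntInf (fun x => G (x, b))) - 0)%C by ring.
apply (tends_bound _ _ _ _ 0 HDt). intros T HT. cbv beta.
replace (CInt (fun x => D (x, b)) 0 T - 0)%C with (CInt (fun x => D (x, b)) 0 T) by ring.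
replace (80 / (Y * Y) / nu * Cmod k ^ 2)
  with (80 / (Y * Y) * Cmod k ^ 2 / nu * exp (- (nu * 0)))
  by (rewrite Rmult_0_r, Ropp_0, exp_0; field; lra).
assert (HY2 : 0 < / (Y * Y)) by (apply Rinv_0_lt_compat, Rmult_lt_0_compat; exact HZ).
pose proof (Cmod_ge_0 k) as Pk.
apply CInt_exp_bound; [exact Hnu|unfold Rdiv; nra|exact HT|apply Hc, HD|].
intros x _. unfold D, G.
eapply Rle_trans; [apply integrand_taylor|]. rewrite HS.
unfold b. rewrite Cmod_integrand_bottom. fold Y.
pose proof (cosh_ge_1 x) as Hcx. set (c := cosh x) in *.
unfold Rminus. rewrite exp_plus.
set (u := Y / 2 * c).
assert (Hu : 0 <= u) by (unfold u; nra).
assert (Hexp : exp (- (Y * c)) * exp (Cmod k * c) <= exp (- u)).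
{ rewrite <- exp_plus. apply exp_le. unfold u. nra. }
pose proof (exp_half_square u Hu) as Hq.
pose proof (exp_pos (- (nu * x))) as P2.
apply Rle_trans with (exp (- (nu * x)) * (5 * Cmod k ^ 2 * (c ^ 2 * exp (- u)))).
- replace (exp (- (nu * x)) * exp (- (Y * c)) * (5 * (Cmod k * c) ^ 2 * exp (Cmod k * c)))
    with (exp (- (nu * x)) * (5 * Cmod k ^ 2 * (c ^ 2 * (exp (- (Y * c)) * exp (Cmod k * c))))) by ring.
  repeat (apply Rmult_le_compat_l; [nra|]). exact Hexp.
- rewrite (Rmult_comm (80 / (Y * Y) * Cmod k ^ 2)). apply Rmult_le_compat_l; [lra|].
  assert (c ^ 2 * exp (- u) <= 16 / (Y * Y)).
  { replace (c ^ 2 * exp (- u)) with (4 / (Y * Y) * (u ^ 2 * exp (- u))) by (unfold u; field; lra).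
    replace (16 / (Y * Y)) with (4 / (Y * Y) * 4) by (field; lra).
    apply Rmult_le_compat_l; [unfold Rdiv; lra|exact Hq]. }
  replace (80 / (Y * Y) * Cmod k ^ 2) with (5 * Cmod k ^ 2 * (16 / (Y * Y))) by (field; lra).
  apply Rmult_le_compat_l; [nra|assumption].
Qed.

(** ** The continued integral *)

(** The integral along the imaginary axis down to [- i PI / 2] and then parallel
    to the real axis. *)
Definition continued (Z : C) : C := (tail Z - Ci * vert Z 0)%C.

(** Goursat's theorem on the rectangle [[0, s] x [- PI / 2, 0]] lets the path follow
    the real axis up to [s] before it goes down; what remains of the half-line
    contributes at most [exp (- nu s) / nu]. *)
Lemma continued_shift Z s : 0 <= Im Z -> 0 <= s ->
  Cmod (continued Z - (CInt (fun x => integrand nu Z (x, 0)) 0 s - Ci * vert Z s)) <= / nu * exp (- (nu * s)).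
Proof.
intros HZ Hs. pose proof PI_RGT_0 as HPI.
pose proof (entire_goursat (integrand nu Z) 0 s (- (PI / 2)) 0 (entire_integrand nu Z) Hs ltac:(lra)) as G.
unfold rect_int in G. fold (vert Z s) in G. fold (vert Z 0) in G.
set (H0 := CInt (fun x => integrand nu Z (x, 0)) 0 s) in *.
assert (T : Cmod (tail Z - CInt (fun x => integrand nu Z (x, - (PI / 2))) 0 s) <= 1 / nu * exp (- (nu * s))).
{ apply CIntInf_tail; [exact Hnu|lra|exact Hs| |].
  - intros x. apply entire_rcont_h, entire_integrand.
  - intros x _. apply Cmod_integrand_bottom_le, HZ. }
set (H1 := CInt (fun x => integrand nu Z (x, - (PI / 2))) 0 s) in *.
unfold continued.
replace (tail Z - Ci * vert Z 0 - (H0 - Ci * vert Z s))%C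
  with ((tail Z - H1) + (H1 - H0 + Ci * (vert Z s - vert Z 0)))%C by ring.
rewrite G, Cplus_0_r. replace (/ nu) with (1 / nu) by (field; lra). exact T.
Qed.

Lemma vert_bound Z s : 0 <= Re Z -> 0 <= Im Z -> 0 <= s ->
  Cmod (vert Z s) <= PI / 2 * exp (- (nu * s)).
Proof.
intros HX HY Hs. pose proof PI_RGT_0 as HPI. unfold vert.
replace (PI / 2 * exp (- (nu * s))) with ((0 - - (PI / 2)) * exp (- (nu * s))) by ring.
apply CInt_bound; [lra| |].
- intros t _. apply entire_rcont_v, entire_integrand.
- intros y Hy. rewrite Cmod_integrand. apply exp_le.
  assert (0 <= cos y) by (apply cos_ge_0; lra).
  assert (sin y <= 0).
  { replace y with (- - y) by ring. rewrite sin_neg. pose proof (sin_ge_0 (- y)). lra. }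
  pose proof (sinh_nonneg s Hs). pose proof (cosh_ge_1 s).
  assert (0 <= Re Z * (sinh s * cos y)) by (apply Rmult_le_pos; [assumption|apply Rmult_le_pos; assumption]).
  assert (Im Z * (cosh s * sin y) <= 0).
  { assert (cosh s * sin y <= 0) by nra. nra. }
  lra.
Qed.

Lemma tends_exp (K : R) : forall eps, 0 < eps -> exists M, forall T, M < T -> K * exp (- (nu * T)) < eps.
Proof.
intros eps He. exists (Rmax 0 (K / (nu * eps))). intros T HT.
pose proof (Rmax_l 0 (K / (nu * eps))). pose proof (Rmax_r 0 (K / (nu * eps))).
assert (H1 : K / (nu * eps) < T) by lra.
assert (P : 0 < nu * eps) by (apply Rmult_lt_0_compat; assumption).
apply (Rmult_lt_compat_r (nu * eps)) in H1; [|exact P].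
replace (K / (nu * eps) * (nu * eps)) with K in H1 by (field; lra).
rewrite exp_Ropp. pose proof (exp_ineq1_le (nu * T)) as E.
apply (Rmult_lt_reg_r (exp (nu * T))); [apply exp_pos|].
rewrite Rmult_assoc, Rinv_l by (pose proof (exp_pos (nu * T)); lra). nra.
Qed.

(** In the first quadrant the integrand also decays on the vertical segments, so
    that these may be moved to infinity. *)
Lemma continued_first_quadrant Z : 0 <= Re Z -> 0 <= Im Z ->
  tends (fun T => CInt (fun x => integrand nu Z (x, 0)) 0 T) (continued Z).
Proof.
intros HX HY e He.
destruct (tends_exp (/ nu + PI / 2) e He) as [M HM].
exists (Rmax 0 M). intros T HT.
pose proof (Rmax_l 0 M). pose proof (Rmax_r 0 M).
specialize (HM T ltac:(lra)).
pose proof (continued_shift Z T HY ltac:(lra)) as HS.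
pose proof (vert_bound Z T HX HY ltac:(lra)) as HV.
set (I := CInt (fun x => integrand nu Z (x, 0)) 0 T) in *.
replace (I - continued Z)%C
  with (- (continued Z - (I - Ci * vert Z T)) + Ci * vert Z T)%C by ring.
eapply Rle_lt_trans; [apply Cmod_triangle|]. rewrite Cmod_opp, Cmod_mult, Cmod_Ci. lra.
Qed.

(** Any analytic continuation from the right half-plane is given by the integral
    over the moved path: both are holomorphic and agree in the first quadrant. *)
Theorem continued_unique (f : C -> C) :
  (forall Z, 0 < Im Z -> exists l, cderiv f Z l) ->
  (forall Z, 0 < Re Z -> tends (fun T => CInt (fun x => integrand nu Z (x, 0)) 0 T) (f Z)) ->
  forall Z, 0 < Im Z -> f Z = continued Z.
Proof.
intros Hf Hr Z HZ.
assert (H : (f Z - continued Z)%C = 0%C).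
{ apply (identity_upper_half_plane (fun Z => f Z - continued Z)%C); [| |exact HZ].
  - intros W HW. destruct (Hf W HW) as [l Hl].
    destruct (tail_cderiv W HW) as [m Hm]. destruct (vert_cderiv W HW) as [v Hv].
    eexists. eapply cderiv_minus; [exact Hl|]. unfold continued.
    eapply cderiv_minus; [exact Hm|]. eapply cderiv_mult; [apply cderiv_const|exact Hv].
  - intros W HW1 HW2.
    rewrite (tends_unique _ _ _ (Hr W HW2) (continued_first_quadrant W ltac:(lra) ltac:(lra))). ring. }
replace (f Z) with (f Z - continued Z + continued Z)%C by ring. rewrite H. ring.
Qed.

End UpperHalfPlane.

(** * Polynomial expressions and derivations *)

Inductive expr : Type :=
| Var (i : nat) | Cst (c : C) | Add (e1 e2 : expr) | Mul (e1 e2 : expr).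

Fixpoint ev (rho : nat -> C) (e : expr) : C :=
  match e with
  | Var i => rho i
  | Cst c => c
  | Add e1 e2 => (ev rho e1 + ev rho e2)%C
  | Mul e1 e2 => (ev rho e1 * ev rho e2)%C
  end.

Fixpoint der (d : nat -> expr) (e : expr) : expr :=
  match e with
  | Var i => d i
  | Cst _ => Cst 0
  | Add e1 e2 => Add (der d e1) (der d e2)
  | Mul e1 e2 => Add (Mul (der d e1) e2) (Mul e1 (der d e2))
  end.

(** The chain rule, by induction on the expression.  The factor [kappa] allows a
    derivation such as [d/du] to be used along a curve parametrised by [t]. *)
Lemma ev_chain (d : nat -> expr) (rho : C -> nat -> C) (kappa z : C) :
  (forall i, cderiv (fun w => rho w i) z (kappa * ev (rho z) (d i))%C) ->
  forall e, cderiv (fun w => ev (rho w) e) z (kappa * ev (rho z) (der d e))%C.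
Proof.
intros H. induction e as [i|c|e1 H1 e2 H2|e1 H1 e2 H2]; simpl.
- apply H.
- cder_ring.
- cder_ring.
- cder_ring.
Qed.

Definition eqv (e1 e2 : expr) : Prop := forall rho, ev rho e1 = ev rho e2.

(** Formal derivations respect equality of values, since the value of the derived
    expression is the derivative along a line. *)
Lemma der_eqv (d : nat -> expr) (e1 e2 : expr) : eqv e1 e2 -> eqv (der d e1) (der d e2).
Proof.
intros H rho.
set (line := fun (w : C) i => (rho i + w * ev rho (d i))%C).
assert (E : forall e, ev (line 0%C) e = ev rho e).
{ induction e as [i|c|a Ha b Hb|a Ha b Hb]; simpl; try congruence. unfold line. ring. }
assert (HL : forall i, cderiv (fun w => line w i) 0%C (1 * ev (line 0%C) (d i))%C).
{ intros i. rewrite E. unfold line. cder_ring. }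
pose proof (ev_chain d line 1%C 0%C HL e1) as H1.
pose proof (ev_chain d line 1%C 0%C HL e2) as H2.
apply (cderiv_ext _ (fun w => ev (line w) e2)) in H1; [|intros w; apply H].
pose proof (cderiv_unique _ _ _ _ H1 H2) as U. rewrite !E, !Cmult_1_l in U. exact U.
Qed.

(** * The derivatives of the inverse of [t + z sinh t] *)

(** Let [u = t + z sinh t].  The variables 0 and 1 stand for
    [q = 1 / (1 + z cosh t)] and [p = z sinh t * q]; variable 2, called [E] in
    the comments, stands for the constant 1 and makes all formulas homogeneous
    when [q], [p], [E] have weights 2, 1, 2. *)
Definition vq := Var 0.
Definition vp := Var 1.
Definition vE := Var 2.
Definition neg (e : expr) := Mul (Cst (- (1))) e.

(** The derivation [d/du] at fixed [z]. *)
Definition du (i : nat) : expr :=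
  match i with
  | 0%nat => neg (Mul vp (Mul vq vq))
  | 1%nat => Mul vq (Add vE (neg (Add vq (Mul vp vp))))
  | _ => Cst 0
  end.

(** The derivation [z d/dz] at fixed [u]. *)
Definition dz (i : nat) : expr :=
  match i with
  | 0%nat => Mul vq (Add (Add vq (neg vE)) (Mul vp vp))
  | 1%nat => Mul vp (Add (Add (Add vq vq) (neg vE)) (Mul vp vp))
  | _ => Cst 0
  end.

(** [coef k] is the derivative [d^(k+1) t / du^(k+1)]. *)
Fixpoint coef (k : nat) : expr :=
  match k with O => vq | S k => der du (coef k) end.

(** The commutator of two derivations is a derivation, so it suffices that it
    vanishes on the variables. *)
Lemma du_dz_commute (e : expr) : eqv (der du (der dz e)) (der dz (der du e)).
Proof.
intros rho. induction e as [i|c|a Ha b Hb|a Ha b Hb].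
- destruct i as [|[|i]]; simpl; try ring.
- reflexivity.
- simpl. rewrite Ha, Hb. reflexivity.
- simpl. rewrite Ha, Hb. ring.
Qed.

(** Bessel's equation for the Laplace transform of [dt/du] amounts to
    [(z d/dz)^2 t = (1 - z^2) d^2 t/du^2]; since [(1 - z^2) q^2 = 2 q - E + p^2],
    this is the case [k = 0] below, differentiated once.  The general case
    follows because [d/du] and [z d/dz] commute. *)
Lemma coef_recurrence (k : nat) :
  eqv (Mul (Add (Add (Add vq vq) (neg vE)) (Mul vp vp)) (coef (S (S k))))
      (Mul (Mul vq vq) (der dz (der dz (coef k)))).
Proof.
induction k as [|k IH].
- intros rho. simpl. ring.
- intros rho. pose proof (der_eqv du _ _ IH rho) as D.
  pose proof (du_dz_commute (der dz (coef k)) rho) as C1.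
  pose proof (der_eqv dz _ _ (du_dz_commute (coef k)) rho) as C2.
  specialize (IH rho).
  change (coef (S (S (S k)))) with (der du (coef (S (S k)))).
  change (coef (S k)) with (der du (coef k)).
  set (X := coef (S (S k))) in *. set (Y := der dz (der dz (coef k))) in *.
  simpl in D, IH |- *. rewrite <- C2, <- C1.
  set (x := ev rho X) in *. set (y := ev rho Y) in *.
  set (x' := ev rho (der du X)) in *. set (y' := ev rho (der du Y)) in *.
  set (q := rho 0%nat) in *. set (p := rho 1%nat) in *. set (E := rho 2%nat) in *.
  clearbody x y x' y' q p E. clear C1 C2.
  (* [du] maps [2 q - E + p^2] to [- 2 p q] times itself and [q^2] to [- 2 p q]
     times itself, so these terms cancel by the induction hypothesis. *)
  transitivity ((q + q + - (1) * E + p * p) * x' + ((- (1) * (p * (q * q)) + - (1) * (p * (q * q)) + (0 * E + - (1) * 0) + (q * (E + - (1) * (q + p * p)) * p + p * (q * (E + - (1) * (q + p * p))))) * x)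
    + 2 * p * q * ((q + q + - (1) * E + p * p) * x))%C; [ring|].
  rewrite IH.
  match type of D with ?l = ?r =>
    transitivity (l + 2 * p * q * (q * q * y))%C; [ring|rewrite D; ring] end.
Qed.

Definition wt (i : nat) : nat := match i with 1%nat => 1 | _ => 2 end.

(** Weighted homogeneity.  The constant 0 has every weight, because it arises as
    the derivative of a constant of any weight. *)
Inductive hom : nat -> expr -> Prop :=
| hom_var i : hom (wt i) (Var i)
| hom_zero w : hom w (Cst 0)
| hom_cst c : hom 0 (Cst c)
| hom_add w a b : hom w a -> hom w b -> hom w (Add a b)
| hom_mul w u v a b : hom u a -> hom v b -> w = (u + v)%nat -> hom w (Mul a b).

Lemma der_hom (d : nat -> expr) (m : nat) : (forall i, hom (wt i + m) (d i)) ->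
  forall e w, hom w e -> hom (w + m) (der d e).
Proof.
intros Hd e w H. induction H; simpl.
- apply Hd.
- constructor.
- constructor.
- constructor; assumption.
- constructor; econstructor; eauto; lia.
Qed.

Lemma du_hom (i : nat) : hom (wt i + 3) (du i).
Proof.
destruct i as [|[|i]]; simpl.
- repeat (econstructor; simpl); reflexivity.
- apply hom_mul with 2%nat 2%nat; [apply (hom_var 0)| |reflexivity].
  constructor; [apply (hom_var 2)|].
  apply hom_mul with 0%nat 2%nat; [constructor| |reflexivity].
  constructor; [apply (hom_var 0)|].
  apply hom_mul with 1%nat 1%nat; [apply (hom_var 1)|apply (hom_var 1)|reflexivity].
- constructor.
Qed.

Lemma coef_hom (k : nat) : hom (2 + 3 * k) (coef k).
Proof.
induction k as [|k IH]; [apply (hom_var 0)|].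
replace (2 + 3 * S k)%nat with (2 + 3 * k + 3)%nat by lia.
simpl coef. apply der_hom; [apply du_hom|exact IH].
Qed.

(** The values at [t = 0], where [p] vanishes. *)
Definition at0 (q E : C) (i : nat) : C :=
  match i with 0%nat => q | 1%nat => RtoC 0 | _ => E end.

(** Only [p] has odd weight, so that an expression of odd weight vanishes with
    [p], while one of even weight is homogeneous in [q] and [E] of half that
    degree. *)
Lemma hom_at0 (w : nat) (e : expr) : hom w e -> forall mu q E : C,
  (forall n, w = (2 * n)%nat -> ev (at0 (mu * q) (mu * E)) e = (mu ^ n * ev (at0 q E) e)%C) /\
  (forall n, w = S (2 * n) -> ev (at0 q E) e = 0%C).
Proof.
intros H. induction H as [i|w|c|w a b _ IHa _ IHb|w u v a b _ IHa _ IHb Hw]; intros mu q E.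
- destruct i as [|[|i]]; simpl; split; intros n Hn; try lia; try ring;
  (assert (n = 1%nat) by lia; subst; simpl; ring).
- split; intros; simpl; ring.
- split; intros n Hn; [|lia]. assert (n = 0%nat) by lia. subst. simpl. ring.
- destruct (IHa mu q E) as [Ea Oa], (IHb mu q E) as [Eb Ob]. split; intros n Hn; simpl.
  + rewrite (Ea n Hn), (Eb n Hn). ring.
  + rewrite (Oa n Hn), (Ob n Hn). ring.
- destruct (IHa mu q E) as [Ea Oa], (IHb mu q E) as [Eb Ob].
  destruct (IHa mu (mu * q)%C (mu * E)%C) as [_ Oa']. destruct (IHb mu (mu * q)%C (mu * E)%C) as [_ Ob'].
  destruct (Nat.Even_or_Odd u) as [[x Hx]|[x Hx]], (Nat.Even_or_Odd v) as [[y Hy]|[y Hy]];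
   split; intros n Hn; try lia; simpl.
  + rewrite (Ea x Hx), (Eb y Hy). replace n with (x + y)%nat by lia. rewrite Cpow_add_r. ring.
  + rewrite (Ob y ltac:(lia)). ring.
  + rewrite (Oa x ltac:(lia)). ring.
  + rewrite (Oa' x ltac:(lia)), (Oa x ltac:(lia)). ring.
Qed.

Lemma coef_odd_at0 (s : nat) (q E : C) : ev (at0 q E) (coef (2 * s + 1)) = 0%C.
Proof.
destruct (hom_at0 _ _ (coef_hom (2 * s + 1)) 1 q E) as [_ H]. apply (H (3 * s + 2)%nat). lia.
Qed.

Lemma coef_even_scaling (s : nat) (mu q E : C) :
  ev (at0 (mu * q) (mu * E)) (coef (2 * s)) = (mu ^ (3 * s + 1) * ev (at0 q E) (coef (2 * s)))%C.
Proof.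
destruct (hom_at0 _ _ (coef_hom (2 * s)) mu q E) as [H _]. apply H. lia.
Qed.

(** ** The coefficients of the expansion *)

Definition gcoef (s : nat) (z : C) : C := ev (at0 (/ (1 + z)) 1) (coef (2 * s)).

(** By homogeneity of degree [3 s + 1], the point [(1 / (1 + z), 1)] can be replaced
    by [(1, 1 + z)], which yields the numerator over [(1 + z)^(3 s + 1)]. *)
Definition gnum (s : nat) (z : C) : C := ev (at0 1 (1 + z)) (coef (2 * s)).

Lemma gcoef_gnum (s : nat) (z : C) : (1 + z)%C <> 0%C ->
  gcoef s z = (gnum s z / (1 + z) ^ (3 * s + 1))%C.
Proof.
intros Hz. unfold gcoef, gnum.
replace (at0 (/ (1 + z)) 1) with (at0 (/ (1 + z) * 1) (/ (1 + z) * (1 + z))).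
2:{ f_equal; field; exact Hz. }
rewrite coef_even_scaling, Cpow_inv by exact Hz. unfold Cdiv. ring.
Qed.

(** At [E = p = 0] the derivation [z d/dz] is [q^2 d/dq]. *)
Lemma dz_at_pole (e : expr) (c : C) (n : nat) :
  (forall w : C, w <> 0%C -> ev (at0 w 0) e = (c * w ^ n)%C) ->
  forall w : C, w <> 0%C -> ev (at0 w 0) (der dz e) = (c * INR n * w ^ S n)%C.
Proof.
intros H w Hw.
assert (Hi : forall i, cderiv (fun w => at0 w 0 i) w (/ (w * w) * ev (at0 w 0) (dz i))%C).
{ intros [|[|i]]; simpl.
  - eapply cderiv_val; [apply cderiv_id|]. field. exact Hw.
  - eapply cderiv_val; [apply cderiv_const|]. ring.
  - eapply cderiv_val; [apply cderiv_const|]. ring. }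
pose proof (ev_chain dz (fun w => at0 w 0) _ w Hi e) as D.
assert (P : forall m, cderiv (fun w => w ^ m)%C w (INR m * w ^ (m - 1))%C).
{ induction m as [|m IHm].
  - simpl. eapply cderiv_val; [apply cderiv_const|]. ring.
  - eapply cderiv_val; [simpl; eapply cderiv_mult; [apply cderiv_id|exact IHm]|].
    cbv beta. rewrite S_INR, RtoC_plus. destruct m as [|m]; simpl.
    + ring.
    + rewrite Nat.sub_0_r. simpl. ring. }
assert (D' : cderiv (fun w => ev (at0 w 0) e) w (c * (INR n * w ^ (n - 1)))%C).
{ assert (Hm := proj1 (Cmod_gt_0 w) Hw).
  apply (cderiv_ext_near (fun w => c * w ^ n)%C _ w _ (Cmod w) Hm).
  - intros v Hv. symmetry. apply H. intros ->.
    replace (0 - w)%C with (- w)%C in Hv by ring. rewrite Cmod_opp in Hv. lra.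
  - eapply cderiv_val; [eapply cderiv_mult; [apply cderiv_const|apply P]|]. cbv beta. ring. }
pose proof (cderiv_unique _ _ _ _ D D') as U.
apply (f_equal (fun x => w * w * x)%C) in U.
replace (w * w * (/ (w * w) * ev (at0 w 0) (der dz e)))%C with (ev (at0 w 0) (der dz e)) in U
  by (field; exact Hw).
rewrite U. destruct n as [|n]; simpl.
- ring.
- rewrite Nat.sub_0_r. ring.
Qed.

Lemma C1_neq_0 : RtoC 1 <> 0%C.
Proof. intros H. apply RtoC_inj in H. lra. Qed.

(** The value [c_s] at the pole satisfies [2 c_(s+1) = n (n + 1) c_s] with
    [n = 3 s + 1]: this is the recurrence at [E = p = 0], where the expression of
    index [2 s] is [c_s q^n] and [z d/dz] is [q^2 d/dq]. *)
Lemma gnum_pole (s : nat) : gnum s (- (1)) <> 0%C.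
Proof.
unfold gnum. replace (1 + - (1))%C with (RtoC 0) by ring.
induction s as [|s IH].
- simpl. apply C1_neq_0.
- set (c := ev (at0 1 0) (coef (2 * s))) in *.
  assert (H0 : forall w : C, w <> 0%C -> ev (at0 w 0) (coef (2 * s)) = (c * w ^ (3 * s + 1))%C).
  { intros w _. pose proof (coef_even_scaling s w 1 0) as E.
    rewrite Cmult_1_r, Cmult_0_r in E. rewrite E. unfold c. ring. }
  pose proof (dz_at_pole _ _ _ (dz_at_pole _ _ _ H0) 1%C C1_neq_0) as H2.
  pose proof (coef_recurrence (2 * s) (at0 1 0)) as R.
  replace (2 * S s)%nat with (S (S (2 * s))) by lia.
  cbn [ev] in R. rewrite H2 in R.
  set (c' := ev (at0 1 0) (coef (S (S (2 * s))))) in *.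
  rewrite !Cpow_1_l in R. unfold vq, vp, vE, neg in R. simpl ev in R.
  intros E0. rewrite E0 in R.
  assert (R' : (c * (INR (3 * s + 1) * INR (S (3 * s + 1)))%R)%C = 0%C).
  { rewrite RtoC_mult. transitivity ((1 + 1 + - (1) * 0 + 0 * 0) * 0)%C; [rewrite R; ring|ring]. }
  revert R'. apply Cmult_neq_0; [exact IH|]. intros R'. apply RtoC_inj in R'.
  pose proof (lt_0_INR (3 * s + 1) ltac:(lia)).
  pose proof (lt_0_INR (S (3 * s + 1)) ltac:(lia)). nra.
Qed.

(** ** Rationality *)

Definition is_poly (f : C -> C) : Prop := exists p : list C, forall z, f z = peval p z.

Lemma is_poly_const (c : C) : is_poly (fun _ => c).
Proof. exists (c :: nil). intros z. simpl. ring. Qed.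

Lemma is_poly_id : is_poly (fun z => z).
Proof. exists (RtoC 0 :: RtoC 1 :: nil). intros z. simpl. ring. Qed.

Lemma is_poly_plus f g : is_poly f -> is_poly g -> is_poly (fun z => f z + g z)%C.
Proof.
intros [p Hp] [q Hq].
assert (H : exists r, forall z, (peval p z + peval q z)%C = peval r z).
{ clear. revert q. induction p as [|a p IH]; intros q.
  - exists q. intros z. simpl. ring.
  - destruct q as [|b q].
    + exists (a :: p). intros z. simpl. ring.
    + destruct (IH q) as [r Hr]. exists ((a + b)%C :: r). intros z. simpl.
      fold (peval p z) (peval q z) (peval r z). rewrite <- Hr. ring. }
destruct H as [r Hr]. exists r. intros z. rewrite Hp, Hq. apply Hr.
Qed.

Lemma is_poly_mult f g : is_poly f -> is_poly g -> is_poly (fun z => f z * g z)%C.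
Proof.
intros [p Hp] Hg.
assert (H : is_poly (fun z => peval p z * g z)%C).
{ clear Hp. induction p as [|a p [r Hr]].
  - exists nil. intros z. simpl. ring.
  - destruct (is_poly_plus (fun z => a * g z)%C (fun z => z * (peval p z * g z))%C) as [t Ht].
    + destruct Hg as [q Hq]. exists (map (Cmult a) q). intros z. rewrite Hq.
      clear. induction q as [|b q IH]; simpl; [ring|].
      fold (peval q z) (peval (map (Cmult a) q) z). rewrite <- IH. ring.
    + exists (RtoC 0 :: r). intros z. simpl. fold (peval r z). rewrite <- Hr. ring.
    + exists t. intros z. rewrite <- Ht. simpl. fold (peval p z). ring. }
destruct H as [r Hr]. exists r. intros z. rewrite Hp. apply Hr.
Qed.

Lemma is_poly_pow f n : is_poly f -> is_poly (fun z => f z ^ n)%C.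
Proof.
intros Hf. induction n as [|n IH]; simpl; [apply is_poly_const|apply is_poly_mult; assumption].
Qed.

Lemma is_poly_ev (rho : C -> nat -> C) e :
  (forall i, is_poly (fun z => rho z i)) -> is_poly (fun z => ev (rho z) e).
Proof.
intros H. induction e; simpl; [apply H|apply is_poly_const|apply is_poly_plus|apply is_poly_mult]; assumption.
Qed.

Lemma one_plus_neq_0 (z : C) : z <> RtoC (-1) <-> (1 + z)%C <> 0%C.
Proof.
split; intros H E; apply H.
- replace z with ((1 + z) - 1)%C by ring. rewrite E. rewrite <- RtoC_minus. f_equal. ring.
- rewrite E, <- RtoC_plus. f_equal. ring.
Qed.

(** The fraction with denominator [(1 + z)^(3 s + 1)] is in lowest terms because
    its numerator does not vanish at -1. *)
Lemma gcoef_rational (s : nat) : rational_with_poles (gcoef s) (fun z => z = RtoC (-1)).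
Proof.
assert (Hl : is_poly (fun z => 1 + z)%C) by (apply is_poly_plus; [apply is_poly_const|apply is_poly_id]).
destruct (is_poly_ev (fun z => at0 1 (1 + z)) (coef (2 * s))) as [p Hp].
{ intros [|[|i]]; simpl; try apply is_poly_const. exact Hl. }
destruct (is_poly_pow _ (3 * s + 1) Hl) as [q Hq].
assert (Q : forall z, peval q z = 0%C <-> z = RtoC (-1)).
{ intros z. rewrite <- Hq. split.
  - intros H. destruct (Ceq_dec z (RtoC (-1))) as [|N]; [assumption|].
    exfalso. apply one_plus_neq_0 in N. revert H. apply Cpow_nz, N.
  - intros ->. rewrite <- RtoC_plus. replace (1 + -1) with 0 by ring.
    rewrite Nat.add_1_r. simpl. ring. }
exists p, q. split; [|split; [|split]].
- exists (RtoC 0). intros H. apply Q, RtoC_inj in H. lra.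
- intros z [H1 H2]. apply Q in H2. subst z. rewrite <- Hp in H1.
  apply (gnum_pole s). replace (RtoC (-1)) with (- (1))%C in H1 by (rewrite <- RtoC_opp; f_equal; ring). exact H1.
- exact Q.
- intros z Hz. rewrite <- Hp, <- Hq. apply gcoef_gnum, one_plus_neq_0, Hz.
Qed.

(** * The recursively defined coefficients *)

Lemma Cpowr_plus (z : C) (a b : R) : (Cpowr z a * Cpowr z b)%C = Cpowr z (a + b).
Proof. unfold Cpowr. rewrite <- Cexp_plus, RtoC_plus. f_equal. ring. Qed.

Lemma Cpowr_1 (z : C) : z <> 0%C -> Cpowr z 1 = z.
Proof. intros Hz. unfold Cpowr. rewrite Cmult_1_l. apply Cexp_Clog, Hz. Qed.

Lemma Cpowr_0 (z : C) : Cpowr z 0 = 1%C.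
Proof. unfold Cpowr. rewrite Cmult_0_l. apply Cexp_0. Qed.

Lemma slit_plane_neq_0 (z : C) : slit_plane z -> z <> 0%C.
Proof. intros H ->. unfold slit_plane in H. simpl in H. lra. Qed.

Lemma Carg_slit (z : C) : slit_plane z -> - PI < Carg z < PI.
Proof.
intros H. assert (Hz := slit_plane_neq_0 z H).
pose proof (Cmod_unit_circle z Hz) as Hu. assert (Hm := proj1 (Cmod_gt_0 z) Hz).
pose proof PI_RGT_0 as HPI. pose proof (acos_bound (Re z / Cmod z)) as Hb.
assert (Hlt : acos (Re z / Cmod z) < PI).
{ assert (HR : -1 < Re z / Cmod z).
  { destruct H as [H|H].
    - assert (Im z / Cmod z <> 0).
      { unfold Rdiv. apply Rmult_integral_contrapositive_currified; [exact H|].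
        apply Rinv_neq_0_compat. lra. }
      assert (0 < (Im z / Cmod z)²) by (apply Rsqr_pos_lt; assumption).
      unfold Rsqr in *. nra.
    - assert (0 < Re z / Cmod z) by (apply Rdiv_lt_0_compat; assumption). lra. }
  destruct (proj2 (Re_over_Cmod_bound z Hz)) as [HR1|HR1].
  - apply acos_bound_lt. lra.
  - rewrite HR1, acos_1. lra. }
unfold Carg. destruct (Rle_dec 0 (Im z)); lra.
Qed.

(** All powers in the definition of the coefficients reduce to this one. *)
Definition csqrt (z : C) : C := Cpowr z (1 / 2).

Lemma csqrt_sqr (z : C) : z <> 0%C -> (csqrt z * csqrt z)%C = z.
Proof.
intros Hz. unfold csqrt. rewrite Cpowr_plus. replace (1 / 2 + 1 / 2) with 1 by field.
apply Cpowr_1, Hz.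
Qed.

Lemma csqrt_Re_pos (z : C) : slit_plane z -> 0 < Re (csqrt z).
Proof.
intros H. pose proof (Carg_slit z H) as Ha.
unfold csqrt, Cpowr, Cexp.
replace (Im (RtoC (1 / 2) * Clog z)) with (Carg z / 2) by (unfold Clog; simpl; field).
cbn [Re fst]. apply Rmult_lt_0_compat; [apply exp_pos|].
apply cos_gt_0; lra.
Qed.

Lemma slit_plane_open (z : C) : slit_plane z ->
  exists d, 0 < d /\ forall w, Cmod (w - z) < d -> slit_plane w.
Proof.
intros H.
assert (HI : forall w, Rabs (Im w - Im z) <= Cmod (w - z)).
{ intros w. replace (Im w - Im z) with (Im (w - z)) by (destruct w, z; simpl; ring). apply im_le_Cmod. }
assert (HR : forall w, Rabs (Re w - Re z) <= Cmod (w - z)).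
{ intros w. replace (Re w - Re z) with (Re (w - z)) by (destruct w, z; simpl; ring). apply re_le_Cmod. }
destruct H as [H|H].
- exists (Rabs (Im z)); split; [apply Rabs_pos_lt, H|].
  intros w Hw. left. intros E. specialize (HI w). rewrite E in HI.
  replace (0 - Im z) with (- Im z) in HI by ring. rewrite Rabs_Ropp in HI. lra.
- exists (Re z); split; [exact H|]. intros w Hw. right. specialize (HR w).
  assert (Ha : Rabs (Re w - Re z) < Re z) by lra. apply Rabs_def2 in Ha. lra.
Qed.

(** Two square roots in the right half-plane differ by
    [(w - z) / (csqrt w + csqrt z)], and the denominator stays away from 0. *)
Lemma cderiv_csqrt (z : C) : slit_plane z -> cderiv csqrt z (csqrt z / (2 * z))%C.
Proof.
intros H. assert (Hz := slit_plane_neq_0 z H).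
pose proof (csqrt_Re_pos z H) as HR. pose proof (csqrt_sqr z Hz) as E.
set (s := csqrt z) in *.
assert (Hs : s <> 0%C) by (intros E0; rewrite E0 in HR; simpl in HR; lra).
replace (s / (2 * z))%C with (/ (2 * s))%C.
2:{ rewrite <- E. field. exact Hs. }
destruct (slit_plane_open z H) as [d [Hd Hslit]].
set (r := Re s) in *.
assert (Hr3 : forall x, 0 < x -> 0 < 2 * x * x * x).
{ intros x Hx. repeat apply Rmult_lt_0_compat; lra. }
apply cderiv_eps. intros eps He.
exists (Rmin d (2 * r * r * r * eps)); split.
{ apply Rmin_pos; [exact Hd|]. apply Rmult_lt_0_compat; [apply Hr3|]; assumption. }
intros w Hw.
assert (W1 := Rlt_le_trans _ _ _ Hw (Rmin_l _ _)).
assert (W2 := Rlt_le_trans _ _ _ Hw (Rmin_r _ _)).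
pose proof (Hslit w W1) as Hsw.
pose proof (csqrt_Re_pos w Hsw) as HRw. pose proof (csqrt_sqr w (slit_plane_neq_0 w Hsw)) as Ew.
set (v := csqrt w) in *. fold s.
assert (Hsum : r <= Cmod (v + s)).
{ pose proof (re_le_Cmod (v + s)) as Hre. pose proof (Rle_abs (Re (v + s))) as Hab.
  replace (Re (v + s)) with (Re v + r) in * by reflexivity. lra. }
assert (Hrs : r <= Cmod s).
{ pose proof (re_le_Cmod s). pose proof (Rle_abs (Re s)). unfold r. lra. }
assert (Hvs : (v + s)%C <> 0%C) by (apply Cmod_gt_0; lra).
assert (D : (v - s)%C = ((w - z) / (v + s))%C).
{ rewrite <- Ew, <- E. field. exact Hvs. }
replace (v - s - (w - z) * / (2 * s))%C
  with ((w - z) * - ((w - z) / ((v + s) * (v + s) * (2 * s))))%C.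
2:{ rewrite <- Ew, <- E. field. repeat split; auto using C2_neq_0. }
rewrite Cmod_mult, Cmod_opp, Rmult_comm. apply Rmult_le_compat_r; [apply Cmod_ge_0|].
assert (H2 : Cmod 2 = 2) by (rewrite Cmod_R, Rabs_right; lra).
assert (Hden : 2 * r * r * r <= Cmod ((v + s) * (v + s) * (2 * s))).
{ rewrite !Cmod_mult, H2.
  assert (r * r <= Cmod (v + s) * Cmod (v + s)) by (apply Rmult_le_compat; lra).
  assert (r * r * r <= Cmod (v + s) * Cmod (v + s) * Cmod s) by (apply Rmult_le_compat; nra). lra. }
specialize (Hr3 r HR).
rewrite Cmod_div by (apply Cmod_gt_0; lra).
apply Rmult_le_reg_r with (Cmod ((v + s) * (v + s) * (2 * s))); [lra|].
unfold Rdiv. rewrite Rmult_assoc, Rinv_l by lra. nra.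
Qed.

Definition regular_point (z : C) : Prop := slit_plane z /\ z <> 1%C.

Lemma regular_point_open (z : C) : regular_point z -> exists d, 0 < d /\ forall w, Cmod (w - z) < d -> regular_point w.
Proof.
intros [Hs H1]. destruct (slit_plane_open z Hs) as [d [Hd Hd']].
assert (Hm : 0 < Cmod (z - 1)).
{ apply Cmod_gt_0. intros E. apply H1. replace z with (z - 1 + 1)%C by ring. rewrite E. ring. }
exists (Rmin d (Cmod (z - 1))); split; [apply Rmin_pos; assumption|].
intros w Hw. split.
- apply Hd'. eapply Rlt_le_trans; [exact Hw|apply Rmin_l].
- intros ->. apply (Rlt_not_le _ _ (Rlt_le_trans _ _ _ Hw (Rmin_r _ _))).
  right. rewrite <- Cmod_opp. f_equal. ring.
Qed.

Lemma regular_point_spec (z : C) : regular_point z ->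
  z <> 0%C /\ (1 + z)%C <> 0%C /\ (1 - z)%C <> 0%C /\ (z * z - 1)%C <> 0%C.
Proof.
intros [Hs H1].
assert (A : (1 + z)%C <> 0%C).
{ apply one_plus_neq_0. intros ->. unfold slit_plane in Hs. simpl in Hs. lra. }
assert (B : (1 - z)%C <> 0%C).
{ intros E. apply H1. replace z with (1 - (1 - z))%C by ring. rewrite E. ring. }
split; [apply slit_plane_neq_0, Hs|]. split; [exact A|]. split; [exact B|].
replace (z * z - 1)%C with (- ((1 + z) * (1 - z)))%C by ring.
intros E. apply (Cmult_neq_0 _ _ A B).
replace ((1 + z) * (1 - z))%C with (- - ((1 + z) * (1 - z)))%C by ring. rewrite E. ring.
Qed.

Lemma cderiv_ext_regular (f g : C -> C) (z l : C) : regular_point z ->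
  (forall w, regular_point w -> f w = g w) -> cderiv f z l -> cderiv g z l.
Proof.
intros Hz H. destruct (regular_point_open z Hz) as [d [Hd Hd']].
apply (cderiv_ext_near f g z l d Hd). intros w Hw. apply H, Hd', Hw.
Qed.

(** Rational functions of [z] with poles at 1 and -1, as polynomial expressions
    in [z] (variable 0) and [1 / (z^2 - 1)] (variable 1). *)
Definition atz (z : C) (i : nat) : C :=
  match i with 0%nat => z | 1%nat => (/ (z * z - 1))%C | _ => RtoC 0 end.

Definition ddz (i : nat) : expr :=
  match i with
  | 0%nat => Cst 1
  | 1%nat => Mul (Mul (Cst (- (2))) (Var 0)) (Mul (Var 1) (Var 1))
  | _ => Cst 0
  end.

Lemma cderiv_atz (e : expr) (z : C) : regular_point z ->
  cderiv (fun w => ev (atz w) e) z (ev (atz z) (der ddz e)).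
Proof.
intros Hz. destruct (regular_point_spec z Hz) as [_ [_ [_ Hn]]].
eapply cderiv_val; [apply (ev_chain ddz atz 1%C z)|ring].
intros [|[|i]]; simpl.
- eapply cderiv_val; [apply cderiv_id|ring].
- eapply cderiv_val.
  + apply (cderiv_inv (fun w => w * w - 1)%C); [exact Hn|cder].
  + cbv beta. field. exact Hn.
- eapply cderiv_val; [apply cderiv_const|ring].
Qed.

(** The factor of [z^(1/2)] in [Gcoef mu s], starting from the factor [e0] of
    [Gcoef mu 0]. *)
Fixpoint grat (e0 : expr) (s : nat) : expr :=
  match s with
  | O => e0
  | S s => Mul (Mul (Cst (- (1))) (Var 1))
      (Add (Mul (Var 0) (der ddz (grat e0 s)))
           (Mul (Mul (Var 0) (Var 0)) (der ddz (der ddz (grat e0 s)))))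
  end.

(** Writing [G = z^(1/2) r], the operator [G + 4 z^2 G''] becomes
    [4 z^(1/2) (z r' + z^2 r'')]: the terms without derivative cancel. *)
Lemma Gcoef_grat (mu : R) (e0 : expr) :
  (forall z, regular_point z -> Gcoef mu 0 z = (csqrt z * ev (atz z) e0)%C) ->
  forall s z, regular_point z -> Gcoef mu s z = (csqrt z * ev (atz z) (grat e0 s))%C.
Proof.
intros H0. induction s as [|s IH]; [exact H0|]. intros z Hz.
set (r := grat e0 s) in *.
set (F1 := fun w => (csqrt w * (ev (atz w) r / (2 * w) + ev (atz w) (der ddz r)))%C).
assert (D1 : forall w, regular_point w -> C_derive (Gcoef mu s) w = F1 w).
{ intros w Hw. destruct (regular_point_spec w Hw) as [Hw0 _].
  apply is_C_derive_unique.
  apply (cderiv_ext_regular (fun w => csqrt w * ev (atz w) r)%C); [exact Hw| |].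
  - intros v Hv. symmetry. apply IH, Hv.
  - eapply cderiv_val.
    + eapply cderiv_mult; [apply cderiv_csqrt, Hw|apply cderiv_atz, Hw].
    + unfold F1. cbv beta. field. exact Hw0. }
assert (D2 : C_derive (C_derive (Gcoef mu s)) z =
  (csqrt z * (- ev (atz z) r / (4 * (z * z)) + ev (atz z) (der ddz r) / z
     + ev (atz z) (der ddz (der ddz r))))%C).
{ destruct (regular_point_spec z Hz) as [Hz0 _].
  apply is_C_derive_unique.
  apply (cderiv_ext_regular F1); [exact Hz| |].
  - intros w Hw. symmetry. apply D1, Hw.
  - eapply cderiv_val.
    + unfold F1. eapply cderiv_mult; [apply cderiv_csqrt, Hz|].
      eapply cderiv_plus; [|apply cderiv_atz, Hz].
      unfold Cdiv. eapply cderiv_mult; [apply cderiv_atz, Hz|].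
      apply (cderiv_inv (fun w => 2 * w)%C); [apply Cmult_neq_0; [apply C2_neq_0|exact Hz0]|cder].
    + cbv beta. replace (RtoC 4) with (2 * 2)%C by (rewrite <- RtoC_mult; f_equal; ring).
      field. exact Hz0. }
destruct (regular_point_spec z Hz) as [Hz0 [Hp [Hm Hn]]].
cbn [Gcoef]. rewrite D2, (IH z Hz). simpl ev. fold r.
set (a := ev (atz z) r). set (b := ev (atz z) (der ddz r)). set (c := ev (atz z) (der ddz (der ddz r))).
assert (H4 : RtoC 4 <> 0%C) by (intros E; apply RtoC_inj in E; lra).
simpl Cpow.
assert (Hn' : (1 - z * z)%C <> 0%C).
{ replace (1 - z * z)%C with ((1 + z) * (1 - z))%C by ring. apply Cmult_neq_0; assumption. }
replace (/ (z * z - 1))%C with (- / (1 - z * z))%C by (field; split; assumption).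
field. repeat split; assumption.
Qed.

(** At [t = 0] the curve [z |-> (q, p, E) = (1 / (1 + z), 0, 1)] follows the
    derivation [dz]. *)
Lemma cderiv_at0 (e : expr) (z : C) : z <> 0%C -> (1 + z)%C <> 0%C ->
  cderiv (fun w => ev (at0 (/ (1 + w)) 1) e) z (/ z * ev (at0 (/ (1 + z)) 1) (der dz e))%C.
Proof.
intros Hz Hz1. apply (ev_chain dz (fun w => at0 (/ (1 + w)) 1)).
intros [|[|i]]; simpl.
- eapply cderiv_val.
  + apply (cderiv_inv (fun w => 1 + w)%C); [exact Hz1|cder].
  + cbv beta. field. split; assumption.
- eapply cderiv_val; [apply cderiv_const|ring].
- eapply cderiv_val; [apply cderiv_const|ring].
Qed.

(** At [t = 0] one has [2 q - 1 = (1 - z^2) q^2], which turns the general recurrence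
    of the derivatives into that of the coefficients. *)
Lemma gcoef_recurrence (s : nat) (z : C) : z <> 0%C -> (1 + z)%C <> 0%C -> (1 - z)%C <> 0%C ->
  gcoef (S s) z = (ev (at0 (/ (1 + z)) 1) (der dz (der dz (coef (2 * s)))) / (1 - z * z))%C.
Proof.
intros Hz Hp Hm. unfold gcoef.
replace (2 * S s)%nat with (S (S (2 * s))) by lia.
pose proof (coef_recurrence (2 * s) (at0 (/ (1 + z)) 1)) as R.
set (X := coef (S (S (2 * s)))) in *. set (Y := der dz (der dz (coef (2 * s)))) in *.
simpl ev in R.
assert (Hn : (1 - z * z)%C <> 0%C).
{ replace (1 - z * z)%C with ((1 + z) * (1 - z))%C by ring. apply Cmult_neq_0; assumption. }
apply (f_equal (fun x => (1 + z) * (1 + z) / (1 - z * z) * x)%C) in R.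
set (x := ev (at0 (/ (1 + z)) 1) X) in *. set (y := ev (at0 (/ (1 + z)) 1) Y) in *.
transitivity ((1 + z) * (1 + z) / (1 - z * z) *
  ((/ (1 + z) + / (1 + z) + - (1) * 1 + 0 * 0) * x))%C.
- field. split; assumption.
- rewrite R. field. split; assumption.
Qed.

(** After division by [z^(1/2)] the difference of the two sequences starts with
    [(z - 1) / (z^2 - 1) = 1 / (1 + z)] and obeys the same linear recurrence as
    [gcoef], with derivatives determined by the values on an open set. *)
Theorem Gminus_gcoef (s : nat) (z : C) : slit_plane z -> z <> 1%C -> Gminus s z = gcoef s z.
Proof.
intros Hs H1. assert (Hz : regular_point z) by (split; assumption).
assert (H0 : forall z, regular_point z -> Gcoef 0 0 z = (csqrt z * ev (atz z) (Mul (Var 0) (Var 1)))%C).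
{ intros w Hw. destruct (regular_point_spec w Hw) as [Hw0 [_ [_ Hn]]]. simpl.
  replace (0 + 3 / 2) with (1 / 2 + 1) by field.
  rewrite <- Cpowr_plus, Cpowr_1 by exact Hw0. unfold csqrt, Cdiv. rewrite Cmult_1_r. ring. }
assert (Hm1 : forall z, regular_point z -> Gcoef (-1) 0 z = (csqrt z * ev (atz z) (Var 1))%C).
{ intros w Hw. simpl. replace (-1 + 3 / 2) with (1 / 2) by field.
  unfold csqrt, Cdiv. rewrite Cmult_1_r. reflexivity. }
unfold Gminus.
rewrite (Gcoef_grat 0 _ H0 s z Hz), (Gcoef_grat (-1) _ Hm1 s z Hz).
set (r0 := grat (Mul (Var 0) (Var 1))). set (r1 := grat (Var 1)).
transitivity (ev (atz z) (r0 s) - ev (atz z) (r1 s))%C.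
{ transitivity ((Cpowr z (- (1 / 2)) * csqrt z) * (ev (atz z) (r0 s) - ev (atz z) (r1 s)))%C; [ring|].
  unfold csqrt. rewrite Cpowr_plus. replace (- (1 / 2) + 1 / 2) with 0 by field.
  rewrite Cpowr_0. ring. }
clear H0 Hm1 Hs H1. revert z Hz. induction s as [|s IH]; intros z Hz;
 destruct (regular_point_spec z Hz) as [Hz0 [Hp [Hm Hn]]].
- unfold gcoef. simpl. field. split; assumption.
- assert (D1 : forall w, regular_point w ->
    (ev (atz w) (der ddz (r0 s)) - ev (atz w) (der ddz (r1 s)))%C
    = (/ w * ev (at0 (/ (1 + w)) 1) (der dz (coef (2 * s))))%C).
  { intros w Hw. destruct (regular_point_spec w Hw) as [Hw0 [Hwp _]].
    apply (cderiv_unique (fun w => gcoef s w) w).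
    - apply (cderiv_ext_regular (fun w => ev (atz w) (r0 s) - ev (atz w) (r1 s))%C); [exact Hw|exact IH|].
      apply cderiv_minus; apply cderiv_atz, Hw.
    - apply cderiv_at0; assumption. }
  assert (D2 : (ev (atz z) (der ddz (der ddz (r0 s))) - ev (atz z) (der ddz (der ddz (r1 s))))%C
    = (- / (z * z) * ev (at0 (/ (1 + z)) 1) (der dz (coef (2 * s)))
       + / z * (/ z * ev (at0 (/ (1 + z)) 1) (der dz (der dz (coef (2 * s))))))%C).
  { apply (cderiv_unique (fun w => / w * ev (at0 (/ (1 + w)) 1) (der dz (coef (2 * s))))%C z).
    - apply (cderiv_ext_regular (fun w => ev (atz w) (der ddz (r0 s)) - ev (atz w) (der ddz (r1 s)))%C);
        [exact Hz|exact D1|].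
      apply cderiv_minus; apply cderiv_atz, Hz.
    - eapply cderiv_val.
      + eapply cderiv_mult; [apply (cderiv_inv (fun w => w)); [exact Hz0|apply cderiv_id]|].
        apply cderiv_at0; assumption.
      + cbv beta. field. assumption. }
  rewrite (gcoef_recurrence s z Hz0 Hp Hm).
  specialize (D1 z Hz).
  unfold r0, r1 in *. simpl grat.
  set (s0 := grat (Mul (Var 0) (Var 1)) s) in *. set (s1 := grat (Var 1) s) in *.
  cbn [ev]. 
  set (a0 := ev (atz z) (der ddz s0)) in *. set (a1 := ev (atz z) (der ddz s1)) in *.
  set (b0 := ev (atz z) (der ddz (der ddz s0))) in *. set (b1 := ev (atz z) (der ddz (der ddz s1))) in *.
  set (u := ev (at0 (/ (1 + z)) 1) (der dz (coef (2 * s)))) in *.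
  set (v := ev (at0 (/ (1 + z)) 1) (der dz (der dz (coef (2 * s))))) in *.
  change (atz z 0%nat) with z. change (atz z 1%nat) with (/ (z * z - 1))%C.
  transitivity (- / (z * z - 1) * (z * (a0 - a1) + z * z * (b0 - b1)))%C; [ring|].
  rewrite D1, D2.
  assert (Hn' : (1 - z * z)%C <> 0%C).
  { replace (1 - z * z)%C with ((1 + z) * (1 - z))%C by ring. apply Cmult_neq_0; assumption. }
  field. repeat split; assumption.
Qed.

(** * Integration by parts *)

(** The derivation [d/dt] at fixed [z]; it is [1 / q] times [du]. *)
Definition dt (i : nat) : expr :=
  match i with
  | 0%nat => neg (Mul vp vq)
  | 1%nat => Add vE (neg (Add vq (Mul vp vp)))
  | _ => Cst 0
  end.

(** The values of [q], [p] and [E] at a point [t]. *)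
Definition att (z t : C) (i : nat) : C :=
  match i with
  | 0%nat => (/ (1 + z * Ccosh t))%C
  | 1%nat => (z * Csinh t / (1 + z * Ccosh t))%C
  | _ => RtoC 1
  end.

Lemma cderiv_att (z t : C) (e : expr) : (1 + z * Ccosh t)%C <> 0%C ->
  cderiv (fun t => ev (att z t) e) t (ev (att z t) (der dt e)).
Proof.
intros H.
assert (Hc : cderiv (fun t => 1 + z * Ccosh t)%C t (z * Csinh t)%C).
{ eapply cderiv_val.
  - eapply cderiv_plus; [apply cderiv_const|]. eapply cderiv_mult; [apply cderiv_const|apply cderiv_Ccosh].
  - cbv beta. ring. }
eapply cderiv_val; [apply (ev_chain dt (att z) 1%C t)|ring].
intros [|[|i]]; simpl.
- eapply cderiv_val; [apply cderiv_inv; [exact H|exact Hc]|]. cbv beta. field. exact H.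
- unfold Cdiv. eapply cderiv_val.
  + eapply cderiv_mult; [eapply cderiv_mult; [apply cderiv_const|apply cderiv_Csinh]|].
    apply cderiv_inv; [exact H|exact Hc].
  + cbv beta. field. exact H.
- eapply cderiv_val; [apply cderiv_const|ring].
Qed.

Lemma du_dt (z t : C) (e : expr) : (1 + z * Ccosh t)%C <> 0%C ->
  ((1 + z * Ccosh t) * ev (att z t) (der du e))%C = ev (att z t) (der dt e).
Proof.
intros H. induction e as [i|c|a Ha b Hb|a Ha b Hb]; simpl.
- destruct i as [|[|i]]; simpl; try ring; field; exact H.
- ring.
- rewrite <- Ha, <- Hb. ring.
- rewrite <- Ha, <- Hb. ring.
Qed.

Fixpoint csum (F : nat -> C) (n : nat) : C :=
  match n with O => 0%C | S n => (csum F n + F n)%C end.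

(** With [f = t + z sinh t], repeated integration by parts in
    [exp (- nu f) = (1 / q) exp (- nu f) q] produces at stage [k] the boundary value
    of [exp (- nu f) (d/du)^k q], which is [coef k].  The path is the segment
    [tau d], [tau] between 0 and [b], where [b] may be negative. *)
Section Parts.
Variables (nu : R) (z d : C) (b : R).
Hypothesis Hnu : 0 < nu.
Let pt (tau : R) : C := (0 + RtoC tau * d)%C.
Let f (t : C) : C := integrand nu (RtoC nu * z) t.
Hypothesis Hne : forall tau, Rmin 0 b <= tau <= Rmax 0 b -> (1 + z * Ccosh (pt tau))%C <> 0%C.

Let stage (k : nat) (t : C) : C := (f t * ((1 + z * Ccosh t) * ev (att z t) (coef k)))%C.

Let stage_cont k : contOn (fun tau => d * stage k (pt tau))%C 0 b.
Proof.
intros tau Htau. specialize (Hne tau Htau).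
apply (cderiv_rcont (fun t => d * stage k t)%C 0%C d (d * (
   - (RtoC nu + RtoC nu * z * Ccosh (pt tau)) * f (pt tau) * ((1 + z * Ccosh (pt tau)) * ev (att z (pt tau)) (coef k))
   + f (pt tau) * (z * Csinh (pt tau) * ev (att z (pt tau)) (coef k) + (1 + z * Ccosh (pt tau)) * ev (att z (pt tau)) (der dt (coef k)))))%C).
fold (pt tau). eapply cderiv_val.
- eapply cderiv_mult; [apply cderiv_const|]. unfold stage.
  eapply cderiv_mult; [apply cderiv_integrand|].
  eapply cderiv_mult; [|apply cderiv_att, Hne].
  eapply cderiv_plus; [apply cderiv_const|]. eapply cderiv_mult; [apply cderiv_const|apply cderiv_Ccosh].
- cbv beta. unfold f. ring.
Qed.

Let boundary (k : nat) (t : C) : C := (f t * ev (att z t) (coef k))%C.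

Let parts_step k :
  CInt (fun tau => d * stage k (pt tau))%C 0 b =
  ((boundary k (pt 0) - boundary k (pt b)) / RtoC nu
   + CInt (fun tau => d * stage (S k) (pt tau))%C 0 b / RtoC nu)%C.
Proof.
assert (D : CInt (fun tau => d * stage (S k) (pt tau) - RtoC nu * (d * stage k (pt tau)))%C 0 b
  = (boundary k (pt b) - boundary k (pt 0))%C).
{ apply (CInt_derive (fun tau => boundary k (pt tau))).
  - intros tau Htau. specialize (Hne tau Htau).
    replace (d * stage (S k) (pt tau) - RtoC nu * (d * stage k (pt tau)))%C
      with (d * (stage (S k) (pt tau) - RtoC nu * stage k (pt tau)))%C by ring.
    apply (cderiv_rderiv (boundary k) 0%C d).
    eapply cderiv_val; [unfold boundary; eapply cderiv_mult; [apply cderiv_integrand|apply cderiv_att, Hne]|].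
    cbv beta. fold (pt tau). unfold stage. simpl coef. rewrite (du_dt z (pt tau) (coef k) Hne).
    unfold f. ring.
  - intros tau Htau. apply (continuous_minus (V := C_R_NormedModule)).
    + apply stage_cont, Htau.
    + specialize (stage_cont k tau Htau) as Hc.
      refine (continuous_ext _ _ _ _ (continuous_scal_r (K := R_AbsRing) (V := C_R_NormedModule) nu _ _ Hc)).
      intros u. apply scal_R_Cmult. }
rewrite CInt_minus in D.
- rewrite (CInt_scal (fun tau => d * stage k (pt tau))%C 0 b (RtoC nu)) in D by apply stage_cont.
  set (X := CInt (fun tau => d * stage k (pt tau))%C 0 b) in *.
  set (Y := CInt (fun tau => d * stage (S k) (pt tau))%C 0 b) in *.
  assert (Hn : RtoC nu <> 0%C) by (intros E; apply RtoC_inj in E; lra).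
  transitivity ((- (Y - RtoC nu * X) + Y) / RtoC nu)%C; [field; exact Hn|].
  rewrite D. field. exact Hn.
- apply stage_cont.
- intros tau Htau. specialize (stage_cont k tau Htau) as Hc.
  refine (continuous_ext _ _ _ _ (continuous_scal_r (K := R_AbsRing) (V := C_R_NormedModule) nu _ _ Hc)).
  intros u. apply scal_R_Cmult.
Qed.

Lemma parts (n : nat) :
  CInt (fun tau => d * integrand nu (RtoC nu * z) (0 + RtoC tau * d))%C 0 b =
  (csum (fun k => (ev (att z 0) (coef k)
       - integrand nu (RtoC nu * z) (0 + RtoC b * d) * ev (att z (0 + RtoC b * d)) (coef k))
       / RtoC (nu ^ S k)) n
   + CInt (fun tau => d * (integrand nu (RtoC nu * z) (0 + RtoC tau * d) *
       ((1 + z * Ccosh (0 + RtoC tau * d)) * ev (att z (0 + RtoC tau * d)) (coef n)))) 0 b / RtoC (nu ^ n))%C.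
Proof.
assert (Hn : RtoC nu <> 0%C) by (intros E; apply RtoC_inj in E; lra).
assert (Hnk : forall k, RtoC (nu ^ k) <> 0%C).
{ intros k E. apply RtoC_inj in E. revert E. apply pow_nonzero. lra. }
induction n as [|n IH].
- simpl csum. rewrite Cplus_0_l. replace (RtoC (nu ^ 0)) with (RtoC 1) by reflexivity.
  unfold Cdiv. replace (/ 1)%C with (RtoC 1) by (field). rewrite Cmult_1_r. apply CInt_ext.
  intros tau Htau. f_equal. simpl. specialize (Hne tau ltac:(lra)). unfold pt in Hne.
  field. exact Hne.
- rewrite IH. cbn [csum].
  pose proof (parts_step n) as P. unfold stage, boundary, f, pt in P.
  rewrite P.
  replace (integrand nu (RtoC nu * z) (0 + RtoC 0 * d)) with (RtoC 1).
  2:{ unfold integrand. replace (0 + 0 * d)%C with (RtoC 0) by ring. rewrite <- Cexp_0. f_equal.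
      unfold Csinh. replace (- 0)%C with (RtoC 0) by ring. field. }
  replace (0 + RtoC 0 * d)%C with (RtoC 0) by ring.
  replace (RtoC (nu ^ S n)) with (RtoC nu * RtoC (nu ^ n))%C by (rewrite <- RtoC_mult; reflexivity).
  field. split; [apply Hnk|exact Hn].
Qed.
End Parts.

(** ** Bounds along the path *)

Lemma ev_bound (e : expr) (M : R) : exists B, 0 <= B /\
  forall rho, (forall i, Cmod (rho i) <= M) -> Cmod (ev rho e) <= B.
Proof.
induction e as [i|c|a [A [HA0 HA]] b [B [HB0 HB]]|a [A [HA0 HA]] b [B [HB0 HB]]].
- exists (Rabs M). split; [apply Rabs_pos|]. intros rho H. simpl.
  eapply Rle_trans; [apply H|apply Rle_abs].
- exists (Cmod c). split; [apply Cmod_ge_0|]. intros rho _. simpl. lra.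
- exists (A + B). split; [lra|]. intros rho H. simpl.
  eapply Rle_trans; [apply Cmod_triangle|]. specialize (HA rho H). specialize (HB rho H). lra.
- exists (A * B). split; [nra|]. intros rho H. simpl. rewrite Cmod_mult.
  apply Rmult_le_compat; auto using Cmod_ge_0.
Qed.

Lemma csum_ext F G n : (forall k, (k < n)%nat -> F k = G k) -> csum F n = csum G n.
Proof.
induction n as [|n IH]; intros H; simpl; [reflexivity|].
rewrite (H n) by lia. rewrite IH; [reflexivity|]. intros k Hk. apply H. lia.
Qed.

Lemma csum_minus F G n : csum (fun k => F k - G k)%C n = (csum F n - csum G n)%C.
Proof. induction n as [|n IH]; simpl; [ring|rewrite IH; ring]. Qed.

Lemma RtoC_pow_neq_0 (nu : R) (k : nat) : 0 < nu -> RtoC (nu ^ k) <> 0%C.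
Proof. intros Hn E. apply RtoC_inj in E. revert E. apply pow_nonzero. lra. Qed.

(** The boundary terms at the far end, with [x] the value of the exponential there. *)
Lemma csum_coef_bound (M : R) (n : nat) : exists K, 0 <= K /\
  forall (rho : nat -> C) (x : C) (nu : R), 1 <= nu -> (forall i, Cmod (rho i) <= M) ->
  Cmod (csum (fun k => x * ev rho (coef k) / RtoC (nu ^ S k))%C n) <= K * Cmod x.
Proof.
induction n as [|n [K [HK IH]]].
- exists 0. split; [lra|]. intros. simpl. rewrite Cmod_0. lra.
- destruct (ev_bound (coef n) M) as [B [HB0 HB]].
  exists (K + B). split; [lra|]. intros rho x nu Hnu Hrho. cbn [csum].
  eapply Rle_trans; [apply Cmod_triangle|].
  specialize (IH rho x nu Hnu Hrho). specialize (HB rho Hrho).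
  rewrite Cmod_div by (apply RtoC_pow_neq_0; lra).
  rewrite Cmod_mult, Cmod_R.
  assert (H1 : 1 <= nu ^ S n) by (apply pow_R1_Rle, Hnu).
  rewrite (Rabs_right (nu ^ S n)) by lra.
  pose proof (Cmod_ge_0 x) as Px. pose proof (Cmod_ge_0 (ev rho (coef n))) as Pe.
  assert (Cmod x * Cmod (ev rho (coef n)) / nu ^ S n <= B * Cmod x).
  { apply Rmult_le_reg_r with (nu ^ S n); [lra|]. unfold Rdiv.
    rewrite Rmult_assoc, Rinv_l, Rmult_1_r by lra.
    apply Rle_trans with (B * Cmod x * 1); [nra|].
    apply Rmult_le_compat_l; nra. }
  lra.
Qed.

(** The stages of odd index have odd weight, hence vanish at [t = 0]. *)
Lemma csum_at0 (q : C) (nu : R) (N : nat) : 0 < nu ->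
  csum (fun k => ev (at0 q 1) (coef k) / RtoC (nu ^ S k))%C (2 * N + 2) =
  sum_n (fun s => (ev (at0 q 1) (coef (2 * s)) / RtoC (nu ^ (2 * s + 1)))%C) N.
Proof.
intros Hnu.
assert (Step : forall s, csum (fun k => ev (at0 q 1) (coef k) / RtoC (nu ^ S k))%C (2 * s + 2)
  = (csum (fun k => ev (at0 q 1) (coef k) / RtoC (nu ^ S k))%C (2 * s)
     + ev (at0 q 1) (coef (2 * s)) / RtoC (nu ^ (2 * s + 1)))%C).
{ intros s. replace (2 * s + 2)%nat with (S (S (2 * s))) by lia. cbn [csum].
  replace (S (2 * s)) with (2 * s + 1)%nat by lia. rewrite (coef_odd_at0 s).
  unfold Cdiv. ring. }
induction N as [|N IH].
- rewrite sum_O. rewrite Step. simpl csum. ring.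
- rewrite sum_Sn, <- IH, Step. replace (2 * S N)%nat with (2 * N + 2)%nat by lia. reflexivity.
Qed.

Lemma contOn_path (F : C -> C) (d : C) (a b : R) :
  (forall tau, Rmin a b <= tau <= Rmax a b -> exists l, cderiv F (0 + RtoC tau * d)%C l) ->
  contOn (fun tau => F (0 + RtoC tau * d)%C) a b.
Proof. intros H tau Htau. destruct (H tau Htau) as [l Hl]. eapply cderiv_rcont, Hl. Qed.

Lemma CInt_bound_abs (f : R -> C) (a b M : R) : contOn f a b ->
  (forall t, Rmin a b <= t <= Rmax a b -> Cmod (f t) <= M) -> Cmod (CInt f a b) <= Rabs (b - a) * M.
Proof.
intros Hc H. rewrite <- norm_C_R.
apply (norm_RInt_le_const_abs (V := C_R_CompleteNormedModule) f a b); [|apply is_CInt, Hc].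
intros t Ht. rewrite norm_C_R. apply H, Ht.
Qed.

(** The expansion of the integral along a segment issuing from 0, with bounds
    that depend on the path only through [M] and the size [X] of the integrand
    at the other end. *)
Lemma segment_expansion (N : nat) (M : R) : 1 <= M -> exists K, 0 <= K /\
  forall (nu : R) (z d : C) (b X : R), 1 <= nu -> Cmod d = 1 -> Rabs b <= 2 ->
  (forall tau, Rmin 0 b <= tau <= Rmax 0 b ->
     (1 + z * Ccosh (0 + RtoC tau * d))%C <> 0%C /\
     Cmod (att z (0 + RtoC tau * d) 0) <= M /\ Cmod (att z (0 + RtoC tau * d) 1) <= M /\
     Cmod (integrand nu (RtoC nu * z) (0 + RtoC tau * d)) <= 1) ->
  Cmod (integrand nu (RtoC nu * z) (0 + RtoC b * d)) <= X ->
  Cmod (CInt (fun tau => d * integrand nu (RtoC nu * z) (0 + RtoC tau * d))%C 0 b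
        - sum_n (fun s => (gcoef s z / RtoC (nu ^ (2 * s + 1)))%C) N)
  <= K / nu ^ (2 * N + 3) + K * X.
Proof.
intros HM.
(* One stage more than the expansion needs: the last remainder is of the order
   [1 / nu^(2 N + 3)] without any use of the decay of the exponential, because
   [d/dt] of a polynomial in [q] and [p] is again one, bounded in [z]. *)
destruct (csum_coef_bound M (2 * N + 3)) as [K1 [HK1 H1]].
destruct (ev_bound (coef (2 * N + 2)) M) as [B1 [HB1 H2]].
destruct (ev_bound (der dt (coef (2 * N + 2))) M) as [B2 [HB2 H3]].
exists (K1 + B1 + 2 * B2). split; [lra|].
intros nu z d b X Hnu Hd Hb Hpath HX.
assert (Hne : forall tau, Rmin 0 b <= tau <= Rmax 0 b -> (1 + z * Ccosh (0 + RtoC tau * d))%C <> 0%C).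
{ intros tau Htau. apply Hpath, Htau. }
assert (Hrho : forall tau, Rmin 0 b <= tau <= Rmax 0 b ->
   forall i, Cmod (att z (0 + RtoC tau * d) i) <= M).
{ intros tau Htau. destruct (Hpath tau Htau) as [_ [Q1 [Q2 _]]].
  intros [|[|i]]; [exact Q1|exact Q2|]. simpl. rewrite Cmod_1. exact HM. }
assert (Hends : (Rmin 0 b <= 0 <= Rmax 0 b) /\ (Rmin 0 b <= b <= Rmax 0 b)).
{ split; split; auto using Rmin_l, Rmin_r, Rmax_l, Rmax_r. }
destruct Hends as [He0 Heb].
rewrite (parts nu z d b ltac:(lra) Hne (2 * N + 3)).
set (f := integrand nu (RtoC nu * z)).
set (P := (0 + RtoC b * d)%C) in *.
assert (Hat : forall e, ev (att z 0) e = ev (at0 (/ (1 + z)) 1) e).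
{ assert (Hi : forall i, att z 0 i = at0 (/ (1 + z)) 1 i).
  { assert (C0 : Ccosh 0 = 1%C).
    { unfold Ccosh. replace (- 0)%C with (RtoC 0) by ring. rewrite Cexp_0. field. }
    assert (S0 : Csinh 0 = 0%C).
    { unfold Csinh. replace (- 0)%C with (RtoC 0) by ring. field. }
    intros [|[|i]]; simpl; rewrite ?C0, ?S0.
    - f_equal. ring.
    - unfold Cdiv. ring.
    - reflexivity. }
  induction e as [i|c|u Hu v Hv|u Hu v Hv]; simpl; congruence. }
rewrite (csum_ext _ (fun k => ev (at0 (/ (1 + z)) 1) (coef k) / RtoC (nu ^ S k)
   - f P * ev (att z P) (coef k) / RtoC (nu ^ S k))%C).
2:{ intros k _. rewrite Hat. unfold Cdiv. ring. }
rewrite csum_minus.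
replace (2 * N + 3)%nat with (S (2 * N + 2)) at 1 by lia.
cbn [csum]. rewrite csum_at0 by lra. unfold gcoef at 1.
set (S0 := sum_n (fun s => (ev (at0 (/ (1 + z)) 1) (coef (2 * s)) / RtoC (nu ^ (2 * s + 1)))%C) N).
change (sum_n (fun s => (gcoef s z / RtoC (nu ^ (2 * s + 1)))%C) N) with S0.
set (T1 := (ev (at0 (/ (1 + z)) 1) (coef (2 * N + 2)) / RtoC (nu ^ S (2 * N + 2)))%C).
set (T2 := csum (fun k => f P * ev (att z P) (coef k) / RtoC (nu ^ S k))%C (2 * N + 3)).
set (J := CInt _ 0 b).
replace (S0 + T1 - T2 + J / RtoC (nu ^ (2 * N + 3)) - S0)%C
  with ((T1 + J / RtoC (nu ^ (2 * N + 3))) - T2)%C by ring.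
assert (Pn : 0 < nu ^ (2 * N + 3)) by (apply pow_lt; lra).
assert (A1 : Cmod T1 <= B1 / nu ^ (2 * N + 3)).
{ unfold T1. rewrite Cmod_div by (apply RtoC_pow_neq_0; lra).
  replace (S (2 * N + 2)) with (2 * N + 3)%nat by lia.
  rewrite Cmod_R, (Rabs_right (nu ^ (2 * N + 3))) by lra.
  apply Rmult_le_compat_r; [apply Rlt_le, Rinv_0_lt_compat, Pn|].
  rewrite <- Hat. apply H2. specialize (Hrho 0 He0).
  replace (0 + RtoC 0 * d)%C with (RtoC 0) in Hrho by ring. exact Hrho. }
assert (A2 : Cmod T2 <= K1 * X).
{ unfold T2. eapply Rle_trans; [apply H1; [exact Hnu|apply (Hrho b Heb)]|].
  apply Rmult_le_compat_l; [exact HK1|exact HX]. }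
assert (A3 : Cmod J <= 2 * B2).
{ unfold J. apply Rle_trans with (Rabs (b - 0) * B2).
  - set (F := fun t => (d * (f t * ev (att z t) (der dt (coef (2 * N + 2)))))%C).
    rewrite (CInt_ext _ (fun tau => F (0 + RtoC tau * d)%C)).
    2:{ intros tau Htau. unfold F. do 2 f_equal.
        replace (2 * N + 3)%nat with (S (2 * N + 2)) by lia.
        apply (du_dt z _ (coef (2 * N + 2))). apply Hne. lra. }
    apply CInt_bound_abs.
    + apply contOn_path. intros tau Htau. eexists.
      eapply cderiv_mult; [apply cderiv_const|].
      eapply cderiv_mult; [apply cderiv_integrand|apply cderiv_att, Hne, Htau].
    + intros tau Htau. unfold F. rewrite !Cmod_mult, Hd, Rmult_1_l.
      specialize (H3 _ (Hrho tau Htau)).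
      destruct (Hpath tau Htau) as [_ [_ [_ Hf]]]. fold f in Hf.
      pose proof (Cmod_ge_0 (f (0 + RtoC tau * d)%C)).
      pose proof (Cmod_ge_0 (ev (att z (0 + RtoC tau * d)) (der dt (coef (2 * N + 2))))).
      rewrite <- (Rmult_1_l B2). apply Rmult_le_compat; assumption.
  - rewrite Rminus_0_r. apply Rmult_le_compat_r; assumption. }
eapply Rle_trans; [apply Cmod_triangle|]. rewrite Cmod_opp.
assert (HX0 : 0 <= X) by (eapply Rle_trans; [apply Cmod_ge_0|exact HX]).
assert (A4 : Cmod (T1 + J / RtoC (nu ^ (2 * N + 3))) <= (B1 + 2 * B2) / nu ^ (2 * N + 3)).
{ eapply Rle_trans; [apply Cmod_triangle|].
  rewrite (Cmod_div J) by (apply RtoC_pow_neq_0; lra).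
  rewrite Cmod_R, (Rabs_right (nu ^ (2 * N + 3))) by lra.
  apply (Rmult_le_compat_r (/ nu ^ (2 * N + 3))) in A3; [|apply Rlt_le, Rinv_0_lt_compat, Pn].
  unfold Rdiv in *. lra. }
assert (0 <= / nu ^ (2 * N + 3)) by (apply Rlt_le, Rinv_0_lt_compat, Pn).
assert (0 <= K1 / nu ^ (2 * N + 3)) by (unfold Rdiv; apply Rmult_le_pos; assumption).
assert (0 <= (B1 + 2 * B2) * X) by (apply Rmult_le_pos; lra).
unfold Rdiv in *. nra.
Qed.

(** * The expansion in the upper half-plane *)

(** Halving the exponent at each step of the induction on [n] and using
    [exp x >= x]. *)
Lemma exp_small (c : R) (n : nat) : 0 < c -> exists K, 0 <= K /\
  forall nu, 1 <= nu -> exp (- (c * nu)) <= K / nu ^ n.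
Proof.
revert c. induction n as [|n IH]; intros c Hc.
- exists 1. split; [lra|]. intros nu Hnu. simpl. rewrite Rdiv_1_r, <- exp_0. apply exp_le. nra.
- destruct (IH (c / 2) ltac:(lra)) as [K [HK H]].
  exists (K * (2 / c)).
  assert (H2c : 0 < 2 / c) by (apply Rdiv_lt_0_compat; lra).
  split; [nra|]. intros nu Hnu. specialize (H nu Hnu).
  replace (- (c * nu)) with (- (c / 2 * nu) + - (c / 2 * nu)) by field. rewrite exp_plus.
  assert (E : exp (- (c / 2 * nu)) <= 2 / c * / nu).
  { rewrite exp_Ropp. replace (2 / c * / nu) with (/ (c / 2 * nu)) by (field; lra).
    assert (0 < c / 2 * nu) by (apply Rmult_lt_0_compat; lra).
    apply Rinv_le_contravar; [assumption|]. pose proof (exp_ineq1_le (c / 2 * nu)). lra. }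
  apply Rle_trans with (K / nu ^ n * (2 / c * / nu)).
  + pose proof (exp_pos (- (c / 2 * nu))). apply Rmult_le_compat; lra.
  + right. simpl. field. repeat split; try lra. apply pow_nonzero. lra.
Qed.

(** The point is uniformity for large [z]: [z cosh t q = 1 - q] is bounded along
    with [q], and so is [p] where [sinh t] is at most comparable with [cosh t]. *)
Lemma att_bounds (z t : C) (m : R) : 0 < m -> m <= Cmod (1 + z * Ccosh t) ->
  Cmod (Csinh t) <= 2 * Cmod (Ccosh t) ->
  (1 + z * Ccosh t)%C <> 0%C /\ Cmod (att z t 0) <= 2 + 2 / m /\ Cmod (att z t 1) <= 2 + 2 / m.
Proof.
intros Hm H Hs.
assert (Hn : (1 + z * Ccosh t)%C <> 0%C) by (apply Cmod_gt_0; lra).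
assert (Hi : 0 < / m) by (apply Rinv_0_lt_compat, Hm).
assert (Hq : Cmod (/ (1 + z * Ccosh t)) <= / m).
{ rewrite Cmod_inv by exact Hn. apply Rinv_le_contravar; assumption. }
split; [exact Hn|]. unfold Rdiv. split; simpl.
- lra.
- unfold Cdiv. rewrite !Cmod_mult.
  assert (A : Cmod z * Cmod (Ccosh t) * Cmod (/ (1 + z * Ccosh t)) <= 1 + / m).
  { rewrite <- !Cmod_mult. replace (z * Ccosh t * / (1 + z * Ccosh t))%C
      with (1 + - / (1 + z * Ccosh t))%C by (field; exact Hn).
    eapply Rle_trans; [apply Cmod_triangle|]. rewrite Cmod_1, Cmod_opp. lra. }
  pose proof (Cmod_ge_0 z). pose proof (Cmod_ge_0 (/ (1 + z * Ccosh t))).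
  assert (Cmod z * Cmod (Csinh t) <= Cmod z * (2 * Cmod (Ccosh t))) by (apply Rmult_le_compat_l; assumption).
  apply Rle_trans with (Cmod z * (2 * Cmod (Ccosh t)) * Cmod (/ (1 + z * Ccosh t))); [|lra].
  apply Rmult_le_compat_r; assumption.
Qed.

Definition partial_sum (N : nat) (nu : R) (z : C) : C :=
  sum_n (fun s => (gcoef s z / RtoC (nu ^ (2 * s + 1)))%C) N.

Lemma path_imag (tau : R) : (0 + RtoC tau * Ci)%C = (0, tau).
Proof. apply injective_projections; simpl; ring. Qed.

Lemma path_real (tau : R) : (0 + RtoC tau * 1)%C = (tau, 0).
Proof. apply injective_projections; simpl; ring. Qed.

Lemma tail_bound (nu : R) (Z : C) : 0 < nu -> 0 <= Im Z -> Cmod (tail nu Z) <= / nu * exp (- Im Z).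
Proof.
intros Hnu HZ. unfold tail.
pose proof (exp_pos (- Im Z)) as P.
assert (H : Cmod (CIntInf (fun x => integrand nu Z (x, - (PI / 2))) -
   CInt (fun x => integrand nu Z (x, - (PI / 2))) 0 0) <= exp (- Im Z) / nu * exp (- (nu * 0))).
{ apply CIntInf_tail; try lra.
  - intros x. apply entire_rcont_h, entire_integrand.
  - intros x Hx. rewrite Cmod_integrand_bottom, <- exp_plus. apply exp_le.
    pose proof (cosh_ge_1 x). nra. }
rewrite Rmult_0_r, Ropp_0, exp_0, Rmult_1_r in H.
replace (CInt (fun x => integrand nu Z (x, - (PI / 2))) 0 0) with (RtoC 0) in H.
2:{ unfold CInt. rewrite RInt_point. reflexivity. }
unfold Cminus in H. rewrite <- RtoC_opp, Ropp_0, Cplus_0_r in H. unfold Rdiv in H. lra.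
Qed.

Lemma im_scal (nu : R) (z : C) : Im (RtoC nu * z) = nu * Im z.
Proof. destruct z; simpl; ring. Qed.

Lemma re_scal (nu : R) (z : C) : Re (RtoC nu * z) = nu * Re z.
Proof. destruct z; simpl; ring. Qed.

(** Away from the real axis the path may follow the imaginary axis, where
    [1 + z cos y] stays away from 0 until [y = - PI / 3]; there the integrand is
    already exponentially small. *)
Lemma upper_estimate_far (N : nat) (m : R) : 0 < m -> exists K, 0 <= K /\
  forall nu z, 1 <= nu -> m <= Im z ->
  Cmod (continued nu (RtoC nu * z) - partial_sum N nu z) <= K / nu ^ (2 * N + 3).
Proof.
intros Hm. pose proof PI_RGT_0 as HPI.
assert (HM : 1 <= 2 + 2 / (m / 2)).
{ assert (0 < 2 / (m / 2)) by (apply Rdiv_lt_0_compat; lra). lra. }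
destruct (segment_expansion N _ HM) as [K1 [HK1 H1]].
destruct (exp_small (m / 2) (2 * N + 3) ltac:(lra)) as [K2 [HK2 H2]].
exists (K1 + K1 * K2 + (PI / 6 + 1) * K2).
split; [assert (0 <= K1 * K2) by nra; assert (0 <= (PI / 6 + 1) * K2) by nra; lra|].
intros nu z Hnu Hz. specialize (H2 nu Hnu).
set (X := exp (- (m / 2 * nu))) in *.
set (f := integrand nu (RtoC nu * z)).
assert (Hsin : forall y, - (PI / 2) <= y <= - (PI / 3) -> sin y <= - (1 / 2)).
{ intros y Hy. apply Rle_trans with (sin (- (PI / 3))).
  - apply sin_incr_1; lra.
  - rewrite sin_neg, sin_PI3. assert (1 <= sqrt 3) by (rewrite <- sqrt_1; apply sqrt_le_1; lra). lra. }
assert (Hsmall : forall y, - (PI / 2) <= y <= - (PI / 3) -> Cmod (f (0, y)) <= X).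
{ intros y Hy. unfold f, X. rewrite Cmod_integrand, sinh_0, cosh_0, im_scal. apply exp_le.
  specialize (Hsin y Hy).
  assert (Ha : m * nu <= nu * Im z) by nra.
  assert (nu * Im z * sin y <= nu * Im z * - (1 / 2)) by (apply Rmult_le_compat_l; nra). lra. }
set (S0 := CInt (fun tau => Ci * f (0 + RtoC tau * Ci))%C 0 (- (PI / 3))).
assert (E1 : Cmod (S0 - partial_sum N nu z) <= K1 / nu ^ (2 * N + 3) + K1 * X).
{ apply H1; [exact Hnu|apply Cmod_Ci| | |].
  - rewrite Rabs_Ropp, Rabs_right by lra. pose proof PI_4. lra.
  - rewrite Rmin_right, Rmax_left by lra. intros y Hy. rewrite path_imag.
    assert (Hcos : 1 / 2 <= cos y).
    { rewrite <- cos_PI3. rewrite <- (cos_neg y). apply cos_decr_1; lra. }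
    assert (Hch : Ccosh (0, y) = RtoC (cos y)).
    { rewrite Ccosh_pair, cosh_0, sinh_0. apply injective_projections; simpl; ring. }
    assert (B : m / 2 <= Cmod (1 + z * Ccosh (0, y))).
    { rewrite Hch. eapply Rle_trans; [|apply im_le_Cmod]. eapply Rle_trans; [|apply Rle_abs].
      replace (Im (1 + z * RtoC (cos y))) with (Im z * cos y) by (destruct z; simpl; ring). nra. }
    destruct (att_bounds z (0, y) (m / 2) ltac:(lra) B) as [A1 [A2 A3]].
    + rewrite Hch, Csinh_pair, sinh_0, cosh_0, Cmod_R, Rabs_right by lra.
      eapply Rle_trans; [apply Cmod_le_abs|]. simpl. rewrite Rmult_0_l, Rabs_R0, Rmult_1_l.
      pose proof (SIN_bound y). assert (Rabs (sin y) <= 1) by (apply Rabs_le; lra). lra.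
    + repeat split; auto. rewrite Cmod_integrand, sinh_0, cosh_0, im_scal.
      replace 1 with (exp 0) at 2 by apply exp_0. apply exp_le.
      assert (sin y <= 0).
      { replace y with (- - y) by ring. rewrite sin_neg. pose proof (sin_ge_0 (- y)). lra. }
      assert (0 <= nu * Im z) by nra. nra.
  - rewrite path_imag. apply Hsmall. lra. }
set (R0 := CInt (fun y => f (0, y)) (- (PI / 2)) (- (PI / 3))).
assert (Hc : forall a b, contOn (fun y => f (0, y)) a b).
{ intros a b t _. apply entire_rcont_v, entire_integrand. }
assert (E2 : Cmod R0 <= PI / 6 * X).
{ replace (PI / 6) with (- (PI / 3) - - (PI / 2)) by field.
  apply CInt_bound; [lra|apply Hc|exact Hsmall]. }
assert (E3 : Cmod (tail nu (RtoC nu * z)) <= X).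
{ eapply Rle_trans; [apply tail_bound; [lra|rewrite im_scal; nra]|].
  rewrite im_scal. apply Rle_trans with (1 * exp (- (nu * Im z))).
  - apply Rmult_le_compat_r; [apply Rlt_le, exp_pos|]. rewrite <- Rinv_1. apply Rinv_le_contravar; lra.
  - rewrite Rmult_1_l. apply exp_le. nra. }
assert (E4 : (continued nu (RtoC nu * z) - partial_sum N nu z)%C =
  (tail nu (RtoC nu * z) - Ci * R0 + (S0 - partial_sum N nu z))%C).
{ unfold continued, vert. fold f.
  rewrite <- (CInt_Chasles (fun y => f (0, y)) (- (PI / 2)) (- (PI / 3)) 0) by apply Hc. fold R0.
  assert (S0' : S0 = (Ci * CInt (fun y => f (0, y)) 0 (- (PI / 3)))%C).
  { unfold S0. rewrite <- CInt_scal by apply Hc. apply CInt_ext. intros t _. rewrite path_imag. reflexivity. }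
  pose proof (CInt_Chasles (fun y => f (0, y)) 0 (- (PI / 3)) 0 (Hc _ _) (Hc _ _)) as Ch.
  replace (CInt (fun y => f (0, y)) 0 0) with (RtoC 0) in Ch
    by (unfold CInt; rewrite RInt_point; reflexivity).
  set (u := CInt (fun y => f (0, y)) 0 (- (PI / 3))) in *.
  set (v := CInt (fun y => f (0, y)) (- (PI / 3)) 0) in *.
  rewrite S0'. replace v with (- u)%C; [ring|].
  replace v with (u + v - u)%C by ring. rewrite Ch. ring. }
rewrite E4.
eapply Rle_trans; [apply Cmod_triangle|].
pose proof (Cmod_triangle (tail nu (RtoC nu * z)) (- (Ci * R0))) as T.
rewrite Cmod_opp, Cmod_mult, Cmod_Ci, Rmult_1_l in T.
fold (Cminus (tail nu (RtoC nu * z)) (Ci * R0)) in T.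
assert (P : K1 * X <= K1 * (K2 / nu ^ (2 * N + 3))) by (apply Rmult_le_compat_l; assumption).
assert (P' : (PI / 6 + 1) * X <= (PI / 6 + 1) * (K2 / nu ^ (2 * N + 3))) by (apply Rmult_le_compat_l; lra).
replace ((K1 + K1 * K2 + (PI / 6 + 1) * K2) / nu ^ (2 * N + 3)) with
  (K1 / nu ^ (2 * N + 3) + K1 * (K2 / nu ^ (2 * N + 3)) + (PI / 6 + 1) * (K2 / nu ^ (2 * N + 3)))
  by (unfold Rdiv; ring).
lra.
Qed.

(** Near the real axis, to the right of -1, the path starts along the positive
    real axis, on which [1 + z cosh x] stays away from 0 for small [x]; from
    [x = T] on the integrand is exponentially small. *)
Lemma upper_estimate_near (N : nat) (delta : R) : 0 < delta < 1 -> exists K, 0 <= K /\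
  forall nu z, 1 <= nu -> 0 < Im z -> -1 + delta / 2 <= Re z ->
  Cmod (continued nu (RtoC nu * z) - partial_sum N nu z) <= K / nu ^ (2 * N + 3).
Proof.
intros Hdel. pose proof PI_RGT_0 as HPI. pose proof PI_4 as HPI4.
assert (HT : exists T, 0 < T <= 1 /\ forall x, 0 <= x <= T -> cosh x <= 1 + delta / 4).
{ assert (Hcont : continuity_pt cosh 0) by (apply derivable_continuous_pt, derivable_pt_cosh).
  destruct (Hcont (delta / 4) ltac:(lra)) as [a [Ha1 Ha2]].
  exists (Rmin 1 (a / 2)). split.
  { split; [apply Rmin_pos; lra|apply Rmin_l]. }
  intros x Hx. pose proof (Rmin_r 1 (a / 2)).
  destruct (Req_dec x 0) as [->|Hx0]; [rewrite cosh_0; lra|].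
  specialize (Ha2 x). simpl in Ha2. unfold R_dist, D_x, no_cond in Ha2. rewrite cosh_0 in Ha2.
  assert (Rabs (cosh x - 1) < delta / 4).
  { apply Ha2. split; [split; [trivial|auto]|]. rewrite Rminus_0_r, Rabs_right; lra. }
  pose proof (Rle_abs (cosh x - 1)). lra. }
destruct HT as [T [HT1 HT2]].
assert (Hsh : forall x, 0 <= x <= T -> sinh x <= (1 + delta / 4) * x).
{ intros x Hx. destruct (MVT_gen sinh 0 x cosh) as [c [Hc1 Hc2]].
  - intros. apply is_derive_Reals, derivable_pt_lim_sinh.
  - intros. apply derivable_continuous_pt, derivable_pt_sinh.
  - rewrite Rmin_left, Rmax_right in Hc1 by lra.
    rewrite sinh_0, !Rminus_0_r in Hc2. rewrite Hc2. apply Rmult_le_compat_r; [lra|]. apply HT2. lra. }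
assert (HM : 1 <= 2 + 2 / (delta / 4)).
{ assert (0 < 2 / (delta / 4)) by (apply Rdiv_lt_0_compat; lra). lra. }
destruct (segment_expansion N _ HM) as [K1 [HK1 H1]].
destruct (exp_small (T * delta / 4) (2 * N + 3) ltac:(nra)) as [K2 [HK2 H2]].
exists (K1 + K1 * K2 + (PI / 2 + 1) * K2).
split; [assert (0 <= K1 * K2) by nra; assert (0 <= (PI / 2 + 1) * K2) by nra; lra|].
intros nu z Hnu Hz Hre. specialize (H2 nu Hnu).
set (X := exp (- (T * delta / 4 * nu))) in *.
set (f := integrand nu (RtoC nu * z)).
assert (Hre_sinh : forall x c, 0 <= x <= T -> 0 <= c <= 1 -> x * delta / 4 <= x + Re z * (sinh x * c)).
{ intros x c Hx Hcc. specialize (Hsh x Hx). pose proof (sinh_nonneg x ltac:(lra)) as Hs0.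
  assert (Hsc : 0 <= sinh x * c <= (1 + delta / 4) * x) by nra.
  destruct (Rle_dec 0 (Re z)) as [Hp|Hp].
  - assert (0 <= Re z * (sinh x * c)) by (apply Rmult_le_pos; lra). nra.
  - assert (Re z * (sinh x * c) >= - (1 - delta / 2) * ((1 + delta / 4) * x)) by nra. nra. }
set (S0 := CInt (fun tau => 1 * f (0 + RtoC tau * 1))%C 0 T).
assert (E1 : Cmod (S0 - partial_sum N nu z) <= K1 / nu ^ (2 * N + 3) + K1 * X).
{ apply H1; [exact Hnu|apply Cmod_1| | |].
  - rewrite Rabs_right by lra. lra.
  - rewrite Rmin_left, Rmax_right by lra. intros x Hx. rewrite path_real.
    pose proof (HT2 x Hx) as Hcx. pose proof (cosh_ge_1 x) as Hc1.
    assert (Hch : Ccosh (x, 0) = RtoC (cosh x)).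
    { rewrite Ccosh_pair, cos_0, sin_0. apply injective_projections; simpl; ring. }
    assert (B : delta / 4 <= Cmod (1 + z * Ccosh (x, 0))).
    { rewrite Hch. eapply Rle_trans; [|apply re_le_Cmod]. eapply Rle_trans; [|apply Rle_abs].
      replace (Re (1 + z * RtoC (cosh x))) with (1 + Re z * cosh x) by (destruct z; simpl; ring).
      destruct (Rle_dec 0 (Re z)) as [Hp|Hp]; [nra|].
      assert (Re z * cosh x >= - (1 - delta / 2) * (1 + delta / 4)) by nra. nra. }
    destruct (att_bounds z (x, 0) (delta / 4) ltac:(lra) B) as [A1 [A2 A3]].
    + rewrite Hch, Csinh_pair, cos_0, sin_0, Cmod_R, Rabs_right by lra.
      eapply Rle_trans; [apply Cmod_le_abs|]. simpl. rewrite Rmult_0_r, Rabs_R0, Rmult_1_r, Rplus_0_r.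
      rewrite Rabs_right by (apply Rle_ge, sinh_nonneg; lra).
      pose proof (Hsh x Hx). nra.
    + repeat split; auto. rewrite Cmod_integrand, cos_0, sin_0, re_scal.
      replace 1 with (exp 0) at 2 by apply exp_0. apply exp_le.
      pose proof (Hre_sinh x 1 Hx ltac:(lra)).
      assert (0 <= x * delta / 4) by nra. nra.
  - rewrite path_real, Cmod_integrand, cos_0, sin_0, re_scal. unfold X. apply exp_le.
    pose proof (Hre_sinh T 1 ltac:(lra) ltac:(lra)). nra. }
assert (E2 : Cmod (vert nu (RtoC nu * z) T) <= PI / 2 * X).
{ unfold vert. replace (PI / 2 * X) with ((0 - - (PI / 2)) * X) by ring.
  apply CInt_bound; [lra| |].
  - intros t _. apply entire_rcont_v, entire_integrand.
  - intros y Hy. rewrite Cmod_integrand, re_scal, im_scal. unfold X. apply exp_le.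
    assert (Hcy : 0 <= cos y) by (apply cos_ge_0; lra). pose proof (COS_bound y) as Hcb.
    assert (Hsy : sin y <= 0).
    { replace y with (- - y) by ring. rewrite sin_neg. pose proof (sin_ge_0 (- y)). lra. }
    pose proof (Hre_sinh T (cos y) ltac:(lra) ltac:(lra)) as Hr.
    pose proof (cosh_ge_1 T).
    assert (nu * Im z * (cosh T * sin y) <= 0).
    { assert (cosh T * sin y <= 0) by nra. assert (0 <= nu * Im z) by nra. nra. }
    nra. }
pose proof (continued_shift nu ltac:(lra) (RtoC nu * z) T ltac:(rewrite im_scal; nra) ltac:(lra)) as E3.
assert (E3' : / nu * exp (- (nu * T)) <= X).
{ apply Rle_trans with (1 * exp (- (nu * T))).
  - apply Rmult_le_compat_r; [apply Rlt_le, exp_pos|]. rewrite <- Rinv_1. apply Rinv_le_contravar; lra.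
  - rewrite Rmult_1_l. unfold X. apply exp_le.
    assert (0 < nu * T) by nra. nra. }
assert (S0' : CInt (fun x => integrand nu (RtoC nu * z) (x, 0)) 0 T = S0).
{ unfold S0. apply CInt_ext. intros t _. rewrite path_real. fold f. ring. }
rewrite S0' in E3.
set (V := vert nu (RtoC nu * z) T) in *. set (B := continued nu (RtoC nu * z)) in *.
replace (B - partial_sum N nu z)%C
  with ((B - (S0 - Ci * V)) + (- (Ci * V) + (S0 - partial_sum N nu z)))%C by ring.
eapply Rle_trans; [apply Cmod_triangle|].
pose proof (Cmod_triangle (- (Ci * V)) (S0 - partial_sum N nu z)) as Tr.
rewrite Cmod_opp, Cmod_mult, Cmod_Ci, Rmult_1_l in Tr.
assert (P : K1 * X <= K1 * (K2 / nu ^ (2 * N + 3))) by (apply Rmult_le_compat_l; assumption).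
assert (P' : (PI / 2 + 1) * X <= (PI / 2 + 1) * (K2 / nu ^ (2 * N + 3))) by (apply Rmult_le_compat_l; lra).
replace ((K1 + K1 * K2 + (PI / 2 + 1) * K2) / nu ^ (2 * N + 3)) with
  (K1 / nu ^ (2 * N + 3) + K1 * (K2 / nu ^ (2 * N + 3)) + (PI / 2 + 1) * (K2 / nu ^ (2 * N + 3)))
  by (unfold Rdiv; ring).
lra.
Qed.

(** * Reflection in the real axis *)

Lemma cderiv_conj (f : C -> C) (z l : C) :
  cderiv f (Cconj z) l -> cderiv (fun w => Cconj (f (Cconj w))) z (Cconj l).
Proof.
intros H. apply cderiv_eps. intros eps He.
destruct (proj1 (cderiv_eps f _ l) H eps He) as [d [Hd Hd']].
exists d. split; [exact Hd|]. intros w Hw.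
assert (E : Cmod (Cconj w - Cconj z) = Cmod (w - z)).
{ rewrite <- Cminus_conj. apply Cmod_conj. }
rewrite <- E in *. specialize (Hd' _ Hw).
rewrite <- Cmod_conj in Hd'. rewrite !Cminus_conj, Cmult_conj, Cminus_conj, !Cconj_conj in Hd'.
exact Hd'.
Qed.

Lemma CInt_conj (f : R -> C) (a b : R) : contOn f a b ->
  CInt (fun t => Cconj (f t)) a b = Cconj (CInt f a b).
Proof.
intros Hc. apply CInt_unique. pose proof (is_CInt f a b Hc) as H.
pose proof (is_RInt_fct_extend_fst (U := R_NormedModule) (V := R_NormedModule) f a b _ H) as H1.
pose proof (is_RInt_fct_extend_snd (U := R_NormedModule) (V := R_NormedModule) f a b _ H) as H2.
apply (is_RInt_fct_extend_pair (U := R_NormedModule) (V := R_NormedModule)).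
- exact H1.
- exact (is_RInt_opp (V := R_NormedModule) _ _ _ _ H2).
Qed.

Lemma Cexp_conj (z : C) : Cexp (Cconj z) = Cconj (Cexp z).
Proof.
destruct z as [x y]. unfold Cexp, Cconj. simpl. rewrite cos_neg, sin_neg. apply injective_projections; simpl; ring.
Qed.

Lemma integrand_conj (nu : R) (Z : C) (x : R) :
  integrand nu (Cconj Z) (x, 0) = Cconj (integrand nu Z (x, 0)).
Proof.
unfold integrand. rewrite <- Cexp_conj. f_equal. rewrite Csinh_pair, cos_0, sin_0.
destruct Z. apply injective_projections; simpl; ring.
Qed.

Fixpoint real_expr (e : expr) : Prop :=
  match e with
  | Var _ => True
  | Cst c => Cconj c = c
  | Add a b | Mul a b => real_expr a /\ real_expr b
  end.

Lemma der_real (d : nat -> expr) (e : expr) : (forall i, real_expr (d i)) -> real_expr e ->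
  real_expr (der d e).
Proof.
intros Hd. induction e as [i|c|a Ha b Hb|a Ha b Hb]; simpl; intros H; auto.
- apply injective_projections; simpl; ring.
- tauto.
- tauto.
Qed.

(** The coefficients inherit real constants from [du], so that the partial sums
    commute with conjugation. *)
Lemma coef_real (k : nat) : real_expr (coef k).
Proof.
induction k as [|k IH]; [exact I|]. simpl. apply der_real; [|exact IH].
intros [|[|i]]; simpl; repeat split; apply injective_projections; simpl; ring.
Qed.

Lemma ev_conj (rho : nat -> C) (e : expr) : real_expr e ->
  ev (fun i => Cconj (rho i)) e = Cconj (ev rho e).
Proof.
induction e as [i|c|a Ha b Hb|a Ha b Hb]; simpl; intros H.
- reflexivity.
- symmetry. exact H.
- rewrite Ha, Hb, Cplus_conj by tauto. reflexivity.
- rewrite Ha, Hb, Cmult_conj by tauto. reflexivity.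
Qed.

Lemma Cconj_R (x : R) : Cconj (RtoC x) = RtoC x.
Proof. apply injective_projections; simpl; ring. Qed.

Lemma ev_ext (rho sigma : nat -> C) (e : expr) : (forall i, rho i = sigma i) -> ev rho e = ev sigma e.
Proof. intros H. induction e; simpl; congruence. Qed.

Lemma gcoef_conj (s : nat) (z : C) : (1 + z)%C <> 0%C -> gcoef s (Cconj z) = Cconj (gcoef s z).
Proof.
intros Hz. unfold gcoef. rewrite <- ev_conj by apply coef_real. apply ev_ext.
intros [|[|i]]; simpl.
- rewrite Cinv_conj by exact Hz. rewrite Cplus_conj, Cconj_R. reflexivity.
- rewrite Cconj_R. reflexivity.
- rewrite Cconj_R. reflexivity.
Qed.

Lemma partial_sum_conj (N : nat) (nu : R) (z : C) : 0 < nu -> (1 + z)%C <> 0%C ->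
  partial_sum N nu (Cconj z) = Cconj (partial_sum N nu z).
Proof.
intros Hnu Hz. unfold partial_sum.
assert (T : forall s, (gcoef s (Cconj z) / RtoC (nu ^ (2 * s + 1)))%C
  = Cconj (gcoef s z / RtoC (nu ^ (2 * s + 1)))).
{ intros s. rewrite gcoef_conj by exact Hz. rewrite Cdiv_conj by (apply RtoC_pow_neq_0, Hnu).
  rewrite Cconj_R. reflexivity. }
induction N as [|N IH].
- rewrite !sum_O. apply T.
- rewrite !sum_Sn. rewrite IH, T. symmetry. apply Cplus_conj.
Qed.

(** * Continuity up to the real axis *)

Lemma gcoef_cderiv (s : nat) (z : C) : (1 + z)%C <> 0%C -> exists l, cderiv (gcoef s) z l.
Proof.
intros Hz. eexists. unfold gcoef.
apply (ev_chain (fun i => match i with 0%nat => neg (Mul vq vq) | _ => Cst 0 end)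
  (fun w => at0 (/ (1 + w)) 1) 1%C z).
intros [|[|i]]; simpl.
- eapply cderiv_val; [apply (cderiv_inv (fun w => 1 + w)%C); [exact Hz|cder]|].
  cbv beta. field. exact Hz.
- eapply cderiv_val; [apply cderiv_const|ring].
- eapply cderiv_val; [apply cderiv_const|ring].
Qed.

Lemma partial_sum_cderiv (N : nat) (nu : R) (z : C) : (1 + z)%C <> 0%C ->
  exists l, cderiv (partial_sum N nu) z l.
Proof.
intros Hz.
assert (T : forall s, exists l, cderiv (fun z => gcoef s z / RtoC (nu ^ (2 * s + 1)))%C z l).
{ intros s. destruct (gcoef_cderiv s z Hz) as [l Hl]. eexists. unfold Cdiv.
  eapply cderiv_mult; [exact Hl|apply cderiv_const]. }
induction N as [|N [m Hm]].
- destruct (T 0%nat) as [l Hl]. exists l.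
  apply (cderiv_ext (fun z => gcoef 0 z / RtoC (nu ^ (2 * 0 + 1)))%C); [|exact Hl].
  intros w. unfold partial_sum. rewrite sum_O. reflexivity.
- destruct (T (S N)) as [l Hl]. eexists.
  apply (cderiv_ext (fun z => partial_sum N nu z + gcoef (S N) z / RtoC (nu ^ (2 * S N + 1)))%C).
  + intros w. unfold partial_sum. rewrite sum_Sn. reflexivity.
  + eapply cderiv_plus; [exact Hm|exact Hl].
Qed.

Lemma within_Cmod (D : C -> Prop) (f : C -> C) (z l : C) :
  filterlim f (within D (locally z)) (locally l) ->
  forall eps, 0 < eps -> exists d, 0 < d /\ forall w, Cmod (w - z) < d -> D w -> Cmod (f w - l) < eps.
Proof.
intros H eps He.
pose proof (proj1 (filterlim_Cmod (within D (locally z)) f l) H eps He) as Hw.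
unfold within in Hw. apply locally_C in Hw. destruct Hw as [d Hd].
exists d. split; [apply cond_pos|]. intros w Hw. exact (Hd w Hw).
Qed.

Section AngerWeber.
Variables (nu : R) (A : C -> C).
Hypothesis Hnu : 0 < nu.
Hypothesis HA : is_anger_weber nu A.

Lemma anger_weber_cderiv (z : C) : slit_plane z -> exists l, cderiv A z l.
Proof. intros H. exact (proj1 (proj2 HA) z H). Qed.

Lemma anger_weber_integral (Z : C) : 0 < Re Z ->
  tends (fun T => CInt (fun x => integrand nu Z (x, 0)) 0 T) (RtoC PI * A Z)%C.
Proof.
intros HZ. pose proof (is_RInt_gen_tends _ _ (proj1 HA Z HZ)) as H.
intros eps He. destruct (H eps He) as [M HM]. exists M. intros T HT. specialize (HM T HT).
erewrite CInt_ext; [exact HM|]. intros x _. unfold integrand. cbv beta. do 2 f_equal.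
- f_equal. rewrite RtoC_mult. f_equal.
- f_equal. rewrite Csinh_pair, cos_0, sin_0. apply injective_projections; simpl; ring.
Qed.

Lemma anger_weber_upper (Z : C) : 0 < Im Z -> (RtoC PI * A Z)%C = continued nu Z.
Proof.
apply (continued_unique nu Hnu (fun Z => RtoC PI * A Z)%C).
- intros W HW. destruct (anger_weber_cderiv W) as [l Hl]; [left; lra|].
  eexists. eapply cderiv_mult; [apply cderiv_const|exact Hl].
- intros W HW. apply anger_weber_integral, HW.
Qed.

(** The reflected function [Cconj (A (Cconj Z))] continues the same integral. *)
Lemma anger_weber_lower (Z : C) : Im Z < 0 -> (RtoC PI * A Z)%C = Cconj (continued nu (Cconj Z)).
Proof.
intros HZ.
rewrite <- (continued_unique nu Hnu (fun Z => Cconj (RtoC PI * A (Cconj Z)))%C).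
- rewrite !Cconj_conj. reflexivity.
- intros W HW. destruct (anger_weber_cderiv (Cconj W)) as [l Hl]; [left; change (- Im W <> 0); lra|].
  eexists. apply (cderiv_conj (fun z => RtoC PI * A z)%C).
  eapply cderiv_mult; [apply cderiv_const|exact Hl].
- intros W HW. assert (HW' : 0 < Re (Cconj W)) by exact HW.
  intros eps He. destruct (anger_weber_integral (Cconj W) HW' eps He) as [M HM].
  exists M. intros T HT. specialize (HM T HT).
  rewrite <- Cmod_conj in HM. rewrite Cminus_conj in HM.
  rewrite <- CInt_conj in HM.
  2:{ intros t _. apply entire_rcont_h, entire_integrand. }
  erewrite CInt_ext; [exact HM|]. intros x _. cbv beta. rewrite <- integrand_conj, Cconj_conj. reflexivity.
- change (0 < - Im Z). lra.
Qed.

Lemma anger_weber_from_above (x : R) : forall eps, 0 < eps -> exists d, 0 < d /\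
  forall w, 0 < Im w -> Cmod (w - RtoC x) < d -> Cmod (A w - A (RtoC x)) < eps.
Proof.
intros eps He. destruct HA as [_ [_ [Hcut H0]]].
destruct (Rtotal_order x 0) as [Hx|[->|Hx]].
- destruct (within_Cmod _ _ _ _ (Hcut x Hx) eps He) as [d [Hd Hd']].
  exists d. split; [exact Hd|]. intros w H1 H2. apply Hd'; assumption.
- destruct (within_Cmod _ _ _ _ H0 eps He) as [d [Hd Hd']].
  exists d. split; [exact Hd|]. intros w H1 H2. apply Hd'; [exact H2|]. left. lra.
- destruct (anger_weber_cderiv (RtoC x)) as [l Hl]; [right; exact Hx|].
  destruct (cderiv_continuous _ _ _ Hl eps He) as [d [Hd Hd']].
  exists d. split; [exact Hd|]. intros w _ Hw. apply Hd', Hw.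
Qed.

(** Both terms are continuous from above at points of the real axis to the right
    of -1; on the cut and at 0 this is part of the definition of [A]. *)
Lemma estimate_from_above (N : nat) (x r B : R) : -1 < x -> 0 < r ->
  (forall w, 0 < Im w -> Cmod (w - RtoC x) < r ->
     Cmod (RtoC PI * A (RtoC nu * w)%C - partial_sum N nu w) <= B) ->
  Cmod (RtoC PI * A (RtoC nu * RtoC x)%C - partial_sum N nu (RtoC x)) <= B.
Proof.
intros Hx Hr H. pose proof PI_RGT_0 as HPI. apply le_epsilon. intros e He.
assert (Hx1 : (1 + RtoC x)%C <> 0%C).
{ rewrite <- RtoC_plus. intros E. apply RtoC_inj in E. lra. }
destruct (partial_sum_cderiv N nu (RtoC x) Hx1) as [l Hl].
destruct (cderiv_continuous _ _ _ Hl (e / 2) ltac:(lra)) as [d1 [Hd1 H1]].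
assert (He2 : 0 < e / 2 / PI) by (apply Rdiv_lt_0_compat; lra).
destruct (anger_weber_from_above (nu * x) _ He2) as [d2 [Hd2 H2]].
assert (Hd2n : 0 < d2 / nu) by (apply Rdiv_lt_0_compat; assumption).
set (y := Rmin r (Rmin d1 (d2 / nu)) / 2).
assert (Hy : 0 < y < r /\ y < d1 /\ y < d2 / nu).
{ unfold y. pose proof (Rmin_l r (Rmin d1 (d2 / nu))). pose proof (Rmin_r r (Rmin d1 (d2 / nu))).
  pose proof (Rmin_l d1 (d2 / nu)). pose proof (Rmin_r d1 (d2 / nu)).
  assert (0 < Rmin r (Rmin d1 (d2 / nu))) by (repeat apply Rmin_pos; assumption). lra. }
assert (Hw : Cmod ((x, y) - RtoC x) = y).
{ replace ((x, y) - RtoC x)%C with (RtoC y * Ci)%C by (apply injective_projections; simpl; ring).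
  rewrite Cmod_mult, Cmod_R, Cmod_Ci, Rabs_right; lra. }
specialize (H (x, y)). specialize (H1 (x, y)). rewrite Hw in H, H1.
specialize (H ltac:(simpl; lra) ltac:(lra)). specialize (H1 ltac:(lra)).
specialize (H2 (RtoC nu * (x, y))%C).
assert (Hn : Cmod (RtoC nu * (x, y) - RtoC (nu * x)) < d2).
{ rewrite RtoC_mult. replace (RtoC nu * (x, y) - RtoC nu * RtoC x)%C with (RtoC nu * ((x, y) - RtoC x))%C by ring.
  rewrite Cmod_mult, Hw, Cmod_R, Rabs_right by lra.
  destruct Hy as [_ [_ Hy]]. apply (Rmult_lt_compat_l nu) in Hy; [|exact Hnu].
  replace (nu * (d2 / nu)) with d2 in Hy by (field; lra). exact Hy. }
specialize (H2 ltac:(simpl; nra) Hn). rewrite RtoC_mult in H2.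
set (a := A (RtoC nu * (x, y))%C) in *. set (a0 := A (RtoC nu * RtoC x)%C) in *.
set (p := partial_sum N nu (x, y)) in *. set (p0 := partial_sum N nu (RtoC x)) in *.
replace (RtoC PI * a0 - p0)%C with ((RtoC PI * a - p) + (- (RtoC PI * (a - a0)) + (p - p0)))%C by ring.
eapply Rle_trans; [apply Cmod_triangle|].
pose proof (Cmod_triangle (- (RtoC PI * (a - a0))) (p - p0)) as T.
rewrite Cmod_opp, Cmod_mult, Cmod_R, Rabs_right in T by lra.
apply (Rmult_lt_compat_l PI) in H2; [|lra].
replace (PI * (e / 2 / PI)) with (e / 2) in H2 by (field; lra). lra.
Qed.
End AngerWeber.

Lemma Sdom_cases (delta : R) (z : C) : 0 < delta -> Sdom delta z ->
  delta / 2 <= Rabs (Im z) \/ -1 + delta / 2 < Re z.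
Proof.
intros Hd H. destruct (Rle_dec (delta / 2) (Rabs (Im z))) as [Hi|Hi]; [left; exact Hi|right].
apply Rnot_le_lt. intros Hre.
set (x := Rmin (-1) (Re z)).
specialize (H x (Rmin_l _ _)).
assert (Cmod (z - RtoC x) <= Rabs (Re z - x) + Rabs (Im z)).
{ eapply Rle_trans; [apply Cmod_le_abs|]. destruct z as [u v]. simpl.
  replace (u + - x) with (u - x) by ring. replace (v + - 0) with v by ring. lra. }
assert (Rabs (Re z - x) <= delta / 2).
{ unfold x, Rmin. destruct (Rle_dec (-1) (Re z)); apply Rabs_le; lra. }
lra.
Qed.

Theorem theorem4p1 :
  exists g : nat -> C -> C,
    (forall s : nat, rational_with_poles (g s) (fun z => z = RtoC (-1))) /\
    (forall (s : nat) (z : C),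
       slit_plane z -> z <> RtoC 1 -> Gminus s z = g s z) /\
    (forall A : R -> C -> C,
       (forall nu : R, 0 < nu -> is_anger_weber nu (A nu)) ->
       forall delta : R, 0 < delta < 1 ->
         uniform_expansion (Sdom delta) (fun nu z => A nu (RtoC nu * z)%C) g).
Proof.
exists gcoef. split; [exact gcoef_rational|]. split; [exact Gminus_gcoef|].
intros A HA delta Hdelta N. pose proof PI_RGT_0 as HPI.
destruct (upper_estimate_far N (delta / 2) ltac:(lra)) as [K1 [HK1 H1]].
destruct (upper_estimate_near N delta Hdelta) as [K2 [HK2 H2]].
exists ((K1 + K2) / PI), 1. split; [lra|]. intros nu z Hnu Hz.
pose proof (HA nu ltac:(lra)) as HAn.
assert (Pn : 0 < / nu ^ (2 * N + 3)) by (apply Rinv_0_lt_compat, pow_lt; lra).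
set (B := (K1 + K2) / nu ^ (2 * N + 3)).
assert (Hup : forall w, 0 < Im w -> delta / 2 <= Im w \/ -1 + delta / 2 <= Re w ->
  Cmod (continued nu (RtoC nu * w) - partial_sum N nu w) <= B).
{ intros w Hw [Hc|Hc].
  - eapply Rle_trans; [apply H1; assumption|]. unfold B, Rdiv. nra.
  - eapply Rle_trans; [apply H2; assumption|]. unfold B, Rdiv. nra. }
assert (Main : Cmod (RtoC PI * A nu (RtoC nu * z)%C - partial_sum N nu z) <= B).
{ pose proof (Sdom_cases delta z ltac:(lra) Hz) as Hcase.
  destruct (Rtotal_order (Im z) 0) as [Hi|[Hi|Hi]].
  - rewrite (anger_weber_lower nu (A nu) ltac:(lra) HAn) by (rewrite im_scal; nra).
    replace (Cconj (RtoC nu * z)) with (RtoC nu * Cconj z)%C by (rewrite Cmult_conj, Cconj_R; reflexivity).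
    assert (Hz1 : (1 + z)%C <> 0%C).
    { apply one_plus_neq_0. intros ->. simpl in Hi. lra. }
    rewrite <- (Cconj_conj (partial_sum N nu z)), <- partial_sum_conj by (assumption || lra).
    rewrite <- Cminus_conj, Cmod_conj. apply Hup; [change (0 < - Im z); lra|].
    change (Im (Cconj z)) with (- Im z). change (Re (Cconj z)) with (Re z). rewrite Rabs_left in Hcase by exact Hi.
    destruct Hcase as [Hc|Hc]; [left; lra|right; lra].
  - assert (Ez : z = RtoC (Re z)) by (destruct z; simpl in *; subst; reflexivity).
    rewrite Hi, Rabs_R0 in Hcase. destruct Hcase as [Hc|Hc]; [lra|].
    rewrite Ez.
    apply (estimate_from_above nu (A nu) ltac:(lra) HAn N (Re z) (Re z + 1 - delta / 2)); [lra|lra|].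
    intros w Hw Hd. rewrite (anger_weber_upper nu (A nu) ltac:(lra) HAn) by (rewrite im_scal; nra).
    apply Hup; [exact Hw|]. right.
    pose proof (re_le_Cmod (w - RtoC (Re z))) as Hr.
    replace (Re (w - RtoC (Re z))) with (Re w - Re z) in Hr by (destruct w; simpl; ring).
    assert (Ha : Rabs (Re w - Re z) < Re z + 1 - delta / 2) by lra. apply Rabs_def2 in Ha. lra.
  - rewrite (anger_weber_upper nu (A nu) ltac:(lra) HAn) by (rewrite im_scal; nra).
    apply Hup; [exact Hi|]. rewrite Rabs_right in Hcase by lra.
    destruct Hcase as [Hc|Hc]; [left; exact Hc|right; lra]. }
fold (partial_sum N nu z).
assert (HPC : RtoC PI <> 0%C) by (intros E; apply RtoC_inj in E; lra).
replace (A nu (RtoC nu * z) - RtoC (/ PI) * partial_sum N nu z)%C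
  with (RtoC (/ PI) * (RtoC PI * A nu (RtoC nu * z)%C - partial_sum N nu z))%C.
2:{ rewrite RtoC_inv by lra. field. exact HPC. }
rewrite Cmod_mult, Cmod_R, Rabs_right by (apply Rle_ge, Rlt_le, Rinv_0_lt_compat, HPI).
replace ((K1 + K2) / PI / nu ^ (2 * N + 3)) with (/ PI * B) by (unfold B, Rdiv; ring).
apply Rmult_le_compat_l; [apply Rlt_le, Rinv_0_lt_compat, HPI|exact Main].
Qed.
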